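(* Suppose that $a>0$, $b\in\mathbb{R}$ and $\psi\in C([-1,0];\mathbb{R})$. Let $X$ be the unique continuous adapted process satisfying $$dX(t)=\Big(aX(t)+\frac{b}{1+t}\int_{-1}^t X(s)\,ds\Big)\,dt+\sigma\,dB(t),\quad t\ge 0;\qquad X(t)=\psi(t),\quad t\in[-1,0].$$ Then: (a) There exists an $\mathcal{F}^B(\infty)$-measurable normal random variable $C$ such that $$\lim_{t\to\infty}\frac{X(t)}{e^{at}t^{b/a}}=C,\quad\text{a.s.}$$ (b) $C$ is given by $$C=a^{\frac ba}\Big\{a\psi(0)\,U\big(1+\tfrac ba,2,a\big)+b\int_{-1}^0\psi(s)\,ds\;U\big(1+\tfrac ba,1,a\big)\Big\}+\sigma a^{1+\frac ba}\int_0^\infty e^{-as}(1+s)\,U\big(1+\tfrac ba,2,a(1+s)\big)\,dB(s).$$ (c) The mean and variance of $C$ are $$\mathbb{E}[C]=a^{\frac ba}\Big\{a\psi(0)\,U\big(1+\tfrac ba,2,a\big)+b\int_{-1}^0\psi(s)\,ds\;U\big(1+\tfrac ba,1,a\big)\Big\},$$ $$\mathrm{Var}[C]=\sigma^2a^{2+\frac{2b}{a}}\int_0^\infty e^{-2as}(1+s)^2\,U\big(1+\tfrac ba,2,a(1+s)\big)^2\,ds>0.$$ (d) The mean and variance of $X$ satisfy $$\lim_{t\to\infty}\frac{\mathbb{E}[X(t)]}{e^{at}t^{b/a}}=\mathbb{E}[C],\qquad\lim_{t\to\infty}\frac{\mathrm{Var}[X(t)]}{e^{2at}t^{2b/a}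}=\mathrm{Var}[C].$$
   Context: $\sigma>0$, $\psi$ is deterministic, and $B$ is a standard one-dimensional Brownian motion on a complete probability space with a filtration satisfying the usual conditions, to which $B$ is adapted. $\mathcal{F}^B(\infty)$ is the (completed) $\sigma$-algebra generated by $\{B(s):s\ge0\}$. ''a.s.'' means almost surely. $U(\alpha,\beta,z)$ denotes the Tricomi confluent hypergeometric function: for real $\alpha,\beta$ and $z>0$ it is the solution of Kummer's equation $z w''(z)+(\beta-z)w'(z)-\alpha w(z)=0$ determined by $z^{\alpha}U(\alpha,\beta,z)\to1$ as $z\to\infty$. *)

(* Defs.v *)
From HB Require Import structures.
From mathcomp Require Import all_boot all_order all_algebra.
From mathcomp Require Import all_classical all_reals all_analysis.

Set Implicit Arguments.
Unset Strict Implicit.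
Unset Printing Implicit Defensive.

Import Order.TTheory GRing.Theory Num.Theory.
Import numFieldNormedType.Exports.

Local Open Scope classical_set_scope.
Local Open Scope ring_scope.

(* Kummer's equation on ]0, +oo[ together with the normalization at infinity
   that singles out the solution U(alpha, beta, .). *)
Definition is_tricomi (R : realType) (alpha beta : R) (w : R -> R) : Prop :=
  (forall z, 0 < z ->
     [/\ derivable w z 1, derivable (w^`())%classic z 1 &
         z * (w^`(2))%classic z + (beta - z) * (w^`())%classic z
           - alpha * w z = 0]) /\
  z `^ alpha * w z @[z --> +oo] --> (1 : R).

(* [is_tricomi] determines w on ]0, +oo[ only: the values of [tricomiU] at
   nonpositive arguments are meaningless. *)
Definition tricomiU (R : realType) (alpha beta : R) : R -> R :=
  xget (cst 0) [set w | is_tricomi alpha beta w].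

Definition measurable_wrt (T : Type) (R : realType) (G : set (set T))
    (f : T -> R) : Prop :=
  forall A : set R, measurable A -> G (f @^-1` A).

Section processes.
Context (d : measure_display) (T : measurableType d) (R : realType)
  (P : probability T R).

(* The time set is [0, +oo[: filtrations and processes indexed by R are only
   constrained at nonnegative times. *)
Definition usual_filtration (F : R -> set (set T)) : Prop :=
  [/\ forall t, 0 <= t -> sigma_algebra setT (F t) /\ F t `<=` measurable,
      forall s t, 0 <= s -> s <= t -> F s `<=` F t,
      forall t, 0 <= t -> F t = \bigcap_(s in `]t, +oo[) F s &
      forall N, P.-negligible N -> F 0 N].

Definition adapted (F : R -> set (set T)) (Y : R -> T -> R) : Prop :=
  forall t, 0 <= t -> measurable_wrt (F t) (Y t).

(* The third clause is the mutual independence of the increments along any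
   finite nondecreasing list of times t 0, ..., t n (only these terms of the
   sequence t matter); taking some A i := setT covers subfamilies. *)
Definition brownian_motion (B : R -> T -> R) : Prop :=
  [/\ forall t, 0 <= t -> measurable_fun setT (B t),
      {ae P, forall w, B 0 w = 0},
      forall (n : nat) (t : nat -> R) (A : nat -> set R),
        0 <= t 0%N -> (forall i, t i <= t i.+1) ->
        (forall i, measurable (A i)) ->
        let E i := [set w | A i (B (t i.+1) w - B (t i) w)] in
        P (\bigcap_(i in `I_n) E i) = (\prod_(i < n) P (E i))%E,
      forall s t, 0 <= s -> s < t ->
        forall A : set R, measurable A ->
        P [set w | A (B t w - B s w)] = normal_prob 0 (Num.sqrt (t - s)) A &
      {ae P, forall w, {within `[0, +oo[, continuous (fun t => B t w)}}].

(* The sigma-algebra generated by {B(s) : s >= 0} and the P-null sets. *)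
Definition brownian_sigma_algebra (B : R -> T -> R) : set (set T) :=
  <<s [set E | (exists s, exists A : set R,
                 [/\ 0 <= s, measurable A & E = B s @^-1` A]) \/
               P.-negligible E] >>.

Definition normal_rv (Y : T -> R) : Prop :=
  exists m s : R, 0 < s /\
    forall A : set R, measurable A -> P (Y @^-1` A) = normal_prob m s A.

(* A list of triples (l, u, c) codes the step function
   \sum c * 1_{]l, u]}, whose integral is \sum c * (B u - B l). *)
Definition step_fun (p : seq (R * R * R)) (s : R) : R :=
  \sum_(q <- p) q.2 * \1_(`]q.1.1, q.1.2] : set R) s.

Definition step_integral (B : R -> T -> R) (p : seq (R * R * R)) (w : T) : R :=
  \sum_(q <- p) q.2 * (B q.1.2 w - B q.1.1 w).

(* J is (a version of) \int_0^oo f dB: the L^2(P)-limit of the integrals of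
   step functions that converge to f in L^2([0, +oo[). By the Ito isometry
   the limit does not depend on the approximating sequence. *)
Definition is_wiener_integral (B : R -> T -> R) (f : R -> R) (J : T -> R) :
    Prop :=
  [/\ measurable_fun (`[0, +oo[ : set R) f, measurable_fun setT J &
      exists p : nat -> seq (R * R * R),
      [/\ forall n q, q \in p n -> 0 <= q.1.1 <= q.1.2,
          (\int[lebesgue_measure]_(s in `[0%R, +oo[)
             ((step_fun (p n) s - f s) ^+ 2)%R%:E)%E @[n --> \oo] --> 0%E &
          (\int[P]_w ((step_integral B (p n) w - J w) ^+ 2)%R%:E)%E
             @[n --> \oo] --> 0%E]].

(* Integral form of
     dX(t) = (a X(t) + b / (1 + t) * \int_{-1}^t X(s) ds) dt + sigma dB(t);
   sigma being constant, the integral against B is sigma * (B(t) - B(0)) and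
   the equation is pathwise. *)
Definition average_sde_solution (F : R -> set (set T)) (B : R -> T -> R)
    (a b sigma : R) (psi : R -> R) (X : R -> T -> R) : Prop :=
  adapted F X /\
  {ae P, forall w,
    [/\ {within `[-1, +oo[, continuous (fun t => X t w)},
        forall t, -1 <= t <= 0 -> X t w = psi t &
        forall t, 0 <= t ->
          X t w = X 0 w
            + \int[lebesgue_measure]_(s in `[0, t])
                (a * X s w + b / (1 + s) *
                   \int[lebesgue_measure]_(u in `[-1, s]) X u w)
            + sigma * (B t w - B 0 w)]}.

End processes.

Definition limit_mean (R : realType) (a b : R) (psi : R -> R) : R :=
  a `^ (b / a) *
  (a * psi 0 * tricomiU (1 + b / a) 2 a
   + b * (\int[lebesgue_measure]_(s in `[-1, 0]) psi s)
       * tricomiU (1 + b / a) 1 a).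

(* Main.v *)
Require Import Defs.
From HB Require Import structures.
From mathcomp Require Import all_boot all_order all_algebra.
From mathcomp Require Import all_classical all_reals all_analysis.
From mathcomp Require Import measurable_realfun ring lra.

Set Implicit Arguments.
Unset Strict Implicit.
Unset Printing Implicit Defensive.

Import Order.TTheory GRing.Theory Num.Theory.
Import numFieldNormedType.Exports.

Local Open Scope classical_set_scope.
Local Open Scope ring_scope.

(** The equation is pathwise, so the asymptotics of [X] is a deterministic
    statement about a path [B] of moderate growth, and probability enters only
    through the growth of Brownian paths and the law of one Wiener integral.

    One path.  Let [I] be the running integral of [X] from [-1].  Then [X]
    minus the noise, together with [I], solves a linear differential system.
    The adjoint system reduces to [t v'' = a t v' + b v], a form of Kummer's
    equation, and [decaying_solution] gives its solution
    [v t = a t U(1 + b / a, 2, a t)], which behaves like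
    [(a t) `^ (- (b / a))].  The normalization of [U] has to be backed by
    existence ([tricomi_sol_exists]: a Laplace integral, and a recurrence that
    lowers the first parameter) and uniqueness ([kummer_unique]: a Wronskian
    argument).  With [f t = expR (- (a t)) * v (1 + t)] and
    [g t = expR (- (a t)) * v' (1 + t)], the drift of [f X - g I] vanishes
    ([path_martingale]), so [f X - g I] is its initial value plus
    [sigma] times the integral of [f] against [B].  Integration by parts
    defines this integral along each continuous path that grows less fast than
    [f] decays, and shows that it converges as [t] tends to infinity.  As
    [g / f = v' / v] tends to [0] and [f I] stays bounded, [f X] has the same
    limit, and [f X] is [X / (expR (a t) * t `^ (b / a))] up to a factor that
    tends to [a `^ (- (b / a))].  This is [path_limit], which moreover bounds
    the square of the normalized path by a multiple of [1 + H ^ 2], with [H]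
    the constant in the growth bound of [B].

    Growth.  By a chaining argument with fourth moments, almost every path
    satisfies such a bound at any positive exponential rate, with a square
    integrable [H] ([brownian_growth]).  This single random variable dominates
    everything: the convergence of means and variances, and the convergence in
    mean square of the sums that approximate the Wiener integral.

    The Wiener integral.  Over finer and finer grids, the integrals of step
    functions converge to the integral by parts along almost every path
    ([weight_step_cvg]).  Each of these sums is a combination of independent
    normal increments, hence normal ([increment_sum_law]); its variance
    converges to the integral of [f ^ 2], and the limit is normal with this
    variance ([gauss_limit]), which is positive because [v] is positive far
    out.  All the assertions about the limit variable follow from its law and
    from dominated convergence. *)

(** * Calculus on the real line *)

Section derivatives.
Context {R : realType}.
Implicit Types (f g h : R -> R) (x y d e : R).

Lemma is_drv_eq f x d e : is_derive x 1 f d -> d = e -> is_derive x 1 f e.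
Proof. by move=> ? <-. Qed.

Lemma is_drvD f g x d e : is_derive x 1 f d -> is_derive x 1 g e ->
  is_derive x 1 (fun t => f t + g t) (d + e).
Proof. by move=> hf hg; exact: is_deriveD. Qed.

Lemma is_drvB f g x d e : is_derive x 1 f d -> is_derive x 1 g e ->
  is_derive x 1 (fun t => f t - g t) (d - e).
Proof. by move=> hf hg; exact: is_deriveB. Qed.

Lemma is_drvN f x d : is_derive x 1 f d -> is_derive x 1 (fun t => - f t) (- d).
Proof. by move=> hf; exact: is_deriveN. Qed.

Lemma is_drvM f g x d e : is_derive x 1 f d -> is_derive x 1 g e ->
  is_derive x 1 (fun t => f t * g t) (d * g x + f x * e).
Proof.
move=> hf hg; apply: is_drv_eq (is_deriveM hf hg) _.
by rewrite /= addrC mulrC.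
Qed.

Lemma is_drvC (c : R) x : is_derive x 1 (fun=> c) 0.
Proof. exact: is_derive_cst. Qed.

Lemma is_drv_id x : is_derive x 1 (fun t : R => t) 1.
Proof. exact: is_derive_id. Qed.

Lemma is_drvZ (c : R) f x d : is_derive x 1 f d ->
  is_derive x 1 (fun t => c * f t) (c * d).
Proof.
by move=> hf; apply: is_drv_eq (is_drvM (is_drvC c x) hf) _; rewrite mul0r add0r.
Qed.

Lemma is_drv_comp f g x d e : is_derive (g x) 1 f d -> is_derive x 1 g e ->
  is_derive x 1 (fun t => f (g t)) (d * e).
Proof. by move=> hf hg; exact: is_derive1_comp. Qed.

Lemma is_drv_exp f x d : is_derive x 1 f d ->
  is_derive x 1 (fun t => expR (f t)) (d * expR (f x)).
Proof.
move=> hf; apply: is_drv_eq (is_drv_comp (is_derive_expR _) hf) _.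
by rewrite mulrC.
Qed.

Lemma is_drv_sqr f x d : is_derive x 1 f d ->
  is_derive x 1 (fun t => f t ^+ 2) (2 * f x * d).
Proof.
move=> hf; have -> : (fun t => f t ^+ 2) = (fun t => f t * f t).
  by apply/funext => t; rewrite expr2.
by apply: is_drv_eq (is_drvM hf hf) _; ring.
Qed.

Lemma is_drvV f x d : f x != 0 -> is_derive x 1 f d ->
  is_derive x 1 (fun t => (f t)^-1) (- d / f x ^+ 2).
Proof.
move=> f0 hf; apply: is_drv_eq (is_deriveV f0 hf) _.
by rewrite /GRing.scale /= mulrC mulrN mulNr.
Qed.

Lemma is_drv_cont f x d : is_derive x 1 f d -> {for x, continuous f}.
Proof.
by case=> df _; apply: differentiable_continuous; apply/derivable1_diffP.
Qed.

Lemma is_drv_near f g x d : (\forall t \near x, f t = g t) ->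
  is_derive x 1 f d -> is_derive x 1 g d.
Proof.
move=> fg hf; have [df ef] := hf; split; first exact: near_eq_derivable df.
by rewrite -ef; apply/esym/near_eq_derive.
Qed.

(** The product of [f] with [expR (- K t)] is nonincreasing in [t]. *)
Lemma gronwall f f' (K x y : R) : x <= y ->
  (forall t, x < t < y -> is_derive t 1 f (f' t)) ->
  {within `[x, y], continuous f} ->
  (forall t, x < t < y -> f' t <= K * f t) ->
  f y <= f x * expR (K * (y - x)).
Proof.
move=> xy df cf le.
pose h t := f t * expR (- (K * t)).
have dh t : x < t < y ->
    is_derive t 1 h ((f' t - K * f t) * expR (- (K * t))).
  move=> /df dft.
  have dE := is_drv_exp (is_drvN (is_drvZ K (is_drv_id t))).
  by apply: is_drv_eq (is_drvM dft dE) _; ring.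
have ch : {within `[x, y], continuous h}.
  move=> t; apply: cvgM; first exact: cf.
  apply: continuous_subspaceT => {}t.
  exact: is_drv_cont (is_drv_exp (is_drvN (is_drvZ K (is_drv_id t)))).
have hle : h y <= h x.
  apply: (@ler0_derive1_le_cc _ h x y) => //.
  - by move=> t; rewrite in_itv /= => /dh[].
  - move=> t; rewrite in_itv /= => tI; rewrite derive1E.
    have [_ ->] := dh _ tI.
    by rewrite mulr_le0_ge0 ?expR_ge0 // subr_le0 le.
  - by rewrite in_itv /= lexx xy.
  - by rewrite in_itv /= lexx xy.
have : h y * expR (K * y) <= h x * expR (K * y) by rewrite ler_pM2r ?expR_gt0.
rewrite /h -!mulrA -!expRD.
by rewrite addNr expR0 mulr1 mulrBr [- _ + _]addrC.
Qed.

(** Gronwall's lemma for the reflected function [t |-> f (x + y - t)]. *)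
Lemma gronwall_back f f' (K x y : R) : x <= y ->
  (forall t, x <= t <= y -> is_derive t 1 f (f' t)) ->
  (forall t, x <= t <= y -> - (K * f t) <= f' t) ->
  f x <= f y * expR (K * (y - x)).
Proof.
move=> xy df le.
have dr (t : R) : is_derive t 1 (fun u => x + y - u) (-1).
  by apply: is_drv_eq (is_drvB (is_drvC (x + y) t) (is_drv_id t)) _; ring.
have dg (t : R) : x <= t <= y ->
    is_derive t 1 (fun u => f (x + y - u)) (- f' (x + y - t)).
  move=> tI; apply: is_drv_eq (is_drv_comp (df _ _) (dr t)) _; last by ring.
  by move: tI => /andP[]; lra.
have := @gronwall (fun u => f (x + y - u)) (fun u => - f' (x + y - u)) K x y xy.
rewrite addrK [x + y - x]addrAC subrr add0r; apply.
- by move=> t /andP[/ltW xt /ltW ty]; apply: dg; rewrite xt ty.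
- apply: derivable_within_continuous => t; rewrite in_itv /= => tI.
  by have [] := dg t tI.
- by move=> t tI; rewrite lerNl; apply: le; move: tI => /andP[]; lra.
Qed.

Lemma drv0_cst_le f (x y z : R) : (forall t, x <= t -> is_derive t 1 f 0) ->
  x <= y -> x <= z -> f y = f z.
Proof.
move=> df; wlog yz : y z / y < z.
  move=> wl xy xz; have [yz|yz|->//] := ltgtP y z; first exact: wl.
  by rewrite (wl z y).
move=> xy xz.
have [||c _] := @MVT R f (fun=> 0) y z yz.
- move=> t; rewrite in_itv /= => /andP[yt _]; apply: df.
  by apply: le_trans xy _; exact: ltW.
- apply: derivable_within_continuous => t; rewrite in_itv /= => /andP[yt _].
  by have [] := df t (le_trans xy yt).
- by rewrite mul0r => /subr0_eq.
Qed.

Lemma drv0_cst f (x y z : R) : (forall t, x < t -> is_derive t 1 f 0) ->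
  x < y -> x < z -> f y = f z.
Proof.
move=> df xy xz; apply: (@drv0_cst_le f (Num.min y z)).
- by move=> t; rewrite ge_min => /orP[] h; apply: df; exact: lt_le_trans h.
- by rewrite ge_min lexx.
- by rewrite ge_min lexx orbT.
Qed.

Lemma is_drv_powR (p x : R) : 0 < x ->
  is_derive x 1 (fun t => t `^ p) (p * x `^ p / x).
Proof.
move=> x0; apply: is_drv_eq (is_derive1_powR p x0) _.
rewrite powRB; last by rewrite (gt_eqF x0) implybT.
by rewrite powRr1 ?ltW // mulrA.
Qed.

(** For [0 < p], raise [1 + u <= expR u] at [u = e / p * z] to the power [p]. *)
Lemma powR_le_exp (p e : R) : 0 < e ->
  exists2 K, 0 < K & forall z, 1 <= z -> z `^ p <= K * expR (e * z).
Proof.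
move=> e0; have [p0|p0] := leP p 0.
  exists 1 => // z z1; rewrite mul1r.
  have z0 : 0 <= z by exact: le_trans z1.
  apply: (@le_trans _ _ 1).
    by rewrite -(powRr0 z); apply: ler_powR.
  by rewrite -expR0 ler_expR mulr_ge0 // ltW.
exists ((p / e) `^ p) => [|z z1]; first by rewrite powR_gt0 // divr_gt0.
have -> : expR (e * z) = expR (e / p * z) `^ p.
  by rewrite -expRM; congr expR; field; rewrite gt_eqF.
have pe : 0 <= p / e by rewrite divr_ge0 // ltW.
rewrite -powRM ?expR_ge0 //.
have z0 : 0 <= z by exact: le_trans z1.
apply: ge0_ler_powR; rewrite ?nnegrE //; first exact: ltW.
  by apply: mulr_ge0 => //; exact: expR_ge0.
apply: (@le_trans _ _ (p / e * (1 + e / p * z))); last first.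
  by apply: ler_wpM2l => //; exact: expR_ge1Dx.
rewrite mulrDr mulr1 mulrA [X in X * z](_ : _ = 1) ?mul1r ?lerDr //.
by field; rewrite !gt_eqF.
Qed.

Lemma exp_cvg0 (e : R) : 0 < e -> expR (- (e * z)) @[z --> +oo] --> (0 : R).
Proof.
move=> e0; under eq_fun do rewrite mulrC.
exact: (cvg_comp _ _ (gt0_cvgMly e0 cvg_id) (@cvgr_expR R)).
Qed.

Lemma invy_cvg0 : z^-1 @[z --> +oo] --> (0 : R).
Proof.
apply/(gtr0_cvgV0 (f := id)); last exact: cvg_id.
by near=> z; near: z; apply: nbhs_pinfty_gt; exact: num_real.
Unshelve. all: by end_near. Qed.

Lemma exp_powR_cvg0 (p e : R) : 0 < e ->
  expR (- (e * z)) * z `^ p @[z --> +oo] --> (0 : R).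
Proof.
move=> e0; have e2 : 0 < e / 2 by rewrite divr_gt0.
have [K K0 hK] := powR_le_exp p e2.
have c0 : K * expR (- (e / 2 * z)) @[z --> +oo] --> (0 : R).
  rewrite -(mulr0 K); apply: cvgM; [exact: cvg_cst|exact: exp_cvg0].
apply: (squeeze_cvgr _ (cvg_cst 0) c0); near=> z.
have z1 : 1 <= z by near: z; apply: nbhs_pinfty_ge; exact: num_real.
rewrite mulr_ge0 ?expR_ge0 ?powR_ge0 //=.
apply: le_trans (ler_wpM2l (expR_ge0 _) (hK z z1)) _.
rewrite mulrCA -expRD; apply: ler_wpM2l; first exact: ltW.
by rewrite ler_expR; lra.
Unshelve. all: by end_near. Qed.

End derivatives.

Section integrals.
Context {R : realType}.
Notation mu := (@lebesgue_measure R).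
Implicit Types (f g h F : R -> R).

Lemma cont_within f (A : set R) :
  (forall t, A t -> {for t, continuous f}) -> {within A, continuous f}.
Proof.
move=> cf; apply: continuous_in_subspaceT => t.
by rewrite inE; exact: cf.
Qed.

Lemma within_cont_sub f (A B : set R) :
  A `<=` B -> {within B, continuous f} -> {within A, continuous f}.
Proof. exact: continuous_subspaceW. Qed.

Lemma cont_itv_integrable f x y : {within `[x, y], continuous f} ->
  mu.-integrable `[x, y] (EFin \o f).
Proof.
by move=> cf; apply: continuous_compact_integrable => //; exact: segment_compact.
Qed.

Lemma within_measurable f (i : interval R) :
  {within [set` i], continuous f} -> measurable_fun [set` i] f.
Proof. by move=> cf; apply: subspace_continuous_measurable_fun. Qed.

Lemma FTC2_itv f F x y : x <= y ->
  {within `[x, y], continuous f} -> {within `[x, y], continuous F} ->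
  (forall t, x < t < y -> is_derive t 1 F (f t)) ->
  \int[mu]_(t in `[x, y]) f t = F y - F x.
Proof.
rewrite le_eqVlt => /predU1P[->|xy] cf cF dF.
  by rewrite set_itv1 Rintegral_set1 subrr.
have [cFo cFx cFy] := (continuous_within_itvP F xy).1 cF.
rewrite /Rintegral (@continuous_FTC2 _ f F) //.
- split=> // t; rewrite in_itv /= => /dF[]//.
- by move=> t; rewrite in_itv /= => /dF[_ e]; rewrite derive1E.
Qed.

Lemma Rdominated_cvg d (T : measurableType d) (m : {measure set T -> \bar R})
    (D : set T) (f_ : nat -> T -> R) (f g : T -> R) :
  measurable D -> (forall n, measurable_fun D (f_ n)) ->
  (forall x, D x -> f_ n x @[n --> \oo] --> f x) ->
  m.-integrable D (EFin \o g) ->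
  (forall n x, D x -> `|f_ n x| <= g x) ->
  m.-integrable D (EFin \o f) /\
  \int[m]_(x in D) f_ n x @[n --> \oo] --> \int[m]_(x in D) f x.
Proof.
move=> mD mf_ cf ig le.
have mf : measurable_fun D f by apply: measurable_fun_cvg mf_ cf.
have [] := @dominated_convergence _ _ _ m D mD
  (fun n x => (f_ n x)%:E) (EFin \o f) (EFin \o g).
- by move=> n; exact/measurable_EFinP.
- exact/measurable_EFinP.
- by apply/aeW => x Dx; apply: cvg_EFin; [exact: nearW|exact: cf].
- exact: ig.
- by apply/aeW => x n Dx; rewrite lee_fin le.
move=> iF _ cI; split => //; apply: fine_cvg.
rewrite fineK //; exact: integrable_fin_num.
Qed.

(** Limits at [+oo] are detected by the sequences that tend to [+oo]. *)
Lemma Rdominated_cvgy d (T : measurableType d) (m : {measure set T -> \bar R})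
    (D : set T) (f_ : R -> T -> R) (f g : T -> R) (z0 : R) :
  measurable D -> (forall z, z0 <= z -> measurable_fun D (f_ z)) ->
  (forall x, D x -> f_ z x @[z --> +oo] --> f x) ->
  m.-integrable D (EFin \o g) ->
  (forall z x, z0 <= z -> D x -> `|f_ z x| <= g x) ->
  m.-integrable D (EFin \o f) /\
  \int[m]_(x in D) f_ z x @[z --> +oo] --> \int[m]_(x in D) f x.
Proof.
move=> mD mf_ cf ig le.
have key (u : nat -> R) : u n @[n --> \oo] --> +oo ->
    m.-integrable D (EFin \o f) /\
    \int[m]_(x in D) f_ (u n) x @[n --> \oo] --> \int[m]_(x in D) f x.
  move=> uy; have [N _ uN] : \forall n \near \oo, z0 <= u n.
    by move: uy => /cvgryPge; exact.
  have [] := @Rdominated_cvg _ _ m D (fun n => f_ (u (n + N)%N)) f g mD.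
  - by move=> n; apply: mf_; apply: uN; rewrite /= leq_addl.
  - move=> x Dx; rewrite (cvg_shiftn N (fun n => f_ (u n) x)).
    exact: (cvg_pinftyP _ _).1 (cf x Dx) u uy.
  - exact: ig.
  - by move=> n x Dx; apply: le => //; apply: uN; rewrite /= leq_addl.
  move=> iF; rewrite (cvg_shiftn N (fun n => \int[m]_(x in D) f_ (u n) x)).
  by split.
split; last by apply/cvg_pinftyP => u /key[].
by have [] := key (fun n => n%:R) (@cvgr_idn R).
Qed.

Lemma integral_tail f x : mu.-integrable `[x, +oo[ (EFin \o f) ->
  \int[mu]_(s in `[x, t]) f s @[t --> +oo] --> \int[mu]_(s in `[x, +oo[) f s.
Proof.
move=> fi.
have mf : measurable_fun `[x, +oo[ f.
  by move/integrableP : fi => -[/measurable_EFinP].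
have sub t : `[x, t] `<=` (`[x, +oo[ : set R).
  by move=> s /=; rewrite !in_itv /= => /andP[->].
have [] := @Rdominated_cvgy _ _ mu `[x, +oo[ (fun t => f \_ `[x, t]) f
  (fun s => `|f s|) 0.
- by [].
- move=> t _; apply/(measurable_restrict f) => //.
  by apply: measurable_funS mf => // s [].
- move=> s; rewrite /= in_itv /= andbT => xs; apply: cvg_near_cst.
  near=> t; rewrite patchE mem_set //= in_itv /= xs /=.
  by near: t; apply: nbhs_pinfty_ge; exact: num_real.
- by apply: (integrable_norm fi).
- move=> t s _ _; rewrite patchE; case: ifP => // _; by rewrite normr0.
move=> _; apply: cvg_trans; apply: near_eq_cvg; near=> t.
rewrite -Rintegral_mkcondr; congr Rintegral.
by rewrite setIC; apply/setIidPl.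
Unshelve. all: by end_near. Qed.

Lemma FTC2y f F x l : mu.-integrable `[x, +oo[ (EFin \o f) ->
  {within `[x, +oo[, continuous f} -> {within `[x, +oo[, continuous F} ->
  (forall t, x < t -> is_derive t 1 F (f t)) ->
  F t @[t --> +oo] --> l ->
  \int[mu]_(t in `[x, +oo[) f t = l - F x.
Proof.
move=> fi cf cF dF Fl; apply/esym.
have c1 := integral_tail fi.
suff c2 : \int[mu]_(s in `[x, t]) f s @[t --> +oo] --> l - F x.
  by rewrite -(cvg_lim (@Rhausdorff R) c2) (cvg_lim (@Rhausdorff R) c1).
apply: cvg_trans (cvgB Fl (cvg_cst (F x))).
apply: near_eq_cvg; near=> t.
have xt : x <= t by near: t; apply: nbhs_pinfty_ge; exact: num_real.
have sub : `[x, t] `<=` (`[x, +oo[ : set R).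
  by move=> s /=; rewrite !in_itv /= => /andP[->].
apply/esym/FTC2_itv => //.
- exact: within_cont_sub sub cf.
- exact: within_cont_sub sub cF.
- by move=> s /andP[xs _]; exact: dF.
Unshelve. all: by end_near. Qed.

(** The base point lies strictly below the region of interest, so that no
    one-sided derivative appears. *)
Lemma primitive_drv f (x t : R) : continuous f -> x < t ->
  is_derive t 1 (fun y => \int[mu]_(s in `[x, y]) f s) (f t).
Proof.
move=> cf xt.
have fi : mu.-integrable `[x, t + 1] (EFin \o f).
  by apply: cont_itv_integrable; apply: cont_within => s _; exact: cf.
have t1 : t < t + 1 by rewrite ltrDl.
have [d e] := continuous_FTC1_closed t1 fi xt (cf t).
by rewrite derive1E in e; exact: DeriveDef d e.
Qed.

Lemma primitiveB f (x y z : R) : continuous f -> x <= y -> y <= z ->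
  \int[mu]_(s in `[y, z]) f s =
  \int[mu]_(s in `[x, z]) f s - \int[mu]_(s in `[x, y]) f s.
Proof.
move=> cf xy yz.
have cfw u v : {within `[u, v], continuous f} by apply: cont_within => s _; exact: cf.
have fi u v : mu.-integrable `[u, v] (EFin \o f) by exact: cont_itv_integrable.
rewrite Rintegral_itvB ?bnd_simp //.
apply/esym/Rintegral_itv_obnd_cbnd.
by apply: integrableS (fi y z) => //; exact: subset_itv_oc_cc.
Qed.

(** Extending by a constant to the left turns continuity on a half-line into
    continuity everywhere. *)
Lemma within_cont_max f (x : R) : {within `[x, +oo[, continuous f} ->
  continuous (fun t => f (Num.max t x)).
Proof.
move=> /subspace_continuousP cf t.
have xm s : (`[x, +oo[%classic : set R) (Num.max s x).
  by rewrite /= in_itv /= andbT le_max lexx orbT.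
apply: (cvg_comp (fun s => Num.max s x) f) (cf _ (xm t)) => A hA.
have cm : Num.max s x @[s --> t] --> Num.max t x.
  apply/cvgrPdist_le => e e0; near=> s.
  have : `|t - s| <= e by near: s; exact: cvgr_dist_le cvg_id _ e0.
  rewrite !ler_norml => /andP[]; case: (leP t x); case: (leP s x); lra.
have := cm _ hA; rewrite /fmap /= !nbhs_simpl /=.
by apply: filterS => s /=; apply; exact: xm.
Unshelve. all: by end_near. Qed.

Lemma exp_integrable (e : R) : 0 < e ->
  mu.-integrable `[0, +oo[ (EFin \o (fun t => expR (- (e * t)))).
Proof.
move=> e0; have en : e != 0 by rewrite gt_eqF.
have dE (t : R) : is_derive t 1 (fun s : R => expR (- (e * s)))
    (- e * expR (- (e * t))).
  by apply: is_drv_eq (is_drv_exp (is_drvN (is_drvZ e (is_drv_id t)))) _; ring.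
have cE : continuous (fun s : R => expR (- (e * s))).
  by move=> t; exact: is_drv_cont (dE t).
have dF (t : R) : is_derive t 1 (fun s : R => - e^-1 * expR (- (e * s)))
    (expR (- (e * t))).
  by apply: is_drv_eq (is_drvZ _ (dE t)) _; field.
have cF : continuous (fun s : R => - e^-1 * expR (- (e * s))).
  by move=> t; exact: is_drv_cont (dF t).
have mE : measurable_fun (`[0, +oo[ : set R) (fun s : R => expR (- (e * s))).
  by apply: within_measurable; apply: cont_within => s _; exact: cE.
apply/integrableP; split; first exact/measurable_EFinP.
under eq_integral => t _ do rewrite /= ger0_norm ?expR_ge0 //.
rewrite (@ge0_continuous_FTC2y _ _ (fun s : R => - e^-1 * expR (- (e * s))) 0 0).
- by rewrite ltry.
- by move=> t _; exact: expR_ge0.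
- by apply: cont_within => t _; exact: cE.
- rewrite -(mulr0 (- e^-1)); apply: cvgM; [exact: cvg_cst|exact: exp_cvg0].
- by move=> t _; have [] := dF t.
- by apply: cvg_at_right_filter; exact: cF.
- by move=> t _; rewrite derive1E; have [_ ->] := dF t.
Qed.

Lemma exp_le_integrable f (K e : R) : 0 < e -> measurable_fun (`[0, +oo[ : set R) f ->
  (forall t, 0 <= t -> `|f t| <= K * expR (- (e * t))) ->
  mu.-integrable `[0, +oo[ (EFin \o f).
Proof.
move=> e0 mf le.
have K0 : 0 <= K.
  have := le 0 (lexx _); rewrite mulr0 oppr0 expR0 mulr1; exact: le_trans.
apply: (@le_integrable _ _ _ mu `[0, +oo[ _ (EFin \o f)
  (fun t => K%:E * (expR (- (e * t)))%:E)%E) => //.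
- exact/measurable_EFinP.
- move=> t /=; rewrite in_itv /= andbT => t0.
  by rewrite lee_fin [leRHS]ger0_norm ?le // mulr_ge0 ?expR_ge0.
- by apply: integrableZl => //; exact: exp_integrable.
Qed.

Lemma exprn_le_exp (j : nat) (e : R) : 0 < e ->
  exists2 K, 0 < K & forall t, 0 <= t -> t ^+ j <= K * expR (e * t).
Proof.
move=> e0; have [K K0 hK] := powR_le_exp j%:R e0.
exists (K + 1) => [|t t0]; first by rewrite addr_gt0.
rewrite mulrDl mul1r; have [t1|t1] := leP 1 t.
  by rewrite -powR_mulrn //; apply: le_trans (hK t t1) _; rewrite lerDl expR_ge0.
apply: (@le_trans _ _ 1); first by rewrite exprn_ile1 // ltW.
apply: (@le_trans _ _ (expR (e * t))); first by rewrite -expR0 ler_expR mulr_ge0 // ltW.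
by rewrite lerDr mulr_ge0 ?expR_ge0 // ltW.
Qed.

Lemma Rintegral_gt0 f (i : interval R) (u v m : R) :
  mu.-integrable [set` i] (EFin \o f) -> (forall t, t \in i -> 0 <= f t) ->
  u < v -> `[u, v] `<=` [set` i] -> 0 < m ->
  (forall t, u <= t <= v -> m <= f t) -> 0 < \int[mu]_(t in [set` i]) f t.
Proof.
move=> fi f0 uv sub m0 mf.
have muv : mu `[u, v] = (v - u)%:E.
  by rewrite lebesgue_measure_itv /= lte_fin uv EFinB.
apply: (@lt_le_trans _ _ (m * (v - u))); first by rewrite mulr_gt0 // subr_gt0.
have -> : m * (v - u) = \int[mu]_(t in `[u, v]) m.
  by rewrite Rintegral_cst //= muv.
rewrite -lee_fin /Rintegral !fineK.
- apply: (@le_trans _ _ (\int[mu]_(t in `[u, v]) (f t)%:E)%E).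
    apply: ge0_le_integral => //=.
    + by move=> t _; rewrite lee_fin ltW.
    + by apply: (measurable_funS _ sub (measurable_int _ fi)).
  apply: ge0_subset_integral => //=; first exact: (measurable_int _ fi).
- exact: integrable_fin_num fi.
- by rewrite integral_cst //= muv -EFinM.
Qed.

End integrals.

(** * Kummer's equation *)

Section kummer.
Context {R : realType}.
Implicit Types (al be z : R) (w : R -> R).

(** The equation as a first-order system, so that explicit solutions come with
    their derivative and no second derivative has to be taken. *)
Definition kummer al be w w' := forall z, 0 < z ->
  is_derive z 1 w (w' z) /\
  is_derive z 1 w' ((al * w z - (be - z) * w' z) / z).

Lemma kummerP al be w : kummer al be w (w^`())%classic <->
  forall z, 0 < z ->
     [/\ derivable w z 1, derivable (w^`())%classic z 1 &
         z * (w^`(2))%classic z + (be - z) * (w^`())%classic z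
           - al * w z = 0].
Proof.
split=> h z z0.
  have [[d1 _] [d2 e2]] := h z z0; split => //.
  rewrite -[(w^`(2))%classic]/((w^`()^`())%classic) derive1E e2.
  by field; rewrite gt_eqF.
have [d1 d2 e] := h z z0; split; first by apply: DeriveDef => //; rewrite derive1E.
apply: DeriveDef => //; rewrite -derive1E.
have zn : z != 0 by rewrite gt_eqF.
apply: (mulfI zn); rewrite [RHS]mulrCA divff // mulr1.
move: e; rewrite -[(w^`(2))%classic]/((w^`()^`())%classic).
lra.
Qed.

Lemma near_pos z : 0 < z -> \forall t \near z, (0 : R) < t.
Proof. by move=> z0; exact: lt_nbhsr. Qed.

Lemma kummer_derive1 al be w w' : kummer al be w w' ->
  kummer al be w (w^`())%classic.
Proof.
move=> k z z0.
have e t : 0 < t -> (w^`())%classic t = w' t.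
  by move=> t0; have [[_ <-] _] := k t t0; rewrite derive1E.
have [k1 k2] := k z z0; rewrite e //; split => //.
apply: is_drv_near k2.
by apply: filterS (near_pos z0) => t t0; rewrite e.
Qed.

Lemma kummerB al be w w' v v' : kummer al be w w' -> kummer al be v v' ->
  kummer al be (fun z => w z - v z) (fun z => w' z - v' z).
Proof.
move=> kw kv z z0; have [w1 w2] := kw z z0; have [v1 v2] := kv z z0.
split; first exact: is_drvB.
by apply: is_drv_eq (is_drvB w2 v2) _; field; rewrite gt_eqF.
Qed.

Lemma kummerZ al be w w' (c : R) : kummer al be w w' ->
  kummer al be (fun z => c * w z) (fun z => c * w' z).
Proof.
move=> kw z z0; have [w1 w2] := kw z z0.
split; first exact: is_drvZ.
by apply: is_drv_eq (is_drvZ c w2) _; field; rewrite gt_eqF.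
Qed.

(** The contiguity relation
    [U(al - 1, be, z) = (z + al - be) U(al, be, z) - z U'(al, be, z)]. *)
Lemma kummer_lower al be w w' : kummer al be w w' ->
  kummer (al - 1) be (fun z => (z + (al - be)) * w z - z * w' z)
    (fun z => (al - 1) * (w' z - w z)).
Proof.
move=> k z z0; have [d1 d2] := k z z0; have zn : z != 0 by rewrite gt_eqF.
split.
  have dz := is_drvD (is_drv_id z) (is_drvC (al - be) z).
  apply: is_drv_eq (is_drvB (is_drvM dz d1) (is_drvM (is_drv_id z) d2)) _.
  by field.
apply: is_drv_eq (is_drvZ (al - 1) (is_drvB d2 d1)) _.
by field.
Qed.

(** Abel's identity: the Wronskian [W] satisfies [W' = (1 - be / z) W]. *)
Lemma kummer_wronskian al be w w' v v' : kummer al be w w' ->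
  kummer al be v v' -> exists c, forall z, 0 < z ->
    w z * v' z - w' z * v z = c * (z `^ (- be) * expR z).
Proof.
move=> kw kv.
pose p z := z `^ be * expR (- z) * (w z * v' z - w' z * v z).
have dp z : 0 < z -> is_derive z 1 p 0.
  move=> z0; have zn : z != 0 by rewrite gt_eqF.
  have [w1 w2] := kw z z0; have [v1 v2] := kv z z0.
  have d1 := is_drvM (is_drv_powR be z0) (is_drv_exp (is_drvN (is_drv_id z))).
  apply: is_drv_eq (is_drvM d1 (is_drvB (is_drvM w1 v2) (is_drvM w2 v1))) _.
  by field.
exists (p 1) => z z0; rewrite (@drv0_cst R p 0 1 z) // /p powRN expRN.
have e0 : expR z != 0 by rewrite gt_eqF ?expR_gt0.
have p0 : z `^ be != 0 by rewrite gt_eqF ?powR_gt0.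
by field; rewrite e0 p0.
Qed.

(** Away from [0], the logarithmic derivative of [w ^ 2 + w' ^ 2] is bounded
    below, so Gronwall's lemma run backwards carries the zero to the left. *)
Lemma kummer_zero al be w w' (z1 : R) : kummer al be w w' ->
  (forall z, z1 < z -> w z = 0) -> forall z, 0 < z -> w z = 0.
Proof.
move=> k w0 z z0; pose y := Num.max z (Num.max z1 0 + 1).
have zy : z <= y by rewrite le_max lexx.
have y1 : z1 < y.
  by rewrite lt_max; apply/orP; right; rewrite ltr_pwDr // le_max lexx.
have y0 : 0 < y by exact: lt_le_trans zy.
have w'y : w' y = 0.
  have [[_ <-] _] := k y y0.
  have [] := @is_drv_near R (fun=> 0) w y 0 _ (is_drvC 0 y) => //.
  apply: filterS (lt_nbhsr y1) => t t1; by rewrite w0.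
pose E t := w t ^+ 2 + w' t ^+ 2.
pose K := 1 + (`|al| + 2 * (`|be| + y)) / z.
have zi : 0 < z^-1 by rewrite invr_gt0.
have le : E z <= E y * expR (K * (y - z)).
  pose E' t := 2 * w t * w' t +
    2 * w' t * ((al * w t - (be - t) * w' t) / t).
  apply: (@gronwall_back R E E' K z y zy) => t /andP[zt ty].
    have t0 : 0 < t by exact: lt_le_trans zt.
    have [d1 d2] := k t t0.
    exact: is_drvD (is_drv_sqr d1) (is_drv_sqr d2).
  have t0 : 0 < t by exact: lt_le_trans zt.
  rewrite /E /E' /K.
  have ti0 : 0 < t^-1 by rewrite invr_gt0.
  have ti : t^-1 <= z^-1 by rewrite lef_pV2.
  set a := w t; set b := w' t.
  have h1 : - (a ^+ 2 + b ^+ 2) <= 2 * a * b.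
    by have := sqr_ge0 (a + b); rewrite sqrrD; lra.
  have hal : - (`|al| * (a ^+ 2 + b ^+ 2)) <= 2 * (al * a * b).
    have h2 : 2 * (a * b) <= a ^+ 2 + b ^+ 2.
      by have := sqr_ge0 (a - b); rewrite sqrrB; lra.
    have h3 : `|2 * (a * b)| <= a ^+ 2 + b ^+ 2.
      by rewrite ler_norml; apply/andP; split; lra.
    have := ler_wpM2l (normr_ge0 al) h3.
    by rewrite -normrM ler_norml => /andP[]; lra.
  have hbe : - (2 * (`|be| + y) * (a ^+ 2 + b ^+ 2)) <=
      - 2 * ((be - t) * b ^+ 2).
    have : be - t <= `|be| + y by have := ler_norm be; lra.
    have := sqr_ge0 a; have := sqr_ge0 b; have := normr_ge0 be.
    nra.
  have hs : 0 <= a ^+ 2 + b ^+ 2 by rewrite addr_ge0 ?sqr_ge0.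
  pose M := `|al| + 2 * (`|be| + y).
  have M0 : 0 <= M * (a ^+ 2 + b ^+ 2).
    rewrite mulr_ge0 // /M; have := normr_ge0 al; have := normr_ge0 be; lra.
  have hx : - (M * (a ^+ 2 + b ^+ 2) * z^-1) <=
      2 * b * ((al * a - (be - t) * b) * t^-1).
    apply: (@le_trans _ _ (- (M * (a ^+ 2 + b ^+ 2) * t^-1))).
      by rewrite lerN2 ler_wpM2l.
    have hn : - (M * (a ^+ 2 + b ^+ 2)) <= 2 * b * (al * a - (be - t) * b).
      by rewrite /M; lra.
    by have := ler_wpM2r (ltW ti0) hn; lra.
  rewrite -/M; lra.
have E0 : E y = 0 by rewrite /E w0 // w'y expr0n /= addr0.
move: le; rewrite E0 mul0r /E => le.
have := sqr_ge0 (w z); have := sqr_ge0 (w' z) => h1 h2.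
apply/eqP; rewrite -sqrf_eq0; apply/eqP; lra.
Qed.

(** A second solution of the same growth differs from the first one by a
    solution [v = o(w)].  As [(v / w)' = c e^z z^(- be) / w ^ 2] would force
    exponential growth, the Wronskian vanishes, [v / w] is constant, and hence
    zero. *)
Lemma kummer_unique al be w w' v v' :
  kummer al be w w' -> z `^ al * w z @[z --> +oo] --> (1 : R) ->
  kummer al be v v' -> z `^ al * v z @[z --> +oo] --> (1 : R) ->
  forall z, 0 < z -> v z = w z.
Proof.
move=> kw lw kv lv.
pose D z := v z - w z; pose D' z := v' z - w' z.
have kD : kummer al be D D' by exact: kummerB.
have lD : z `^ al * D z @[z --> +oo] --> (0 : R).
  rewrite -(subrr (1 : R)); apply: cvg_trans (cvgB lv lw).
  by apply: near_eq_cvg; near=> z; rewrite /D mulrBr.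
suff D0 : forall z, 0 < z -> D z = 0 by move=> z /D0 /subr0_eq.
have [c hc] := kummer_wronskian kw kD.
have [z1 [z10 hz1]] : exists z1, 0 < z1 /\ forall z, z1 < z ->
    [/\ 2^-1 <= z `^ al * w z, z `^ al * w z <= 2 &
        4 <= expR z * z `^ (al + al - be)].
  have H : \forall z \near +oo, [/\ 2^-1 <= z `^ al * w z,
      z `^ al * w z <= 2 & 4 <= expR z * z `^ (al + al - be)].
    near=> y; split.
    - near: y; apply: (cvgr_ge _ lw); lra.
    - near: y; apply: (cvgr_le _ lw); lra.
    - have y0 : 0 < y by near: y; apply: nbhs_pinfty_gt; exact: num_real.
      have : expR (- (1 * y)) * y `^ (- (al + al - be)) <= 4^-1.
        near: y; apply: (cvgr_le 0); [exact: exp_powR_cvg0|lra].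
      rewrite mul1r expRN powRN -invfM lef_pV2 // posrE // mulr_gt0 //.
        exact: expR_gt0.
      exact: powR_gt0.
  have [M [_ hM]] := H.
  exists (Num.max M 0 + 1); split; first by rewrite ltr_pwDr // le_max lexx orbT.
  move=> z Mz; apply: hM; apply: le_lt_trans Mz.
  by rewrite (le_trans (_ : M <= Num.max M 0)) ?lerDl // le_max lexx.
have pos z : z1 < z -> [/\ 0 < z, 0 < w z & w z <= 2 * z `^ (- al)].
  move=> zz1; have z0 : 0 < z by exact: lt_trans zz1.
  have [h1 h2 _] := hz1 z zz1; have p0 : 0 < z `^ al by exact: powR_gt0.
  split => //; first by rewrite -(pmulr_rgt0 _ p0); lra.
  by rewrite powRN ler_pdivlMr // mulrC.
pose rho z := D z / w z.
have drho z : z1 < z ->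
    is_derive z 1 rho (c * (z `^ (- be) * expR z) / w z ^+ 2).
  move=> zz1; have [z0 w0 _] := pos z zz1.
  have wn : w z != 0 by rewrite gt_eqF.
  have [w1 _] := kw z z0; have [d1 _] := kD z z0.
  apply: is_drv_eq (is_drvM d1 (is_drvV wn w1)) _.
  by rewrite -hc //; field.
have lrho : rho z @[z --> +oo] --> (0 : R).
  have -> : (0 : R) = 0 * 1^-1 by rewrite mul0r.
  apply: cvg_trans (cvgM lD (cvgV (oner_neq0 R) lw)).
  apply: near_eq_cvg; near=> z.
  have zz1 : z1 < z by near: z; apply: nbhs_pinfty_gt; exact: num_real.
  have [z0 w0 _] := pos z zz1.
  rewrite /rho /=; field; rewrite gt_eqF //= gt_eqF //; exact: powR_gt0.
have c0 : c = 0.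
  apply/eqP/negP => /negP cn.
  have c2 : 0 < c ^+ 2 by rewrite exprn_even_gt0.
  have grow z : z1 + 1 < z -> c ^+ 2 * (z - (z1 + 1)) <= c * rho z - c * rho (z1 + 1).
    move=> zz.
    have [||t] := @MVT R (fun z => c * rho z)
      (fun z => c * (c * (z `^ (- be) * expR z) / w z ^+ 2)) _ _ zz.
    - move=> t; rewrite in_itv /= => /andP[tz _]; apply/is_drvZ/drho.
      by apply: lt_trans tz; rewrite ltrDl.
    - apply: derivable_within_continuous => t; rewrite in_itv /= => /andP[tz _].
      have tz1 : z1 < t by apply: lt_le_trans tz; rewrite ltrDl.
      by have [] := is_drvZ c (drho t tz1).
    rewrite in_itv /= => /andP[tz _] ->.
    rewrite ler_pM2r ?subr_gt0 //.
    have tz1 : z1 < t by apply: lt_trans tz; rewrite ltrDl.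
    have [t0 w0 wle] := pos t tz1; have [_ _ h4] := hz1 t tz1.
    rewrite mulrA mulrA -expr2 -mulrA ler_pMr // ler_pdivlMr ?exprn_gt0 // mul1r.
    apply: (@le_trans _ _ ((2 * t `^ (- al)) ^+ 2)).
      by rewrite lerXn2r ?nnegrE // ltW // (lt_le_trans w0).
    have -> : t `^ (- be) = t `^ (al + al - be) * t `^ (- al) ^+ 2.
      rewrite expr2 -!powRD; first by congr powR; ring.
      - by rewrite (gt_eqF t0) implybT.
      - by rewrite (gt_eqF t0) implybT.
    rewrite exprMn.
    by have := ler_wpM2r (sqr_ge0 (t `^ (- al))) h4; lra.
  have lc : c * rho z @[z --> +oo] --> (0 : R).
    rewrite -(mulr0 c); apply: cvgM lrho; exact: cvg_cst.
  near (pinfty_nbhs R) => z.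
  have hz : z1 + 1 < z by near: z; apply: nbhs_pinfty_gt; exact: num_real.
  have h1 : c * rho z <= 1 by near: z; apply: (cvgr_le _ lc).
  have h2 : (z1 + 1) + (2 - c * rho (z1 + 1)) / c ^+ 2 <= z.
    by near: z; apply: nbhs_pinfty_ge; exact: num_real.
  have := grow z hz.
  move: h2; rewrite -lerBrDl ler_pdivrMr // [X in _ <= X]mulrC.
  lra.
have rho0 z : z1 < z -> rho z = 0.
  move=> zz1; have cst y : z1 < y -> rho z = rho y.
    move=> yz1; apply: drv0_cst zz1 yz1 => t /drho.
    by rewrite c0 !mul0r.
  rewrite -(cvg_lim (@Rhausdorff R) lrho); apply/esym/cvg_lim => //.
  apply: cvg_near_cst; near=> y.
  by apply/esym/cst; near: y; apply: nbhs_pinfty_gt; exact: num_real.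
apply: (kummer_zero (z1 := z1) kD) => y yz1.
have [_ w0 _] := pos y yz1.
have /eqP := rho0 y yz1.
by rewrite /rho mulf_eq0 invr_eq0 (gt_eqF w0) orbF => /eqP.
Unshelve. all: by end_near. Qed.

End kummer.

Section laplace.
Context {R : realType}.
Notation mu := (@lebesgue_measure R).
Context (c : R) (c1 : 1 <= c).
Implicit Types (z t s : R).

Let c0 : 0 < c. Proof. exact: lt_le_trans c1. Qed.

Definition tkernel t : R := (t / (1 + t)) `^ c.

Let t1_gt0 t : 0 <= t -> 0 < 1 + t. Proof. by move=> ?; lra. Qed.

Lemma tkernel_ge0 t : 0 <= tkernel t. Proof. exact: powR_ge0. Qed.

Lemma tkernel_le t : 0 <= t -> tkernel t <= t.
Proof.
move=> t0; have t1 := t1_gt0 t0.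
have [->|tn] := eqVneq t 0; first by rewrite /tkernel mul0r powR0 ?gt_eqF.
have tp : 0 < t by rewrite lt_neqAle eq_sym tn.
have up : 0 < t / (1 + t) by rewrite divr_gt0.
have u1 : t / (1 + t) <= 1 by rewrite ler_pdivrMr // mul1r; lra.
apply: (@le_trans _ _ (t / (1 + t))).
  by apply: ge1r_powR => //; rewrite up u1.
by rewrite ler_pdivrMr // ler_pMr //; lra.
Qed.

Lemma tkernel_le1 t : 0 <= t -> tkernel t <= 1.
Proof.
move=> t0; have t1 := t1_gt0 t0; have p1 : (1 : R) `^ c = 1 by rewrite powR1.
rewrite -[leRHS]p1.
apply: ge0_ler_powR; [exact: ltW|by rewrite nnegrE divr_ge0 // ltW|by rewrite nnegrE|].
by rewrite ler_pdivrMr // mul1r; lra.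
Qed.

Lemma tkernel_drv t : 0 < t ->
  is_derive t 1 tkernel (c * tkernel t / (t * (1 + t))).
Proof.
move=> t0; have t1 := t1_gt0 (ltW t0).
have t1n : 1 + t != 0 by rewrite gt_eqF.
have tn : t != 0 by rewrite gt_eqF.
have up : 0 < t / (1 + t) by rewrite divr_gt0.
have d1 := is_drvV t1n (is_drvD (is_drvC 1 t) (is_drv_id t)).
have d2 := is_drvM (is_drv_id t) d1.
have d3 := @is_drv_comp R (fun u => u `^ c) (fun t => t / (1 + t)) _ _ _
  (is_drv_powR c up) d2.
apply: is_drv_eq d3 _.
by rewrite /tkernel; field; rewrite tn t1n.
Qed.

Lemma tkernel_cont : {within `[0, +oo[, continuous tkernel}.
Proof.
apply/continuous_within_itvcyP; split.
  by move=> t; rewrite in_itv /= andbT => t0; exact: is_drv_cont (tkernel_drv t0).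
have -> : tkernel 0 = 0 by rewrite /tkernel mul0r powR0 ?gt_eqF.
apply: (@squeeze_cvgr _ _ _ _ (cst 0) id); [|exact: cvg_cst|].
  near=> t; have t0 : 0 <= t by near: t; exact: nbhs_right_ge.
  by rewrite tkernel_ge0 /= tkernel_le.
exact: cvg_at_right_filter cvg_id.
Unshelve. all: by end_near. Qed.

Lemma cont_itv0y (f : R -> R) : (forall t, 0 <= t -> {for t, continuous f}) ->
  {within `[0, +oo[, continuous f}.
Proof.
move=> cf; apply: cont_within => t /=; rewrite in_itv /= andbT; exact: cf.
Qed.

Lemma within_contM (f g : R -> R) (A : set R) : {within A, continuous f} ->
  {within A, continuous g} -> {within A, continuous (fun t => f t * g t)}.
Proof. by move=> cf cg t; apply: cvgM; [exact: cf|exact: cg]. Qed.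

Let exp_drv z t : is_derive t 1 (fun t => expR (- (z * t))) (- z * expR (- (z * t))).
Proof.
by apply: is_drv_eq (is_drv_exp (is_drvN (is_drvZ z (is_drv_id t)))) _; ring.
Qed.

Lemma exprn_drv (j : nat) t :
  is_derive t 1 (fun t => t ^+ j.+1) (j.+1%:R * t ^+ j).
Proof.
elim: j => [|j IH].
  have -> : (fun t => t ^+ 1) = (fun t : R => t) by apply/funext => u; rewrite expr1.
  by apply: is_drv_eq (is_drv_id t) _; rewrite expr0 mulr1.
have -> : (fun t => t ^+ j.+2) = (fun t : R => t * t ^+ j.+1).
  by apply/funext => u; rewrite exprS.
by apply: is_drv_eq (is_drvM (is_drv_id t) IH) _; rewrite exprS -[j.+2%:R]natr1; ring.
Qed.

Lemma exprn_cont (j : nat) t : {for t, continuous (fun t => t ^+ j)}.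
Proof.
case: j => [|j]; last exact: is_drv_cont (exprn_drv j t).
exact: is_drv_cont (is_drvC 1 t).
Qed.

Definition lapl_int (j : nat) z t := expR (- (z * t)) * (t ^+ j * tkernel t).

(** [lapl 0 z] is the integral representation of [U(c + 1, 2, z)] without its
    factor [1 / Gamma (c + 1)], and [lapl j] its [j]-th derivative up to sign. *)
Definition lapl (j : nat) z := \int[mu]_(t in `[0, +oo[) lapl_int j z t.

Lemma lapl_int_cont j z : {within `[0, +oo[, continuous (lapl_int j z)}.
Proof.
apply: within_contM; first by apply: cont_itv0y => t _; exact: is_drv_cont (exp_drv z t).
apply: within_contM tkernel_cont.
by apply: cont_itv0y => t _; exact: exprn_cont.
Qed.

Lemma lapl_int_le j z t : 0 <= t ->
  `|lapl_int j z t| <= t ^+ j * expR (- (z * t)).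
Proof.
move=> t0; rewrite /lapl_int ger0_norm; last first.
  by rewrite !mulr_ge0 ?expR_ge0 ?exprn_ge0 ?tkernel_ge0.
rewrite mulrC ler_wpM2r ?expR_ge0 // ler_piMr ?exprn_ge0 //.
exact: tkernel_le1.
Qed.

Lemma exprn_exp_integrable (j : nat) z : 0 < z ->
  mu.-integrable `[0, +oo[ (EFin \o (fun t => `|t| ^+ j * expR (- (z * t)))).
Proof.
move=> z0; have z2 : 0 < z / 2 by rewrite divr_gt0.
have [K K0 hK] := exprn_le_exp j z2.
apply: (@exp_le_integrable _ _ K _ z2).
  apply: measurable_funTS; apply: measurable_funM.
    by apply: measurable_funX; exact: normr_measurable.
  by apply: continuous_measurable_fun => t; exact: is_drv_cont (exp_drv z t).
move=> t t0; rewrite ger0_norm ?mulr_ge0 ?exprn_ge0 ?expR_ge0 // ger0_norm //.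
apply: le_trans (ler_wpM2r (expR_ge0 _) (hK t t0)) _.
rewrite -[leLHS]mulrA -expRD; apply: ler_wpM2l; first exact: ltW.
by rewrite ler_expR; lra.
Qed.

Lemma lapl_int_integrable j z : 0 < z ->
  mu.-integrable `[0, +oo[ (EFin \o lapl_int j z).
Proof.
move=> z0.
have mf : measurable_fun (`[0, +oo[ : set R) (lapl_int j z).
  exact: (within_measurable (@lapl_int_cont j z)).
apply: (@le_integrable _ _ _ mu _ _ _
  (EFin \o (fun t => `|t| ^+ j * expR (- (z * t))))) => //.
- exact/measurable_EFinP.
- move=> t /=; rewrite in_itv /= andbT => t0; rewrite lee_fin.
  rewrite [leRHS]ger0_norm ?mulr_ge0 ?exprn_ge0 ?expR_ge0 // (ger0_norm t0).
  exact: lapl_int_le.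
- exact: exprn_exp_integrable.
Qed.

Lemma lapl_drv j z : 0 < z -> is_derive z 1 (lapl j) (- lapl j.+1 z).
Proof.
move=> z0.
have zI : `](z / 2), (z * 2)[%classic z by rewrite /= in_itv /=; lra.
have d1 (x t : R) : is_derive x 1 (fun x => lapl_int j x t) (- lapl_int j.+1 x t).
  have dx : is_derive x 1 (fun x => - (x * t)) (- t).
    by apply: is_drv_eq (is_drvN (is_drvM (is_drv_id x) (is_drvC t x))) _; ring.
  apply: is_drv_eq (is_drvM (is_drv_exp dx) (is_drvC (t ^+ j * tkernel t) x)) _.
  by rewrite /lapl_int exprS; ring.
have e1 x t : partial1of2 (lapl_int j) x t = - lapl_int j.+1 x t.
  by rewrite partial1of2E; have [_] := d1 x t.
have H1 x : `](z / 2), (z * 2)[%classic x ->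
    mu.-integrable `[0, +oo[ (EFin \o lapl_int j x).
  by rewrite /= in_itv /= => /andP[xz _]; apply: lapl_int_integrable; lra.
have H2 x t : `](z / 2), (z * 2)[%classic x -> `[0, +oo[%classic t ->
    derivable ((lapl_int j)^~ t) x 1 by move=> _ _; have [] := d1 x t.
have H3 t : 0 <= `|t| ^+ j.+1 * expR (- (z / 2 * t)).
  by rewrite mulr_ge0 ?exprn_ge0 ?expR_ge0.
have z2 : 0 < z / 2 by rewrite divr_gt0.
have H4 := exprn_exp_integrable j.+1 z2.
have H5 x t : `](z / 2), (z * 2)[%classic x -> `[0, +oo[%classic t ->
    `|partial1of2 (lapl_int j) x t| <= `|t| ^+ j.+1 * expR (- (z / 2 * t)).
  rewrite /= !in_itv /= andbT => /andP[xz _] t0; rewrite e1 normrN.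
  apply: le_trans (lapl_int_le _ _ t0) _; rewrite ger0_norm //.
  rewrite ler_wpM2l ?exprn_ge0 // ler_expR lerN2 ler_wpM2r //; lra.
have dd : derivable (lapl j) z 1.
  by apply: (derivable_under_integral _ zI H1 H2 H3 H4 H5).
have ee : (lapl j)^`()%classic z = \int[mu]_(t in `[0, +oo[)
    partial1of2 (lapl_int j) z t.
  by apply: (differentiation_under_integral _ zI H1 H2 H3 H4 H5).
apply: DeriveDef dd _; rewrite derive1E in ee; rewrite ee.
under eq_Rintegral do rewrite e1.
under eq_Rintegral do rewrite -mulN1r.
by rewrite RintegralZl ?mulN1r //; exact: lapl_int_integrable.
Qed.

(** Kummer's equation holds as the integral of a derivative vanishes: the
    integrand is, up to sign, the derivative of
    [expR (- (z t)) * tkernel t * t * (1 + t)]. *)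
Lemma lapl_kummer : kummer (c + 1) 2 (lapl 0) (fun z => - lapl 1 z).
Proof.
move=> z z0; split; first exact: lapl_drv.
apply: is_drv_eq (is_drvN (lapl_drv 1 z0)) _.
rewrite opprK.
suff key : z * lapl 2 z + (z - 2) * lapl 1 z - (c + 1) * lapl 0 z = 0.
  have zn : z != 0 by rewrite gt_eqF.
  by apply: (mulfI zn); rewrite [RHS]mulrCA divff // mulr1; lra.
pose F t := expR (- (z * t)) * (tkernel t * (t * (1 + t))).
pose f t := - (z * lapl_int 2 z t + (z - 2) * lapl_int 1 z t
               - (c + 1) * lapl_int 0 z t).
have li j := lapl_int_integrable j z0.
have m0 : measurable (`[0, +oo[%classic : set (measurableTypeR R)) by [].
have i2 : mu.-integrable `[0, +oo[ (EFin \o (fun t => z * lapl_int 2 z t)).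
  exact: (integrableZl m0 z (li 2%N)).
have i1 : mu.-integrable `[0, +oo[ (EFin \o (fun t => (z - 2) * lapl_int 1 z t)).
  exact: (integrableZl m0 (z - 2) (li 1%N)).
have i0 : mu.-integrable `[0, +oo[ (EFin \o (fun t => (c + 1) * lapl_int 0 z t)).
  exact: (integrableZl m0 (c + 1) (li 0%N)).
have i12 : mu.-integrable `[0, +oo[
    (EFin \o (fun t => z * lapl_int 2 z t + (z - 2) * lapl_int 1 z t)).
  exact: (integrableD m0 i2 i1).
have i012 : mu.-integrable `[0, +oo[ (EFin \o (fun t => z * lapl_int 2 z t
    + (z - 2) * lapl_int 1 z t - (c + 1) * lapl_int 0 z t)).
  exact: (integrableB m0 i12 i0).
have fi : mu.-integrable `[0, +oo[ (EFin \o f).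
  rewrite [X in _.-integrable _ X](_ : _ = (fun t => (-1)%:E * (z * lapl_int 2 z t
    + (z - 2) * lapl_int 1 z t - (c + 1) * lapl_int 0 z t)%:E)%E).
    exact: integrableZl.
  by apply/funext => t; rewrite /= -EFinM mulN1r.
have fE : \int[mu]_(t in `[0, +oo[) f t = - (z * lapl 2 z + (z - 2) * lapl 1 z
    - (c + 1) * lapl 0 z).
  have l j r : \int[mu]_(t in `[0, +oo[) (r * lapl_int j z t) = r * lapl j z.
    exact: RintegralZl.
  rewrite -(l 2%N) -(l 1%N) -(l 0%N).
  have <- := RintegralD m0 i2 i1; have <- := RintegralB m0 i12 i0.
  rewrite -[RHS]mulN1r; have <- := RintegralZl (-1) m0 i012.
  by apply: eq_Rintegral => t _; rewrite mulN1r.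
have dF t : 0 < t -> is_derive t 1 F (f t).
  move=> t0; have dq := is_drvM (is_drv_id t) (is_drvD (is_drvC 1 t) (is_drv_id t)).
  apply: is_drv_eq (is_drvM (exp_drv z t) (is_drvM (tkernel_drv t0) dq)) _.
  have t1n : 1 + t != 0 by rewrite gt_eqF // t1_gt0 // ltW.
  have tn : t != 0 by rewrite gt_eqF.
  by rewrite /f /lapl_int; field; rewrite tn t1n.
have cF : {within `[0, +oo[, continuous F}.
  have ce : {within `[0, +oo[, continuous (fun t => expR (- (z * t)))}.
    by apply: cont_itv0y => t _; exact: is_drv_cont (exp_drv z t).
  have ct : {within `[0, +oo[, continuous (fun t : R => t * (1 + t))}.
    apply: cont_itv0y => t _.
    exact: is_drv_cont (is_drvM (is_drv_id t) (is_drvD (is_drvC 1 t) (is_drv_id t))).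
  exact: (within_contM ce (within_contM tkernel_cont ct)).
have cl j (r : R) : {within `[0, +oo[, continuous (fun t => r * lapl_int j z t)}.
  have cr : {within `[0, +oo[, continuous (fun _ : R => r)}.
    by apply: cont_itv0y => t _; exact: (is_drv_cont (is_drvC r t)).
  exact: (within_contM cr (@lapl_int_cont j z)).
have cf : {within `[0, +oo[, continuous f}.
  by move=> t; apply: cvgN; apply: cvgB; [apply: cvgD; exact: cl|exact: cl].
have lF : F t @[t --> +oo] --> (0 : R).
  have z2 : 0 < z / 2 by rewrite divr_gt0.
  have [K K0 hK] := exprn_le_exp 1 z2.
  have [L L0 hL] := exprn_le_exp 2 z2.
  have lb : (K + L) * expR (- (z / 2 * t)) @[t --> +oo] --> (0 : R).
    by rewrite -(mulr0 (K + L)); apply: cvgM; [exact: cvg_cst|exact: exp_cvg0].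
  apply: (squeeze_cvgr _ (cvg_cst 0) lb); near=> t.
  have t0 : 0 <= t by near: t; apply: nbhs_pinfty_ge; exact: num_real.
  have t1 := t1_gt0 t0.
  rewrite /F !mulr_ge0 ?expR_ge0 ?tkernel_ge0 ?(ltW t1) //=.
  apply: (@le_trans _ _ (expR (- (z * t)) * ((K + L) * expR (z / 2 * t)))).
    rewrite ler_wpM2l ?expR_ge0 //.
    apply: (@le_trans _ _ (1 * (t * (1 + t)))).
      by rewrite ler_wpM2r ?tkernel_le1 // mulr_ge0 // ltW.
    by have := hK t t0; have := hL t t0; rewrite expr1 expr2; lra.
  rewrite mulrCA -expRD; apply: ler_wpM2l; first by rewrite ltW // addr_gt0.
  by rewrite ler_expR; lra.
have f0 : \int[mu]_(t in `[0, +oo[) f t = 0.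
  by rewrite (FTC2y fi cf cF dF lF) /F mul0r !mulr0 subr0.
by move: fE; rewrite f0; lra.
Unshelve. all: by end_near. Qed.

Lemma Rintegral_scale (G : R -> R) z : 0 < z ->
  {within `[0, +oo[, continuous G} -> (forall t, 0 <= t -> 0 <= G t) ->
  \int[mu]_(t in `[0, +oo[) G t = \int[mu]_(s in `[0, +oo[) (G (s / z) / z).
Proof.
move=> z0 cG G0; have zi : 0 < z^-1 by rewrite invr_gt0.
pose F s := s / z.
have dF s : is_derive s 1 F z^-1.
  by apply: is_drv_eq (is_drvM (is_drv_id s) (is_drvC z^-1 s)) _; ring.
have F'E : (F^`())%classic = cst z^-1.
  by apply/funext => s; rewrite derive1E; have [_ ->] := dF s.
have F0 : F 0 = 0 by rewrite /F mul0r.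
have := @increasing_ge0_integration_by_substitutiony R F G 0.
rewrite F'E F0 /Rintegral => ->; first by congr fine; apply: eq_integral.
- by move=> x y _ _ xy; rewrite ltr_pM2r.
- by move=> x _; exact: cst_continuous.
- exact: is_cvg_cst.
- exact: is_cvg_cst.
- split; first by move=> s _; have [] := dF s.
  by apply: cvg_at_right_filter; exact: is_drv_cont (dF 0).
- exact: gt0_cvgMly.
- exact: cG.
- by move=> s; rewrite in_itv /= andbT => s0; rewrite G0 // ltW.
Qed.

Lemma tkernel_scale z s : 0 < z -> 0 <= s ->
  z `^ c * tkernel (s / z) = (s / (1 + s / z)) `^ c.
Proof.
move=> z0 s0; have sz : 0 <= s / z by rewrite divr_ge0 // ltW.
have t1 := t1_gt0 sz.
rewrite /tkernel -powRM ?(ltW z0) //; last by rewrite divr_ge0 // ltW.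
by congr powR; rewrite mulrA [z * _]mulrCA divff ?mulr1 // gt_eqF.
Qed.

Let scale_drv z s : is_derive s 1 (fun s => s / z) z^-1.
Proof. by apply: is_drv_eq (is_drvM (is_drv_id s) (is_drvC z^-1 s)) _; ring. Qed.

(** The integrand of [z `^ (c + 1) * lapl j z] after the substitution
    [t = s / z], which fixes the exponential and makes the limit [z --> +oo] a
    matter of dominated convergence. *)
Definition lapl_int' (j : nat) z s :=
  expR (- s) * ((s / z) ^+ j * (z `^ c * tkernel (s / z))).

Lemma lapl_int'_cont j z : 0 < z -> {within `[0, +oo[, continuous (lapl_int' j z)}.
Proof.
move=> z0; have zi : 0 < z^-1 by rewrite invr_gt0.
have ca : {within `[0, +oo[, continuous (fun s : R => expR (- s))}.
  apply: cont_itv0y => t _; exact: is_drv_cont (is_drv_exp (is_drvN (is_drv_id t))).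
have cb : {within `[0, +oo[, continuous (fun s : R => (s / z) ^+ j)}.
  apply: cont_itv0y => t _.
  have c1' := is_drv_cont (scale_drv z t); have c2' := @exprn_cont j (t / z).
  exact: (continuous_comp c1' c2').
have cc : {within `[0, +oo[, continuous (fun _ : R => z `^ c)}.
  apply: cont_itv0y => t _; exact: (is_drv_cont (is_drvC (z `^ c) t)).
suff cd : {within `[0, +oo[, continuous (fun s : R => tkernel (s / z))}.
  exact: (within_contM ca (within_contM cb (within_contM cc cd))).
apply/continuous_within_itvcyP; split.
  move=> t; rewrite in_itv /= andbT => t0.
  have tz : 0 < t / z by rewrite divr_gt0.
  exact: is_drv_cont (is_drv_comp (g := fun s => s / z) (tkernel_drv tz) (scale_drv z t)).
have -> : tkernel (0 / z) = 0 by rewrite /tkernel !mul0r powR0 ?gt_eqF.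
have lim : t / z @[t --> 0^'+] --> 0.
  rewrite -[X in _ --> X](mul0r z^-1); apply: cvg_at_right_filter.
  exact: is_drv_cont (scale_drv z 0).
apply: (squeeze_cvgr _ (cvg_cst 0) lim).
near=> t; have t0 : 0 <= t by near: t; exact: nbhs_right_ge.
have zt : 0 <= t / z by rewrite divr_ge0 // ltW.
by rewrite tkernel_ge0 /= tkernel_le.
Unshelve. all: by end_near. Qed.

Lemma lapl_int'_ge0 j z s : 0 < z -> 0 <= s -> 0 <= lapl_int' j z s.
Proof.
move=> z0 s0; rewrite !mulr_ge0 ?expR_ge0 ?powR_ge0 ?exprn_ge0 ?divr_ge0 //.
exact: ltW.
Qed.

Lemma lapl_int'_le j z s : 1 <= z -> 0 <= s ->
  lapl_int' j z s <= expR (- s) * (s ^+ j * s `^ c) / z ^+ j.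
Proof.
move=> z1 s0; have z0 : 0 < z by exact: lt_le_trans z1.
rewrite /lapl_int' tkernel_scale // -[leRHS]mulrA ler_wpM2l ?expR_ge0 //.
rewrite expr_div_n mulrAC ler_wpM2r ?invr_ge0 ?exprn_ge0 ?(ltW z0) //.
rewrite ler_wpM2l ?exprn_ge0 //.
have sz : 0 <= s / z by rewrite divr_ge0 // ltW.
have t1 := t1_gt0 sz.
apply: ge0_ler_powR; rewrite ?nnegrE //; [exact: ltW|by rewrite divr_ge0 // ltW|].
by rewrite ler_pdivrMr // ler_peMr //; lra.
Qed.

Lemma gamma_integrable j :
  mu.-integrable `[0, +oo[ (EFin \o (fun s => expR (- s) * (s ^+ j * s `^ c))).
Proof.
have e4 : (0 : R) < 4^-1 by rewrite invr_gt0.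
have [K K0 hK] := exprn_le_exp j e4.
have [L L0 hL] := powR_le_exp c e4.
have e2 : (0 : R) < 2^-1 by rewrite invr_gt0.
apply: (@exp_le_integrable _ _ (K * (L + 1)) _ e2).
  apply: measurable_funTS; apply: measurable_funM.
    apply: continuous_measurable_fun => t.
    exact: is_drv_cont (is_drv_exp (is_drvN (is_drv_id t))).
  apply: measurable_funM; last exact: measurable_powR.
  by apply: continuous_measurable_fun => t; exact: exprn_cont.
move=> t t0; rewrite ger0_norm ?mulr_ge0 ?expR_ge0 ?exprn_ge0 ?powR_ge0 //.
have hc : t `^ c <= (L + 1) * expR (4^-1 * t).
  rewrite mulrDl mul1r; have [t1|t1] := leP 1 t.
    by apply: le_trans (hL t t1) _; rewrite lerDl expR_ge0.
  apply: (@le_trans _ _ 1).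
    rewrite -[leRHS](powRr0 t) -[X in _ <= _ `^ X](subrr c).
    have p1 : (1 : R) `^ c = 1 by rewrite powR1.
    rewrite subrr powRr0 -[leRHS]p1.
    by apply: ge0_ler_powR; rewrite ?nnegrE //; exact: ltW.
  apply: (@le_trans _ _ (expR (4^-1 * t))).
    by rewrite -expR0 ler_expR mulr_ge0 // ltW.
  by rewrite lerDr mulr_ge0 ?expR_ge0 // ltW.
have h1 := ler_pM (exprn_ge0 j t0) (powR_ge0 t c) (hK t t0) hc.
apply: le_trans (ler_wpM2l (expR_ge0 _) h1) _.
set E := expR (4^-1 * t).
have -> : expR (- t) * (K * E * ((L + 1) * E)) = K * (L + 1) * (expR (- t) * (E * E)).
  by ring.
rewrite /E -!expRD; apply: ler_wpM2l.
  by rewrite mulr_ge0 ?addr_ge0 // ltW.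
by rewrite ler_expR; lra.
Qed.

Lemma lapl_int'_integrable j z : 1 <= z ->
  mu.-integrable `[0, +oo[ (EFin \o lapl_int' j z).
Proof.
move=> z1; have z0 : 0 < z by exact: lt_le_trans z1.
have mf : measurable_fun (`[0, +oo[ : set R) (lapl_int' j z).
  exact: (within_measurable (@lapl_int'_cont j z z0)).
apply: (@le_integrable _ _ _ mu _ _ _
  (EFin \o (fun s => expR (- s) * (s ^+ j * s `^ c)))) => //.
- exact/measurable_EFinP.
- move=> t /=; rewrite in_itv /= andbT => t0; rewrite lee_fin.
  rewrite [leRHS]ger0_norm ?mulr_ge0 ?exprn_ge0 ?expR_ge0 ?powR_ge0 //.
  rewrite ger0_norm ?lapl_int'_ge0 //; apply: le_trans (lapl_int'_le _ z1 t0) _.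
  rewrite ler_piMr ?mulr_ge0 ?exprn_ge0 ?expR_ge0 ?powR_ge0 //.
  by rewrite invf_le1 ?exprn_ege1 ?exprn_gt0.
- exact: gamma_integrable.
Qed.

Lemma lapl_scaled j z : 1 <= z ->
  z `^ (c + 1) * lapl j z = \int[mu]_(s in `[0, +oo[) lapl_int' j z s.
Proof.
move=> z1; have z0 : 0 < z by exact: lt_le_trans z1.
have pz : 0 < z `^ (c + 1) by exact: powR_gt0.
have pE : z `^ (c + 1) = z `^ c * z.
  by rewrite powRD ?(gt_eqF z0) ?implybT // powRr1 // ltW.
rewrite /lapl (Rintegral_scale z0 (@lapl_int_cont j z)); last first.
  by move=> t t0; rewrite !mulr_ge0 ?expR_ge0 ?exprn_ge0 ?tkernel_ge0.
have e t : lapl_int j z (t / z) / z = (z `^ (c + 1))^-1 * lapl_int' j z t.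
  rewrite /lapl_int /lapl_int' pE.
  have -> : z * (t / z) = t by rewrite mulrCA divff ?mulr1 // gt_eqF.
  have zn : z != 0 by rewrite gt_eqF.
  have pn : z `^ c != 0 by rewrite gt_eqF // powR_gt0.
  by field; rewrite zn pn.
under eq_Rintegral do rewrite e.
rewrite RintegralZl //; last exact: lapl_int'_integrable.
by rewrite mulrA divff ?mul1r // gt_eqF.
Qed.

Lemma lapl_int'_cvg j s : 0 <= s ->
  lapl_int' j z s @[z --> +oo] --> expR (- s) * (0 ^+ j * s `^ c).
Proof.
move=> s0.
have iz := @invy_cvg0 R.
have sz : s / z @[z --> +oo] --> (0 : R).
  by rewrite -(mulr0 s); apply: cvgM iz; exact: cvg_cst.
apply: cvgM; first exact: cvg_cst.
apply: cvgM.
  exact: (cvg_comp _ _ sz (@exprn_cont j 0)).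
have lim : (s / (1 + s / z)) `^ c @[z --> +oo] --> s `^ c.
  have [->|sn] := eqVneq s 0.
    by apply: cvg_near_cst; apply: nearW => z; rewrite mul0r.
  have sp : 0 < s by rewrite lt_neqAle eq_sym sn.
  have l1 : s / (1 + s / z) @[z --> +oo] --> s / (1 + 0).
    apply: cvgM; first exact: cvg_cst.
    apply: cvgV; first by rewrite addr0 oner_neq0.
    by apply: cvgD sz; exact: cvg_cst.
  rewrite addr0 divr1 in l1.
  exact: (cvg_comp _ _ l1 (is_drv_cont (is_drv_powR c sp))).
apply: cvg_trans lim; apply: near_eq_cvg; near=> z.
by rewrite tkernel_scale //; near: z; apply: nbhs_pinfty_gt; exact: num_real.
Unshelve. all: by end_near. Qed.

Lemma lapl_cvg j : z `^ (c + 1) * lapl j z @[z --> +oo] -->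
  0 ^+ j * \int[mu]_(s in `[0, +oo[) (expR (- s) * (s ^+ 0 * s `^ c)).
Proof.
have [] := @Rdominated_cvgy R _ _ mu `[0, +oo[ (lapl_int' j)
  (fun s => expR (- s) * (0 ^+ j * s `^ c)) (fun s => expR (- s) * (s ^+ j * s `^ c)) 1.
- by [].
- move=> z z1; have z0 : 0 < z by exact: lt_le_trans z1.
  exact: (within_measurable (@lapl_int'_cont j z z0)).
- by move=> s /=; rewrite in_itv /= andbT; exact: lapl_int'_cvg.
- exact: gamma_integrable.
- move=> z s z1 /=; rewrite in_itv /= andbT => s0.
  have z0 : 0 < z by exact: lt_le_trans z1.
  rewrite ger0_norm ?lapl_int'_ge0 //; apply: le_trans (lapl_int'_le _ z1 s0) _.
  rewrite ler_piMr ?mulr_ge0 ?exprn_ge0 ?expR_ge0 ?powR_ge0 //.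
  by rewrite invf_le1 ?exprn_ege1 ?exprn_gt0.
move=> _ lim; apply: cvg_trans.
  by apply: near_eq_cvg; near=> z; rewrite lapl_scaled //;
    near: z; apply: nbhs_pinfty_ge; exact: num_real.
rewrite -RintegralZl //; last exact: gamma_integrable.
have -> : \int[mu]_(s in `[0, +oo[) (0 ^+ j * (expR (- s) * (s ^+ 0 * s `^ c))) =
    \int[mu]_(s in `[0, +oo[) (expR (- s) * (0 ^+ j * s `^ c)).
  by apply: eq_Rintegral => s _; rewrite expr0 mul1r mulrCA.
exact: lim.
Unshelve. all: by end_near. Qed.

Lemma gamma_gt0 : 0 < \int[mu]_(s in `[0, +oo[) (expR (- s) * (s ^+ 0 * s `^ c)).
Proof.
have h12 : (1 : R) < 2 by lra.
have sub : `[1, 2] `<=` (`[0, +oo[ : set R).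
  by move=> t /=; rewrite !in_itv /=; lra.
have e0 : 0 < expR (- 2 : R) by exact: expR_gt0.
apply: (Rintegral_gt0 (gamma_integrable 0) _ h12 sub e0).
  by move=> t _; rewrite !mulr_ge0 ?expR_ge0 ?powR_ge0 // expr0.
move=> t /andP[t1 t2]; rewrite expr0 mul1r -[leLHS]mulr1.
apply: ler_pM; rewrite ?expR_ge0 ?ler_expR ?lerN2 //.
have p1 : (1 : R) `^ c = 1 by rewrite powR1.
rewrite -p1; apply: ge0_ler_powR; rewrite ?nnegrE //; first exact: ltW.
exact: le_trans t1.
Qed.

End laplace.

Section existence.
Context {R : realType}.

(** The solution together with the decay of its derivative, which is what
    makes the lowering step preserve the normalization. *)
Definition tricomi_sol (al : R) (w w' : R -> R) : Prop :=
  [/\ kummer al 2 w w', z `^ al * w z @[z --> +oo] --> (1 : R) &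
      z `^ al * w' z @[z --> +oo] --> (0 : R)].

Lemma tricomi_sol_base (al : R) : 2 <= al -> exists w w', tricomi_sol al w w'.
Proof.
move=> al2; have c1 : 1 <= al - 1 by lra.
have := kummerZ _ (lapl_kummer c1).
move: (gamma_gt0 c1) (@lapl_cvg R _ c1 0) (@lapl_cvg R _ c1 1).
rewrite subrK expr0 expr1 mul0r mul1r.
move: (Rintegral _ _ _) (lapl _ 0) (lapl _ 1) => G L0 L1 G0 l0 l1 k.
have Gn : G != 0 by rewrite gt_eqF.
exists (fun z => G^-1 * L0 z), (fun z => G^-1 * - L1 z); split.
- exact: k.
- rewrite -(mulVf Gn); apply: cvg_trans (cvgM (cvg_cst G^-1) l0).
  by apply: near_eq_cvg; near=> z; rewrite /= mulrCA.
- rewrite -(mulr0 (- G^-1)); apply: cvg_trans (cvgM (cvg_cst (- G^-1)) l1).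
  by apply: near_eq_cvg; near=> z; rewrite /=; ring.
Unshelve. all: by end_near. Qed.

Lemma tricomi_sol_lower (al : R) w w' : tricomi_sol al w w' ->
  tricomi_sol (al - 1) (fun z => (z + (al - 2)) * w z - z * w' z)
    (fun z => (al - 1) * (w' z - w z)).
Proof.
case=> k l l'.
have iz := @invy_cvg0 R.
have pE z : 0 < z -> z `^ (al - 1) = z `^ al / z.
  move=> z0; rewrite powRB; last by rewrite (gt_eqF z0) implybT.
  by rewrite powRr1 // ltW.
split; first exact: kummer_lower.
- have lim : (1 + (al - 2) * z^-1) * (z `^ al * w z) - z `^ al * w' z
      @[z --> +oo] --> (1 + (al - 2) * 0) * 1 - (0 : R).
    apply: cvgB l'; apply: cvgM l; apply: cvgD; first exact: cvg_cst.
    by apply: cvgM iz; exact: cvg_cst.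
  rewrite mulr0 addr0 mul1r subr0 in lim; apply: cvg_trans lim.
  apply: near_eq_cvg; near=> z.
  have z0 : 0 < z by near: z; apply: nbhs_pinfty_gt; exact: num_real.
  by rewrite pE //; field; rewrite gt_eqF.
- have lim : (al - 1) * (z^-1 * (z `^ al * w' z) - z^-1 * (z `^ al * w z))
      @[z --> +oo] --> (al - 1) * (0 * 0 - 0 * (1 : R)).
    by apply: cvgM; [exact: cvg_cst|apply: cvgB; apply: cvgM].
  rewrite !mul0r subrr mulr0 in lim; apply: cvg_trans lim.
  apply: near_eq_cvg; near=> z.
  have z0 : 0 < z by near: z; apply: nbhs_pinfty_gt; exact: num_real.
  by rewrite pE //; field; rewrite gt_eqF.
Unshelve. all: by end_near. Qed.

(** The integral representation covers [2 <= al]; every other [al] is reached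
    from some [al + n] by lowering. *)
Lemma tricomi_sol_exists (al : R) : exists w w', tricomi_sol al w w'.
Proof.
suff H (n : nat) (be : R) : 2 <= be + n%:R -> exists w w', tricomi_sol be w w'.
  apply: (H (Num.Def.archi_bound `|2 - al|)).
  have := archi_boundP (normr_ge0 (2 - al)); have := ler_norm (2 - al); lra.
elim: n be => [|n IH] be; first by rewrite addr0; exact: tricomi_sol_base.
move=> hn; have [|w [w' h]] := IH (be + 1); first by rewrite -addrA nat1r.
have := tricomi_sol_lower h; rewrite addrK => h'.
by do 2 eexists; exact: h'.
Qed.

End existence.

Section decaying_solution.
Context {R : realType}.

Lemma tricomiU_eq (al be : R) w w' : kummer al be w w' ->
  z `^ al * w z @[z --> +oo] --> (1 : R) ->
  forall z, 0 < z -> tricomiU al be z = w z.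
Proof.
move=> k l.
have [k' l'] : is_tricomi al be (tricomiU al be).
  rewrite /tricomiU; apply: xgetPex; exists w; split => //.
  by apply/kummerP; exact: kummer_derive1 k.
by apply: kummer_unique k l _ l'; apply/kummerP; exact: k'.
Qed.

(** The solution is obtained by lowering a solution [w1] at [al + 1]; then
    [w' = al * (w1' - w1)], which yields the exact decay of [w']. *)
Lemma tricomi2_asymp (al : R) : exists w w', [/\ kummer al 2 w w',
  z `^ al * w z @[z --> +oo] --> (1 : R),
  z `^ (al + 1) * w' z @[z --> +oo] --> - al &
  forall z, 0 < z -> tricomiU al 2 z = w z].
Proof.
have [w [w' h]] := tricomi_sol_exists (al + 1).
have [k l _] := tricomi_sol_lower h; have [_ lw lw'] := h.
rewrite addrK in k l.
do 2 eexists; split; [exact: k|exact: l| |exact: tricomiU_eq k l].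
have -> : - al = al * (0 - 1) by ring.
have lim : al * (z `^ (al + 1) * w' z - z `^ (al + 1) * w z) @[z --> +oo]
    --> al * (0 - 1).
  by apply: cvgM; [exact: cvg_cst|exact: cvgB].
apply: cvg_trans lim; apply: near_eq_cvg; near=> z; ring.
Unshelve. all: by end_near. Qed.

(** Among the solutions of [t v'' = a t v' + b v] all but a line grow like
    [expR (a t)]; the one that behaves like a power is [U(b / a, 0, a t)]. *)
Lemma decaying_solution (a b : R) : 0 < a -> exists v v' : R -> R,
  [/\ forall t : R, 0 < t ->
        is_derive t 1 v (v' t) /\ is_derive t 1 v' (a * v' t + b / t * v t),
      t `^ (b / a) * v t @[t --> +oo] --> a `^ (- (b / a)),
      t `^ (b / a) * v' t @[t --> +oo] --> (0 : R),
      forall t, 0 < t -> v t = a * t * tricomiU (1 + b / a) 2 (a * t) &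
      v' 1 = - b * tricomiU (1 + b / a) 1 a].
Proof.
move=> a0; have an : a != 0 by rewrite gt_eqF.
set al := b / a; have ba : b = a * al by rewrite /al; field.
have [w [w' [k lw lw' wE]]] := tricomi2_asymp (1 + al).
exists (fun t => a * t * w (a * t)).
exists (fun t => a * (w (a * t) + a * t * w' (a * t))).
have at0 t : 0 < t -> 0 < a * t by move=> t0; rewrite mulr_gt0.
have lat : a * t @[t --> +oo] --> +oo.
  by under eq_fun do rewrite mulrC; exact: gt0_cvgMly a0 cvg_id.
have pE z (p : R) : 0 < z -> z `^ (1 + p) = z * z `^ p.
  move=> z0; rewrite powRD; last by rewrite (gt_eqF z0) implybT.
  by rewrite powRr1 // ltW.
have sc t : 0 < t -> t `^ al = a `^ (- al) * (a * t) `^ al.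
  move=> t0; rewrite powRM ?(ltW a0) ?(ltW t0) // mulrA -powRD.
    by rewrite addNr powRr0 mul1r.
  by rewrite an implybT.
have lw2 : z `^ (1 + al) * w z + z `^ (1 + al + 1) * w' z @[z --> +oo] --> - al.
  have -> : - al = 1 + - (1 + al) by ring.
  exact: cvgD lw lw'.
split.
- move=> t t0; have z0 := at0 _ t0; have [d1 d2] := k _ z0.
  have da := is_drvZ a (is_drv_id t).
  have D1 := is_drv_comp (g := fun t => a * t) d1 da.
  have D2 := is_drv_comp (g := fun t => a * t) d2 da.
  have tn : t != 0 by rewrite gt_eqF.
  split.
    by apply: is_drv_eq (is_drvM da D1) _; ring.
  apply: is_drv_eq (is_drvZ a (is_drvD D1 (is_drvM da D2))) _.
  by rewrite /= {1}ba; field; rewrite tn an.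
- have l1 := cvg_comp _ _ lat lw.
  have lim : a `^ (- al) * ((a * t) `^ (1 + al) * w (a * t)) @[t --> +oo]
      --> a `^ (- al) * 1 by apply: cvgM l1; exact: cvg_cst.
  rewrite mulr1 in lim; apply: cvg_trans lim.
  apply: near_eq_cvg; near=> t.
  have t0 : 0 < t by near: t; apply: nbhs_pinfty_gt; exact: num_real.
  by rewrite /= sc // pE ?at0 //; ring.
- have l1 := cvg_comp _ _ lat (@invy_cvg0 R).
  have l2 := cvg_comp _ _ lat lw2.
  have lim : a `^ (- al) * a * ((a * t)^-1 * ((a * t) `^ (1 + al) * w (a * t)
      + (a * t) `^ (1 + al + 1) * w' (a * t))) @[t --> +oo]
      --> a `^ (- al) * a * (0 * - al).
    by apply: cvgM; [exact: cvg_cst|exact: cvgM l1 l2].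
  rewrite mul0r mulr0 in lim; apply: cvg_trans lim.
  apply: near_eq_cvg; near=> t.
  have t0 : 0 < t by near: t; apply: nbhs_pinfty_gt; exact: num_real.
  rewrite /= sc // [1 + al + 1]addrC !pE ?at0 //.
  by field; rewrite gt_eqF // an.
- by move=> t t0; rewrite wE ?at0.
rewrite mulr1.
have [b0|bn] := eqVneq b 0.
  have al0 : al = 0 by rewrite /al b0 mul0r.
  rewrite b0 oppr0 mul0r.
  have ki : kummer (1 + al) 2 (fun z => z^-1) (fun z => - 1 / z ^+ 2).
    move=> z z0; have zn : z != 0 by rewrite gt_eqF.
    have z2n : z ^+ 2 != 0 by rewrite expf_neq0.
    split; first exact: is_drvV (is_drv_id z).
    apply: is_drv_eq (is_drvM (is_drvC (-1) z)
      (is_drvV (f := fun z => z ^+ 2) z2n (is_drv_sqr (is_drv_id z)))) _.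
    by rewrite al0; field.
  have li : z `^ (1 + al) * z^-1 @[z --> +oo] --> (1 : R).
    apply: cvg_near_cst; near=> z.
    have z0 : 0 < z by near: z; apply: nbhs_pinfty_gt; exact: num_real.
    by rewrite al0 addr0 powRr1 ?ltW // divff // gt_eqF.
  have wi := kummer_unique ki li k lw.
  have w'i : w' a = - 1 / a ^+ 2.
    have [[_ <-] _] := k a a0; have [dk _] := ki a a0.
    have [] // := @is_drv_near R (fun z => z^-1) w a _ _ dk.
    by apply: filterS (near_pos a0) => t t0; rewrite wi.
  by rewrite wi // w'i; field.
have aln : al != 0 by rewrite /al mulf_neq0 // invr_neq0.
have ku : kummer (1 + al) 1 (fun z => - al^-1 * (w z + z * w' z))
    (fun z => - al^-1 * ((1 + al) * w z + z * w' z)).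
  move=> z z0; have zn : z != 0 by rewrite gt_eqF.
  have [d1 d2] := k z z0; have dz := is_drv_id z.
  split.
    apply: is_drv_eq (is_drvZ _ (is_drvD d1 (is_drvM dz d2))) _.
    by field; rewrite aln zn.
  apply: is_drv_eq (is_drvZ _ (is_drvD (is_drvZ (1 + al) d1) (is_drvM dz d2))) _.
  by field; rewrite aln zn.
have lu : z `^ (1 + al) * (- al^-1 * (w z + z * w' z)) @[z --> +oo] --> (1 : R).
  have lim : - al^-1 * (z `^ (1 + al) * w z + z `^ (1 + al + 1) * w' z)
      @[z --> +oo] --> - al^-1 * - al by apply: cvgM lw2; exact: cvg_cst.
  rewrite mulrNN mulVf // in lim; apply: cvg_trans lim.
  apply: near_eq_cvg; near=> z.
  have z0 : 0 < z by near: z; apply: nbhs_pinfty_gt; exact: num_real.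
  by rewrite /= [1 + al + 1]addrC [z `^ (1 + (1 + al))]pE //; ring.
rewrite (tricomiU_eq ku lu a0) [in RHS]ba.
by field.
Unshelve. all: by end_near. Qed.

End decaying_solution.

(** * The equation along one path *)

Section bounds.
Context {R : realType}.
Implicit Types h : R -> R.

Lemma cont_bounded h (x y : R) : (forall t, x <= t -> {for t, continuous h}) ->
  x <= y -> exists2 K, 0 <= K & forall t, x <= t <= y -> `|h t| <= K.
Proof.
move=> ch xy.
have cn : {within `[x, y], continuous (fun t => `|h t|)}.
  apply: cont_within => t /=; rewrite in_itv /= => /andP[xt _].
  by apply: (continuous_comp (ch t xt)); exact: norm_continuous.
have [c _ hc] := EVT_max xy cn.
by exists `|h c| => // t xty; apply: hc; rewrite in_itv.
Qed.

Lemma powR_exp_bound h (p e l : R) : 0 < e ->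
  (forall t, 1 <= t -> {for t, continuous h}) ->
  t `^ p * h t @[t --> +oo] --> l ->
  exists2 K, 0 <= K & forall t, 1 <= t -> `|h t| <= K * expR (e * t).
Proof.
move=> e0 ch lh.
have [K K0 hK] := powR_le_exp (- p) e0.
have [M [_ hM]] : \forall t \near +oo, `|t `^ p * h t| <= `|l| + 1.
  by apply: (cvgr_norm_le _ lh); rewrite ltrDl.
pose y := Num.max M 1 + 1.
have y1 : 1 <= y by rewrite /y ler_wpDr // le_max lexx orbT.
have [L L0 hL] := cont_bounded ch y1.
exists (L + (`|l| + 1) * K) => [|t t1].
  by rewrite addr_ge0 // mulr_ge0 ?addr_ge0 // ltW.
have t0 : 0 < t by exact: lt_le_trans t1.
have [ty|yt] := leP t y.
  rewrite -[leLHS]mulr1; apply: ler_pM => //.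
  - by apply: le_trans (hL t _) _; rewrite ?t1 // lerDl mulr_ge0 ?addr_ge0 // ltW.
  - by rewrite -expR0 ler_expR mulr_ge0 // ltW.
have Mt : M < t.
  by apply: le_lt_trans yt; rewrite /y ler_wpDr // le_max lexx.
have := hM t Mt; rewrite normrM (ger0_norm (powR_ge0 _ _)) => h1.
have tp : 0 < t `^ p by exact: powR_gt0.
apply: (@le_trans _ _ ((`|l| + 1) * t `^ (- p))).
  by rewrite powRN ler_pdivlMr // mulrC.
apply: (@le_trans _ _ ((`|l| + 1) * K * expR (e * t))).
  by rewrite -mulrA; apply: ler_wpM2l; [rewrite addr_ge0|exact: hK].
by rewrite ler_wpM2r ?expR_ge0 // lerDr.
Qed.

End bounds.

Section weights.
Context {R : realType}.
Context (a b : R) (v v' : R -> R) (a0 : 0 < a).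
Context (dv : forall t : R, 0 < t ->
  is_derive t 1 v (v' t) /\ is_derive t 1 v' (a * v' t + b / t * v t)).
Context (lv : t `^ (b / a) * v t @[t --> +oo] --> a `^ (- (b / a))).
Context (lv' : t `^ (b / a) * v' t @[t --> +oo] --> (0 : R)).

(** The integrand of the Wiener integral, and the weight of the running
    integral in the martingale of the equation. *)
Definition wt t := expR (- (a * t)) * v (1 + t).
Definition wt_int t := expR (- (a * t)) * v' (1 + t).
Definition wt' t := wt_int t - a * wt t.

Let dsh (t : R) : is_derive t 1 (fun t : R => 1 + t) 1.
Proof. by apply: is_drv_eq (is_drvD (is_drvC 1 t) (is_drv_id t)) _; ring. Qed.

Let dexp (t : R) : is_derive t 1 (fun t => expR (- (a * t))) (- a * expR (- (a * t))).
Proof.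
by apply: is_drv_eq (is_drv_exp (is_drvN (is_drvZ a (is_drv_id t)))) _; ring.
Qed.

Lemma wt_drv (t : R) : -1 < t -> is_derive t 1 wt (wt' t).
Proof.
move=> t1; have s0 : 0 < 1 + t by lra.
have [d1 _] := dv s0.
apply: is_drv_eq (is_drvM (dexp t) (is_drv_comp (g := fun t => 1 + t) d1 (dsh t))) _.
by rewrite /wt' /wt /wt_int; ring.
Qed.

Lemma wt_int_drv (t : R) : -1 < t -> is_derive t 1 wt_int (b / (1 + t) * wt t).
Proof.
move=> t1; have s0 : 0 < 1 + t by lra.
have [_ d1] := dv s0.
apply: is_drv_eq (is_drvM (dexp t) (is_drv_comp (g := fun t => 1 + t) d1 (dsh t))) _.
by rewrite /wt /wt_int; ring.
Qed.

Lemma wt'_cont t : -1 < t -> {for t, continuous wt'}.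
Proof.
move=> t1; exact: is_drv_cont (is_drvB (wt_int_drv t1) (is_drvZ a (wt_drv t1))).
Qed.

Lemma wt_bound : exists2 K, 0 <= K & forall t, 0 <= t ->
  `|wt t| <= K * expR (- (a / 2 * t)) /\ `|wt' t| <= K * expR (- (a / 2 * t)).
Proof.
have a2 : 0 < a / 2 by rewrite divr_gt0.
have cv (t : R) : 1 <= t -> {for t, continuous v}.
  by move=> t1; have [d1 _] := dv (lt_le_trans ltr01 t1); exact: is_drv_cont d1.
have cv' (t : R) : 1 <= t -> {for t, continuous v'}.
  by move=> t1; have [_ d1] := dv (lt_le_trans ltr01 t1); exact: is_drv_cont d1.
have [K K0 hK] := powR_exp_bound a2 cv lv.
have [L L0 hL] := powR_exp_bound a2 cv' lv'.
pose E := expR (a / 2).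
have E0 : 0 < E by exact: expR_gt0.
have bw t : 0 <= t -> `|wt t| <= K * E * expR (- (a / 2 * t)).
  move=> t0; rewrite normrM (ger0_norm (expR_ge0 _)).
  have h : 1 <= 1 + t by lra.
  apply: le_trans (ler_wpM2l (expR_ge0 _) (hK _ h)) _.
  rewrite [leLHS]mulrCA -[leRHS]mulrA; apply: ler_wpM2l => //.
  by rewrite -!expRD ler_expR; lra.
have bw' t : 0 <= t -> `|wt_int t| <= L * E * expR (- (a / 2 * t)).
  move=> t0; rewrite normrM (ger0_norm (expR_ge0 _)).
  have h : 1 <= 1 + t by lra.
  apply: le_trans (ler_wpM2l (expR_ge0 _) (hL _ h)) _.
  rewrite [leLHS]mulrCA -[leRHS]mulrA; apply: ler_wpM2l => //.
  by rewrite -!expRD ler_expR; lra.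
have LE : 0 <= L * E by rewrite mulr_ge0 // ltW.
have KE : 0 <= K * E by rewrite mulr_ge0 // ltW.
exists (L * E + (1 + a) * (K * E)).
  by rewrite addr_ge0 // mulr_ge0 // addr_ge0 // ltW.
move=> t t0; have e0 := expR_ge0 (- (a / 2 * t)).
have aKE : 0 <= a * (K * E) by rewrite mulr_ge0 // ltW.
split.
  by apply: le_trans (bw t t0) _; apply: ler_wpM2r => //; lra.
apply: le_trans (ler_normB _ _) _; rewrite [`|a * _|]normrM (gtr0_norm a0).
have h1 := bw' t t0; have h2 := ler_wpM2l (ltW a0) (bw t t0).
have h3 : 0 <= K * E * expR (- (a / 2 * t)) by rewrite mulr_ge0.
lra.
Qed.

Let lsh : (1 + t : R) @[t --> +oo] --> +oo.
Proof.
apply/cvgryPge => A; near=> t.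
have : A <= t by near: t; apply: nbhs_pinfty_ge; exact: num_real.
lra.
Unshelve. all: by end_near. Qed.

Lemma weight_cvg : v (1 + t) * t `^ (b / a) @[t --> +oo] --> a `^ (- (b / a)).
Proof.
have l1 := cvg_comp _ _ lsh lv.
have l3 : (t / (1 + t)) `^ (b / a) @[t --> +oo] --> (1 : R).
  have iz := cvg_comp _ _ lsh (@invy_cvg0 R).
  have lq : 1 - (1 + t)^-1 @[t --> +oo] --> (1 - 0 : R).
    by apply: cvgB iz; exact: cvg_cst.
  rewrite subr0 in lq.
  have cp := is_drv_cont (is_drv_powR (b / a) ltr01).
  have lim : (1 - (1 + t)^-1) `^ (b / a) @[t --> +oo] --> (1 : R) `^ (b / a).
    exact: (cvg_comp _ _ lq cp).
  rewrite powR1 in lim; apply: cvg_trans lim; apply: near_eq_cvg; near=> t.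
  have t0 : 0 < t by near: t; apply: nbhs_pinfty_gt; exact: num_real.
  rewrite /=; congr powR; field; rewrite gt_eqF //; lra.
have l4 : (t / (1 + t)) `^ (b / a) * ((1 + t) `^ (b / a) * v (1 + t))
    @[t --> +oo] --> 1 * a `^ (- (b / a)) by exact: cvgM l3 l1.
rewrite mul1r in l4; apply: cvg_trans l4; apply: near_eq_cvg; near=> t.
have t0 : 0 < t by near: t; apply: nbhs_pinfty_gt; exact: num_real.
have s0 : 0 < 1 + t by lra.
rewrite mulrA -powRM ?(ltW s0) //; last by rewrite divr_ge0 // ltW.
by rewrite divfK ?(gt_eqF s0) // mulrC.
Unshelve. all: by end_near. Qed.

Lemma weight_ratio_cvg0 : v' (1 + t) / v (1 + t) @[t --> +oo] --> (0 : R).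
Proof.
have p0 : a `^ (- (b / a)) != 0 by rewrite gt_eqF // powR_gt0.
have l1 := cvg_comp _ _ lsh lv; have l2 := cvg_comp _ _ lsh lv'.
have lim : ((1 + t) `^ (b / a) * v' (1 + t)) / ((1 + t) `^ (b / a) * v (1 + t))
    @[t --> +oo] --> 0 / a `^ (- (b / a)) by apply: cvgM l2 _; exact: cvgV l1.
rewrite mul0r in lim; apply: cvg_trans lim; apply: near_eq_cvg; near=> t.
have t0 : 0 < t by near: t; apply: nbhs_pinfty_gt; exact: num_real.
have s0 : 0 < 1 + t by lra.
have pn : (1 + t) `^ (b / a) != 0 by rewrite gt_eqF // powR_gt0.
by rewrite invfM mulrACA divff // mul1r.
Unshelve. all: by end_near. Qed.

(** Beyond [t0] the running integral enters [wt X] as a small perturbation,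
    and [wt X] can be divided by [v]. *)
Lemma weights_asymp : exists2 t0, 1 <= t0 & forall t, t0 <= t ->
  [/\ 0 < wt t, `|wt_int t| <= a / 4 * wt t &
      a `^ (- (b / a)) / 2 <= v (1 + t) * t `^ (b / a)].
Proof.
pose m := a `^ (- (b / a)) / 2.
have p0 : 0 < a `^ (- (b / a)) by exact: powR_gt0.
have m0 : 0 < m by rewrite /m; lra.
have [M [_ hM]] : \forall t \near +oo,
    m <= v (1 + t) * t `^ (b / a) /\ `|v' (1 + t) / v (1 + t)| <= a / 4.
  near=> t; split.
  - by near: t; apply: (cvgr_ge _ weight_cvg); rewrite /m; lra.
  - near: t; apply: (cvgr_norm_le _ weight_ratio_cvg0); rewrite normr0.
    by rewrite divr_gt0.
exists (Num.max M 0 + 1); first by rewrite ler_wpDl // le_max lexx orbT.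
move=> t Mt; have t1 : 1 <= t.
  by apply: le_trans Mt; rewrite ler_wpDl // le_max lexx orbT.
have [|h1 h2] := hM t.
  apply: lt_le_trans Mt; apply: le_lt_trans (_ : Num.max M 0 < _); last by lra.
  by rewrite le_max lexx.
have tp : 0 < t by lra.
have vp : 0 < v (1 + t).
  by rewrite -(pmulr_lgt0 _ (powR_gt0 (b / a) tp)); exact: lt_le_trans h1.
split => //.
- by rewrite mulr_gt0 // expR_gt0.
- rewrite /wt /wt_int normrM (ger0_norm (expR_ge0 _)) mulrCA.
  apply: ler_wpM2l; first exact: expR_ge0.
  by move: h2; rewrite normrM normfV (gtr0_norm vp) ler_pdivrMr.
Unshelve. all: by end_near. Qed.

End weights.

Section path.
Context {R : realType}.
Notation mu := (@lebesgue_measure R).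

(** Subtracting the noise leaves a differentiable process, so that along a path
    the equation is an ordinary differential system for [Y = X - sigma B] and
    the running integral [I]. *)
Lemma path_system (a b sigma : R) (X B : R -> R) :
  {within `[-1, +oo[, continuous X} ->
  (forall t, 0 <= t -> X t = X 0 + \int[mu]_(s in `[0, t])
       (a * X s + b / (1 + s) * \int[mu]_(u in `[-1, s]) X u)
     + sigma * (B t - B 0)) ->
  exists Y I : R -> R,
  [/\ forall t : R, 0 <= t -> is_derive t 1 Y (a * X t + b / (1 + t) * I t),
      forall t : R, 0 <= t -> is_derive t 1 I (X t),
      forall t, 0 <= t -> X t = Y t + sigma * B t &
      I 0 = \int[mu]_(u in `[-1, 0]) X u].
Proof.
move=> cX eX.
pose Xc t := X (Num.max t (-1)).
have cXc : continuous Xc by exact: within_cont_max.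
have XcE t : -1 <= t -> Xc t = X t by move=> t1; rewrite /Xc; congr X; exact/max_idPl.
pose I t := \int[mu]_(u in `[-1, t]) Xc u.
have IE t : I t = \int[mu]_(u in `[-1, t]) X u.
  apply: eq_Rintegral => u; rewrite inE /= in_itv /= => /andP[u1 _].
  exact: XcE.
have dI (t : R) : 0 <= t -> is_derive t 1 I (X t).
  move=> t0; have t1 : -1 < t by lra.
  by apply: is_drv_eq (primitive_drv cXc t1) _; rewrite XcE // ltW.
pose k t := a * X t + b / (1 + t) * I t.
have ck0 : {within `[0, +oo[, continuous k}.
  have cX0 : {within `[0, +oo[, continuous X}.
    by apply: within_cont_sub cX => t /=; rewrite !in_itv /= !andbT; lra.
  have cI0 : {within `[0, +oo[, continuous I}.
    by apply: cont_itv0y => t /dI; exact: is_drv_cont.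
  have ca : {within `[0, +oo[, continuous (fun _ : R => a)}.
    by apply: cont_itv0y => t _; exact: (is_drv_cont (is_drvC a t)).
  have cb : {within `[0, +oo[, continuous (fun t : R => b / (1 + t))}.
    apply: cont_itv0y => t t0.
    have tn : 1 + t != 0 by rewrite gt_eqF //; lra.
    exact: (is_drv_cont (is_drvZ b (is_drvV tn (is_drvD (is_drvC 1 t) (is_drv_id t))))).
  have h1 := within_contM ca cX0; have h2 := within_contM cb cI0.
  by move=> t; apply: cvgD; [exact: h1|exact: h2].
pose kc t := k (Num.max t 0).
have ckc : continuous kc by exact: within_cont_max.
have kcE t : 0 <= t -> kc t = k t by move=> t0; rewrite /kc; congr k; exact/max_idPl.
pose Y t := (X 0 - sigma * B 0 - \int[mu]_(s in `[-1, 0]) kc s)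
  + \int[mu]_(s in `[-1, t]) kc s.
exists Y, I; split; [|exact: dI| |exact: IE].
- move=> t t0; have t1 : -1 < t by lra.
  apply: is_drv_eq (is_drvD (is_drvC _ t) (primitive_drv ckc t1)) _.
  by rewrite add0r kcE.
- move=> t t0; rewrite eX // /Y.
  have -> : \int[mu]_(s in `[0, t])
       (a * X s + b / (1 + s) * \int[mu]_(u in `[-1, s]) X u) =
      \int[mu]_(s in `[0, t]) kc s.
    apply: eq_Rintegral => s; rewrite inE /= in_itv /= => /andP[s0 _].
    by rewrite kcE // /k IE.
  by rewrite (primitiveB (x := -1) ckc _ t0); [ring|lra].
Qed.

End path.

Section path_limit.
Context {R : realType}.
Notation mu := (@lebesgue_measure R).
Context (a b sigma : R) (v v' : R -> R) (a0 : 0 < a) (s0 : 0 < sigma).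
Context (dv : forall t : R, 0 < t ->
  is_derive t 1 v (v' t) /\ is_derive t 1 v' (a * v' t + b / t * v t)).
Context (lv : t `^ (b / a) * v t @[t --> +oo] --> a `^ (- (b / a))).
Context (lv' : t `^ (b / a) * v' t @[t --> +oo] --> (0 : R)).

Local Notation f := (wt a v).
Local Notation g := (wt_int a v').
Local Notation f' := (wt' a v v').

(** The Wiener integral of the weight, by parts, along one path [B]. *)
Definition wiener_path (B : R -> R) : R :=
  - (f 0 * B 0) - \int[mu]_(s in `[0, +oo[) (f' s * B s).

(** The rate [a / 4] is half the decay rate of the bounds on the weights, so
    products of [B] with the weights still decay. *)
Definition exp_growth (H : R) (B : R -> R) : Prop :=
  {within `[0, +oo[, continuous B} /\
  forall t, 0 <= t -> `|B t| <= H * expR (a / 4 * t).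

Lemma exp_growth_ge0 H B : exp_growth H B -> 0 <= H.
Proof.
case=> _ /(_ 0 (lexx _)); rewrite mulr0 expR0 mulr1; exact: le_trans.
Qed.

Let a4 : 0 < a / 4. Proof. by rewrite divr_gt0. Qed.

Lemma wt'B_cont H B : exp_growth H B ->
  {within `[0, +oo[, continuous (fun t => f' t * B t)}.
Proof.
case=> cB _; apply: within_contM => //; apply: cont_itv0y => t t0.
by apply: wt'_cont dv _ _; lra.
Qed.

Lemma wt'B_integrable H B : exp_growth H B ->
  mu.-integrable `[0, +oo[ (EFin \o (fun t => f' t * B t)).
Proof.
move=> gB; have [K K0 hK] := wt_bound a0 dv lv lv'.
have mf : measurable_fun (`[0, +oo[ : set R) (fun t => f' t * B t).
  exact: (within_measurable (wt'B_cont gB)).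
apply: (@exp_le_integrable R _ (K * H) _ a4 mf) => t t0.
have [_ h1] := hK t t0; have [_ /(_ t t0) h2] := gB.
rewrite normrM; apply: le_trans (ler_pM _ _ h1 h2) _ => //.
rewrite mulrACA -expRD; apply: ler_wpM2l.
  by rewrite mulr_ge0 // (exp_growth_ge0 gB).
by rewrite ler_expR; lra.
Qed.

(** The weights solve the adjoint system [f' = g - a f],
    [g' = b / (1 + t) f], hence the drift of [f X - g I] cancels and only the
    noise, integrated by parts, is left. *)
Lemma path_martingale (H : R) (X B : R -> R) : exp_growth H B ->
  {within `[-1, +oo[, continuous X} ->
  (forall t, 0 <= t -> X t = X 0 + \int[mu]_(s in `[0, t])
       (a * X s + b / (1 + s) * \int[mu]_(u in `[-1, s]) X u)
     + sigma * (B t - B 0)) ->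
  exists Y I : R -> R,
  [/\ forall t : R, 0 <= t -> is_derive t 1 Y (a * X t + b / (1 + t) * I t),
      forall t : R, 0 <= t -> is_derive t 1 I (X t),
      forall t, 0 <= t -> X t = Y t + sigma * B t,
      I 0 = \int[mu]_(u in `[-1, 0]) X u &
      forall t, 0 <= t -> f t * X t - g t * I t =
        f 0 * X 0 - g 0 * I 0
        + sigma * (f t * B t - f 0 * B 0 - \int[mu]_(s in `[0, t]) (f' s * B s))].
Proof.
move=> gB cX eX; have [Y [I [dY dI XE I0]]] := path_system cX eX.
exists Y, I; split => //.
have ck := within_cont_max (wt'B_cont gB).
set k := (fun t => _) in ck.
have kE t : 0 <= t -> k t = f' t * B t by move=> t0; rewrite /k max_l.
pose D t := \int[mu]_(s in `[-1, t]) k s.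
pose N t := f t * Y t - g t * I t + sigma * D t.
have dN (t : R) : 0 <= t -> is_derive t 1 N 0.
  move=> t0; have t1 : -1 < t by lra.
  have dD := primitive_drv ck t1.
  have df := wt_drv dv t1; have dg := wt_int_drv dv t1.
  have d1 := is_drvB (is_drvM df (dY t t0)) (is_drvM dg (dI t t0)).
  apply: is_drv_eq (is_drvD d1 (is_drvZ sigma dD)) _.
  by rewrite kE // /wt' XE //; ring.
move=> t t0; have := drv0_cst_le dN t0 (lexx 0).
have -> : \int[mu]_(s in `[0, t]) (f' s * B s) = D t - D 0.
  rewrite /D -(primitiveB (x := -1) ck _ t0); last by lra.
  by apply: eq_Rintegral => s; rewrite inE /= in_itv /= => /andP[s00 _]; rewrite kE.
by rewrite /N !XE //; lra.
Qed.

End path_limit.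

Section path_asymptotics.
Context {R : realType}.
Notation mu := (@lebesgue_measure R).
Context (a b sigma : R) (v v' : R -> R) (a0 : 0 < a) (s0 : 0 < sigma).
Context (dv : forall t : R, 0 < t ->
  is_derive t 1 v (v' t) /\ is_derive t 1 v' (a * v' t + b / t * v t)).
Context (lv : t `^ (b / a) * v t @[t --> +oo] --> a `^ (- (b / a))).
Context (lv' : t `^ (b / a) * v' t @[t --> +oo] --> (0 : R)).

Local Notation f := (wt a v).
Local Notation g := (wt_int a v').
Local Notation f' := (wt' a v v').

Let a4 : 0 < a / 4. Proof. by rewrite divr_gt0. Qed.

(** Gronwall's lemma for [Y ^ 2 + I ^ 2], up to a fixed time. *)
Lemma system_bound (T x0 i0 : R) : 0 <= T -> exists2 K, 0 <= K &
  forall (H : R) (X B Y I : R -> R), exp_growth a H B ->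
    (forall t : R, 0 <= t -> is_derive t 1 Y (a * X t + b / (1 + t) * I t)) ->
    (forall t : R, 0 <= t -> is_derive t 1 I (X t)) ->
    (forall t, 0 <= t -> X t = Y t + sigma * B t) ->
    X 0 = x0 -> I 0 = i0 -> I T ^+ 2 <= K * (1 + H ^+ 2).
Proof.
move=> T0; pose e := expR (a / 4 * T); pose k := 3 * a + `|b| + 2.
pose K := expR (k * (T - 0)) *
  (2 * x0 ^+ 2 + i0 ^+ 2 + 2 * sigma ^+ 2 + sigma ^+ 2 * e ^+ 2).
have p1 := sqr_ge0 x0; have p2 := sqr_ge0 i0; have p3 := sqr_ge0 sigma.
have p4 : 0 <= sigma ^+ 2 * e ^+ 2 by rewrite mulr_ge0 ?sqr_ge0.
exists K => [|H X B Y I gB dY dI XE X0 I0].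
  by rewrite mulr_ge0 ?expR_ge0 //; lra.
have H0 := exp_growth_ge0 gB; have [_ hB] := gB.
pose h := sigma * (H * e).
pose E t := Y t ^+ 2 + I t ^+ 2 + h ^+ 2.
pose E' t := 2 * Y t * (a * X t + b / (1 + t) * I t) + 2 * I t * X t.
have dE (t : R) : 0 <= t -> is_derive t 1 E (E' t).
  move=> t0; have d1 := is_drvD (is_drv_sqr (dY t t0)) (is_drv_sqr (dI t t0)).
  by apply: is_drv_eq (is_drvD d1 (is_drvC (h ^+ 2) t)) _; rewrite /E'; ring.
have le : E T <= E 0 * expR (k * (T - 0)).
  apply: (@gronwall R E E' k 0 T T0).
  - by move=> t /andP[/ltW t0 _]; exact: dE.
  - apply: derivable_within_continuous => t; rewrite in_itv /= => /andP[t0 _].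
    by have [] := dE t t0.
  move=> t /andP[/ltW t0 /ltW tT]; rewrite /E' /E XE //.
  have sB : (sigma * B t) ^+ 2 <= h ^+ 2.
    rewrite -[leLHS]real_normK ?num_real // ler_sqr ?nnegrE //; last first.
      by rewrite /h !mulr_ge0 ?expR_ge0 // ltW.
    rewrite normrM (gtr0_norm s0) /h ler_pM2l //.
    apply: le_trans (hB t t0) _; apply: ler_wpM2l => //.
    by rewrite ler_expR ler_pM2l.
  set s := sigma * B t in sB *; set y := Y t; set i := I t.
  have hc : 2 * y * (b / (1 + t) * i) <= `|b| * (y ^+ 2 + i ^+ 2).
    have q1 : `|2 * (y * i)| <= y ^+ 2 + i ^+ 2.
      rewrite ler_norml; apply/andP; split.
        by have := sqr_ge0 (y + i); rewrite sqrrD; lra.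
      by have := sqr_ge0 (y - i); rewrite sqrrB; lra.
    have q2 : `|b / (1 + t)| <= `|b|.
      have t1 : 0 < 1 + t by lra.
      rewrite normrM normfV (gtr0_norm t1) ler_pdivrMr //.
      by rewrite ler_peMr //; lra.
    apply: le_trans (ler_pM _ _ q2 q1) => //.
    have -> : 2 * y * (b / (1 + t) * i) = b / (1 + t) * (2 * (y * i)) by ring.
    by rewrite -normrM ler_norm.
  have h1 : 2 * y * s <= y ^+ 2 + s ^+ 2.
    by have := sqr_ge0 (y - s); rewrite sqrrB; lra.
  have h2 : 2 * i * s <= i ^+ 2 + s ^+ 2.
    by have := sqr_ge0 (i - s); rewrite sqrrB; lra.
  have h3 : 2 * y * i <= y ^+ 2 + i ^+ 2.
    by have := sqr_ge0 (y - i); rewrite sqrrB; lra.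
  have h1a := ler_wpM2l (ltW a0) h1.
  have h4 : a * s ^+ 2 <= a * h ^+ 2 by rewrite ler_pM2l.
  have n1 : 0 <= `|b| * h ^+ 2 by rewrite mulr_ge0 ?sqr_ge0.
  have n2 : 0 <= a * i ^+ 2 by rewrite mulr_ge0 ?sqr_ge0 // ltW.
  have n3 : 0 <= a * h ^+ 2 by rewrite mulr_ge0 ?sqr_ge0 // ltW.
  have n4 := sqr_ge0 h; have n5 := sqr_ge0 y; have n6 := sqr_ge0 i.
  by rewrite /k; lra.
have B0 : `|B 0| <= H by have := hB 0 (lexx _); rewrite mulr0 expR0 mulr1.
have Y0 : Y 0 = x0 - sigma * B 0 by rewrite -X0 (XE 0) //; ring.
have B02 : (sigma * B 0) ^+ 2 <= sigma ^+ 2 * H ^+ 2.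
  rewrite exprMn ler_wpM2l //.
  by rewrite -[leLHS]real_normK ?num_real // ler_sqr ?nnegrE.
have E0 : E 0 <= (2 * x0 ^+ 2 + i0 ^+ 2 + 2 * sigma ^+ 2 + sigma ^+ 2 * e ^+ 2)
    * (1 + H ^+ 2).
  rewrite /E Y0 I0 /h !exprMn.
  have q1 := sqr_ge0 (x0 + sigma * B 0).
  have q2 := mulr_ge0 p1 (sqr_ge0 H); have q3 := mulr_ge0 p2 (sqr_ge0 H).
  have q4 := mulr_ge0 p3 (sqr_ge0 H).
  rewrite exprMn in B02.
  lra.
apply: (@le_trans _ _ (E T)).
  by rewrite /E; have := sqr_ge0 (Y T); have := sqr_ge0 h; lra.
by apply: le_trans le _; rewrite /K mulrC -mulrA; apply: ler_wpM2l.
Qed.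

Let bd_exp_itv (K t : R) : 0 <= K -> 0 <= t ->
  \int[mu]_(s in `[0, t]) (K * expR (- (a / 4 * s))) <= K * (a / 4)^-1.
Proof.
move=> K0 t0; have an : a / 4 != 0 by rewrite gt_eqF.
have dE (s : R) : is_derive s 1 (fun s => expR (- (a / 4 * s)))
    (- (a / 4) * expR (- (a / 4 * s))).
  by apply: is_drv_eq (is_drv_exp (is_drvN (is_drvZ (a / 4) (is_drv_id s)))) _; ring.
have dF (s : R) : is_derive s 1 (fun s => - (K * (a / 4)^-1) * expR (- (a / 4 * s)))
    (K * expR (- (a / 4 * s))).
  by apply: is_drv_eq (is_drvZ _ (dE s)) _; move: an; set q := a / 4 => an; field.
rewrite (FTC2_itv t0 (F := fun s => - (K * (a / 4)^-1) * expR (- (a / 4 * s)))).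
- rewrite mulr0 oppr0 expR0 mulr1 opprK mulNr gerDr oppr_le0.
  by rewrite !mulr_ge0 ?expR_ge0 // invr_ge0 ltW.
- by apply: cont_within => s _; exact: is_drv_cont (is_drvZ K (dE s)).
- by apply: cont_within => s _; exact: is_drv_cont (dF s).
Qed.

Lemma martingale_bound (c0 : R) : exists2 K, 0 <= K & forall H B, exp_growth a H B ->
  forall t, 0 <= t -> (c0 + sigma * (f t * B t - f 0 * B 0
     - \int[mu]_(s in `[0, t]) (f' s * B s))) ^+ 2 <= K * (1 + H ^+ 2).
Proof.
have [Kf Kf0 hK] := wt_bound a0 dv lv lv'.
pose L := sigma * (2 * Kf + Kf * (a / 4)^-1).
have ai : 0 <= (a / 4)^-1 by rewrite invr_ge0 ltW.
have L0 : 0 <= L by rewrite mulr_ge0 ?addr_ge0 ?mulr_ge0 // ltW.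
exists (2 * (c0 ^+ 2 + L ^+ 2)) => [|H B gB t t0].
  by rewrite mulr_ge0 // addr_ge0 ?sqr_ge0.
have H0 := exp_growth_ge0 gB; have [_ hB] := gB.
have KH : 0 <= Kf * H by rewrite mulr_ge0.
have prod h s : 0 <= s -> `|h| <= Kf * expR (- (a / 2 * s)) ->
    `|h * B s| <= Kf * H * expR (- (a / 4 * s)).
  move=> sp hh; rewrite normrM; apply: le_trans (ler_pM _ _ hh (hB s sp)) _ => //.
  rewrite mulrACA -expRD; apply: ler_wpM2l => //.
  by rewrite ler_expR; lra.
have e1 s : 0 <= s -> Kf * H * expR (- (a / 4 * s)) <= Kf * H.
  by move=> sp; rewrite ler_piMr // -[leRHS]expR0 ler_expR oppr_le0 mulr_ge0 // (ltW a4).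
have h1 : `|f t * B t| <= Kf * H.
  by apply: le_trans (e1 t t0); apply: prod => //; have [] := hK t t0.
have h2 : `|f 0 * B 0| <= Kf * H.
  by apply: le_trans (e1 0 _) => //; apply: prod => //; have [] := hK 0 (lexx _).
have h3 : `|\int[mu]_(s in `[0, t]) (f' s * B s)| <= Kf * H * (a / 4)^-1.
  have sub : `[0, t] `<=` (`[0, +oo[ : set R).
    by move=> s /=; rewrite !in_itv /= => /andP[->].
  have fi : mu.-integrable `[0, t] (EFin \o (fun s => f' s * B s)).
    exact: cont_itv_integrable (within_cont_sub sub (wt'B_cont dv gB)).
  apply: le_trans (le_normr_Rintegral _ fi) _ => //.
  apply: le_trans (bd_exp_itv KH t0); apply: le_Rintegral => //.
  - exact: (integrable_norm fi).
  - apply: cont_itv_integrable; apply: cont_within => s _.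
    exact: is_drv_cont (is_drvZ (Kf * H) (is_drv_exp (is_drvN (is_drvZ (a / 4) (is_drv_id s))))).
  move=> s /=; rewrite in_itv /= => /andP[sp _].
  by apply: prod => //; have [] := hK s sp.
set x := _ - _ - _.
have hx : `|sigma * x| <= L * H.
  rewrite normrM (gtr0_norm s0) /L -mulrA ler_pM2l // /x.
  move: h1 h2 h3; move: (f t * B t) (f 0 * B 0) (Rintegral _ _ _) => y1 y2 y3.
  rewrite !ler_norml => /andP[? ?] /andP[? ?] /andP[? ?].
  by clear x; apply/andP; split; lra.
move: x hx => x hx.
have hx2 : (sigma * x) ^+ 2 <= L ^+ 2 * H ^+ 2.
  by rewrite -exprMn -[leLHS]real_normK ?num_real // ler_sqr ?nnegrE // mulr_ge0.
have q1 := sqr_ge0 (c0 - sigma * x).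
have q2 := mulr_ge0 (sqr_ge0 c0) (sqr_ge0 H); have q3 := sqr_ge0 L.
lra.
Qed.

Lemma wiener_path_cvg H B : exp_growth a H B ->
  f t * B t - f 0 * B 0 - \int[mu]_(s in `[0, t]) (f' s * B s) @[t --> +oo]
    --> wiener_path a v v' B.
Proof.
move=> gB; have [Kf Kf0 hK] := wt_bound a0 dv lv lv'.
have H0 := exp_growth_ge0 gB; have [_ hB] := gB.
have KH : 0 <= Kf * H by rewrite mulr_ge0.
have l0 : f t * B t @[t --> +oo] --> (0 : R).
  apply: norm_cvg0.
  have lb : Kf * H * expR (- (a / 4 * t)) @[t --> +oo] --> (0 : R).
    rewrite -[X in _ --> X](mulr0 (Kf * H)).
    by apply: cvgM; [exact: cvg_cst|exact: exp_cvg0].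
  apply: (squeeze_cvgr _ (cvg_cst 0) lb); near=> t.
  have t0 : 0 <= t by near: t; apply: nbhs_pinfty_ge; exact: num_real.
  rewrite normr_ge0 /= normrM; have [hh _] := hK t t0.
  apply: le_trans (ler_pM _ _ hh (hB t t0)) _ => //.
  rewrite mulrACA -expRD; apply: ler_wpM2l => //.
  by rewrite ler_expR; lra.
have l1 := integral_tail (wt'B_integrable a0 dv lv lv' gB).
rewrite /wiener_path -[X in X - _]sub0r.
by apply: cvgB l1; apply: cvgB l0 _; exact: cvg_cst.
Unshelve. all: by end_near. Qed.

End path_asymptotics.

Section path_conclusion.
Context {R : realType}.
Notation mu := (@lebesgue_measure R).
Context (a b sigma : R) (v v' : R -> R) (a0 : 0 < a) (s0 : 0 < sigma).
Context (dv : forall t : R, 0 < t ->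
  is_derive t 1 v (v' t) /\ is_derive t 1 v' (a * v' t + b / t * v t)).
Context (lv : t `^ (b / a) * v t @[t --> +oo] --> a `^ (- (b / a))).
Context (lv' : t `^ (b / a) * v' t @[t --> +oo] --> (0 : R)).

Local Notation f := (wt a v).
Local Notation g := (wt_int a v').
Local Notation f' := (wt' a v v').

(** Along a path, [theta = f I] satisfies
    [theta' = - (a - 2 v' / v) theta + M] with [M] the martingale, so it stays
    bounded; hence [f X = M + (v' / v) theta] has the limit of [M]. *)
Lemma path_limit (x0 i0 : R) : exists t1 K : R, [/\ 1 <= t1, 0 <= K &
  forall (H : R) (X B : R -> R), exp_growth a H B ->
  {within `[-1, +oo[, continuous X} ->
  (forall t, 0 <= t -> X t = X 0 + \int[mu]_(s in `[0, t])
       (a * X s + b / (1 + s) * \int[mu]_(u in `[-1, s]) X u)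
     + sigma * (B t - B 0)) ->
  X 0 = x0 -> \int[mu]_(u in `[-1, 0]) X u = i0 ->
  X t / (expR (a * t) * t `^ (b / a)) @[t --> +oo] -->
    a `^ (b / a) * (v 1 * x0 - v' 1 * i0 + sigma * wiener_path a v v' B) /\
  forall t, t1 <= t ->
    (X t / (expR (a * t) * t `^ (b / a))) ^+ 2 <= K * (1 + H ^+ 2)].
Proof.
have [t0 t01 hw] := weights_asymp a0 lv lv'.
have t00 : 0 <= t0 by exact: le_trans t01.
have [Ks Ks0 hKs] := system_bound b a0 s0 x0 i0 t00.
pose c0 := f 0 * x0 - g 0 * i0.
have [Km Km0 hKm] := martingale_bound a0 s0 dv lv lv' c0.
pose m0 := a `^ (- (b / a)) / 2.
have m00 : 0 < m0 by rewrite divr_gt0 // powR_gt0.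
pose Kt := 4 * Km / a ^+ 2 + f t0 ^+ 2 * Ks.
have Kt0 : 0 <= Kt.
  rewrite addr_ge0 //; last by rewrite mulr_ge0 ?sqr_ge0.
  by rewrite divr_ge0 ?sqr_ge0 // mulr_ge0.
pose K2 := 2 * Km + 2 * ((a / 4) ^+ 2 * Kt).
have K20 : 0 <= K2.
  apply: addr_ge0; first exact: mulr_ge0.
  by apply: mulr_ge0 => //; apply: mulr_ge0 => //; exact: sqr_ge0.
exists t0, (K2 / m0 ^+ 2); split => //; first by rewrite divr_ge0 ?sqr_ge0.
move=> H X B gB cX eX X0 i0E.
have [Y [I [dY dI XE I0 hM]]] := path_martingale dv gB cX eX.
pose M t := c0 + sigma * (f t * B t - f 0 * B 0
                          - \int[mu]_(s in `[0, t]) (f' s * B s)).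
have fX t : 0 <= t -> f t * X t = M t + g t * I t.
  by move=> /hM; rewrite X0 I0 i0E -/c0 -/(M t) => <-; ring.
pose S := 1 + H ^+ 2.
have S0 : 0 <= S by rewrite addr_ge0 ?sqr_ge0.
have M2 t : 0 <= t -> M t ^+ 2 <= Km * S by exact: hKm.
have It0 : I t0 ^+ 2 <= Ks * S by apply: hKs XE X0 _ => //; rewrite I0 i0E.
pose th t := f t * I t.
have an : a != 0 by rewrite gt_eqF.
have th2 t : t0 <= t -> th t ^+ 2 <= Kt * S.
  move=> tt; pose m := 4 * (Km * S) / a ^+ 2.
  have m_ge0 : 0 <= m by rewrite divr_ge0 ?sqr_ge0 // !mulr_ge0.
  (* Above the level [m] for [th ^ 2] the damping beats the forcing [M]. *)
  pose E u := th u ^+ 2 - m.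
  pose E' u := 2 * th u * (f' u * I u + f u * X u) - 0.
  have dE (u : R) : t0 <= u -> is_derive u 1 E (E' u).
    move=> tu; have u0 : 0 <= u by exact: le_trans tu.
    have u1 : -1 < u by lra.
    exact: is_drvB (is_drv_sqr (is_drvM (wt_drv dv u1) (dI u u0))) (is_drvC m u).
  have le : E t <= E t0 * expR (- (a / 2) * (t - t0)).
    apply: (@gronwall R E E' _ t0 t tt).
    - by move=> u /andP[/ltW ? _]; exact: dE.
    - apply: derivable_within_continuous => u; rewrite in_itv /= => /andP[? _].
      by have [] := dE u _.
    move=> u /andP[/ltW tu _]; have u0 : 0 <= u by exact: le_trans tu.
    rewrite /E' fX // subr0 /E /wt'.
    have [fp hg _] := hw u tu.
    have hM2 := M2 u u0.
    have h1 : 4 * (th u * (g u * I u)) <= a * th u ^+ 2.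
      have : g u <= a / 4 * f u by exact: le_trans (ler_norm _) hg.
      move=> h; have := ler_wpM2l (mulr_ge0 (ltW fp) (sqr_ge0 (I u))) h.
      by rewrite /th; lra.
    have h2 : 2 * th u * M u <= a / 2 * th u ^+ 2 + 2 / a * M u ^+ 2.
      have := sqr_ge0 (a * th u - 2 * M u) => q.
      have ai : 0 <= (2 * a)^-1 by rewrite invr_ge0 mulr_ge0 // ltW.
      have := mulr_ge0 ai q.
      have -> : (2 * a)^-1 * (a * th u - 2 * M u) ^+ 2 =
        a / 2 * th u ^+ 2 + 2 / a * M u ^+ 2 - 2 * th u * M u by field.
      lra.
    have h3 : 2 / a * M u ^+ 2 <= a / 2 * m.
      have -> : a / 2 * m = 2 / a * (Km * S) by rewrite /m; field.
      by apply: ler_wpM2l => //; rewrite divr_ge0 // ltW.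
    have -> : 2 * th u * ((g u - a * f u) * I u + (M u + g u * I u)) =
      2 * th u * M u + 4 * (th u * (g u * I u)) - 2 * a * th u ^+ 2.
      by rewrite /th; ring.
    lra.
  have th0 : th t0 ^+ 2 <= f t0 ^+ 2 * Ks * S.
    by rewrite /th exprMn -mulrA ler_wpM2l ?sqr_ge0.
  have ex1 : expR (- (a / 2) * (t - t0)) <= 1.
    rewrite -[leRHS]expR0 ler_expR mulNr oppr_le0 mulr_ge0 ?subr_ge0 //.
    by rewrite divr_ge0 // ltW.
  have Et : E t <= th t0 ^+ 2.
    apply: le_trans le _; apply: (@le_trans _ _ (th t0 ^+ 2 * expR (- (a / 2) * (t - t0)))).
      by apply: ler_wpM2r; [exact: expR_ge0|rewrite /E; lra].
    by rewrite ler_piMr // sqr_ge0.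
  have -> : Kt * S = m + f t0 ^+ 2 * Ks * S by rewrite /Kt /m; field.
  by move: Et; rewrite /E; lra.
have gI t : t0 <= t -> (g t * I t) ^+ 2 <= (a / 4) ^+ 2 * (Kt * S).
  move=> tt; have [fp hg _] := hw t tt.
  have h : f t ^+ 2 * I t ^+ 2 <= Kt * S by rewrite -exprMn; exact: th2.
  rewrite exprMn.
  have q : g t ^+ 2 <= (a / 4) ^+ 2 * f t ^+ 2.
    rewrite -exprMn -[leLHS]real_normK ?num_real // ler_sqr ?nnegrE //.
    by rewrite mulr_ge0 ?divr_ge0 // ltW.
  apply: le_trans (ler_wpM2r (sqr_ge0 (I t)) q) _.
  by rewrite -mulrA ler_wpM2l ?sqr_ge0.
have rE t : t0 <= t ->
    X t / (expR (a * t) * t `^ (b / a)) = (f t * X t) / (v (1 + t) * t `^ (b / a)).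
  move=> tt; have [_ _ h] := hw t tt.
  have tp : 0 < t by apply: lt_le_trans tt; exact: lt_le_trans t01.
  have p0 : t `^ (b / a) != 0 by rewrite gt_eqF // powR_gt0.
  have vn : v (1 + t) != 0.
    by apply: contraTneq h => ->; rewrite mul0r -ltNge.
  have en : expR (a * t) != 0 by rewrite gt_eqF // expR_gt0.
  by rewrite /wt expRN; field; rewrite en vn p0.
split; last first.
  move=> t tt; have [_ _ h] := hw t tt; have tp : 0 <= t by exact: le_trans tt.
  rewrite rE // expr_div_n.
  have d2 : m0 ^+ 2 <= (v (1 + t) * t `^ (b / a)) ^+ 2.
    by rewrite ler_sqr ?nnegrE // ?(ltW m00) //; apply: le_trans h; exact: ltW.
  have n2 : (f t * X t) ^+ 2 <= K2 * S.
    have h1 := M2 t tp; have h2 := gI t tt.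
    have := sqr_ge0 (M t - g t * I t); rewrite fX // /K2 => h3.
    have -> : (M t + g t * I t) ^+ 2 =
      2 * M t ^+ 2 + 2 * (g t * I t) ^+ 2 - (M t - g t * I t) ^+ 2 by ring.
    lra.
  have m2 : 0 < m0 ^+ 2 by rewrite exprn_gt0.
  rewrite [leRHS]mulrAC; apply: ler_pM => //; first exact: sqr_ge0.
    by rewrite invr_ge0 sqr_ge0.
  by rewrite lef_pV2 // posrE (lt_le_trans m2).
have lM : M t @[t --> +oo] --> c0 + sigma * wiener_path a v v' B.
  have lw := wiener_path_cvg a0 dv lv lv' gB.
  exact: (cvgD (cvg_cst c0) (cvgM (cvg_cst sigma) lw)).
have lgI : g t * I t @[t --> +oo] --> (0 : R).
  apply: norm_cvg0.
  have lb : `|v' (1 + t) / v (1 + t)| * Num.sqrt (Kt * S) @[t --> +oo] --> (0 : R).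
    rewrite -[X in _ --> X](mul0r (Num.sqrt (Kt * S))).
    apply: cvgM; last exact: cvg_cst.
    by rewrite -(normr0 R); apply: cvg_norm; exact: weight_ratio_cvg0 lv lv'.
  apply: (squeeze_cvgr _ (cvg_cst 0) lb); near=> t.
  have tt : t0 <= t by near: t; apply: nbhs_pinfty_ge; exact: num_real.
  have [fp _ _] := hw t tt.
  have vp : 0 < v (1 + t) by rewrite -(pmulr_rgt0 _ (expR_gt0 (- (a * t)))).
  have -> : g t * I t = v' (1 + t) / v (1 + t) * th t.
    by rewrite /th /wt /wt_int; field; rewrite gt_eqF.
  rewrite normr_ge0 /= normrM; apply: ler_wpM2l => //.
  by rewrite -sqrtr_sqr; apply: ler_wsqrtr; exact: th2.
have p0 : a `^ (- (b / a)) != 0 by rewrite gt_eqF // powR_gt0.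
have lim : (M t + g t * I t) / (v (1 + t) * t `^ (b / a)) @[t --> +oo] -->
    (c0 + sigma * wiener_path a v v' B + 0) / a `^ (- (b / a)).
  apply: cvgM; first exact: cvgD lM lgI.
  by apply: cvgV => //; exact: weight_cvg.
have -> : a `^ (b / a) * (v 1 * x0 - v' 1 * i0 + sigma * wiener_path a v v' B) =
    (c0 + sigma * wiener_path a v v' B + 0) / a `^ (- (b / a)).
  by rewrite powRN invrK /c0 /wt /wt_int mulr0 oppr0 expR0 !addr0; ring.
apply: cvg_trans lim; apply: near_eq_cvg; near=> t.
have tt : t0 <= t by near: t; apply: nbhs_pinfty_ge; exact: num_real.
by rewrite rE // fX //; exact: le_trans tt.
Unshelve. all: by end_near. Qed.

End path_conclusion.

(** * Centred Gaussian laws *)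

Section ramps.
Context {R : realType}.

(** Continuous approximations from below of the indicator of [`]x, +oo[]. *)
Definition ramp (x : R) (k : nat) (y : R) : R :=
  1 - expR (- (k%:R * (Num.max y x - x))).

Lemma ramp_ge0 x k y : 0 <= ramp x k y.
Proof.
rewrite subr_ge0 -[leRHS]expR0 ler_expR oppr_le0 mulr_ge0 // subr_ge0.
by rewrite le_max lexx orbT.
Qed.

Lemma ramp_le1 x k y : ramp x k y <= 1.
Proof. by rewrite gerBl expR_ge0. Qed.

Lemma ramp_cont x k : continuous (ramp x k).
Proof.
apply: (@within_cont_max _ (fun u => 1 - expR (- (k%:R * (u - x))))).
apply: cont_within => u _.
have d1 := is_drvZ k%:R (is_drvB (is_drv_id u) (is_drvC x u)).
exact: is_drv_cont (is_drvB (is_drvC 1 u) (is_drv_exp (is_drvN d1))).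
Qed.

Lemma measurable_ramp x k : measurable_fun setT (ramp x k).
Proof. by apply: continuous_measurable_fun; exact: ramp_cont. Qed.

Lemma ramp_cvg x y : ramp x k y @[k --> \oo] --> ((x < y)%R%:R : R).
Proof.
have [xy|yx] := ltP x y; last first.
  apply: cvg_near_cst; apply: nearW => k.
  by rewrite /ramp max_r // subrr mulr0 oppr0 expR0 subrr.
rewrite -[X in _ --> X](subr0 1); apply: cvgB; first exact: cvg_cst.
have yx0 : 0 < y - x by rewrite subr_gt0.
have lim := cvg_comp _ _ (@cvgr_idn R) (exp_cvg0 yx0).
apply: cvg_trans lim; apply: near_eq_cvg; apply: nearW => k /=.
by rewrite max_l 1?ltW // mulrC.
Qed.

(** Ramps increase to the indicators of half-lines, which generate. *)
Lemma prob_eq_ramp (p1 p2 : probability R R) :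
  (forall x k, (\int[p1]_y (ramp x k y)%:E = \int[p2]_y (ramp x k y)%:E)%E) ->
  forall A, measurable A -> p1 A = p2 A.
Proof.
move=> e.
have half (p : probability R R) x :
    (\int[p]_y (ramp x k y)%:E)%E @[k --> \oo] --> p `]x, +oo[%classic.
  have <- : (\int[p]_y ((x < y)%R%:R)%:E)%E = p `]x, +oo[%classic.
    rewrite -[X in _ = p X]setIT -integral_indic //.
    apply: eq_integral => y _; rewrite indicE; congr (_%:R%:E); congr nat_of_bool.
    by apply/idP/idP; rewrite inE /= in_itv /= andbT.
  apply: (@dominated_cvg _ _ _ p setT measurableT (fun k y => (ramp x k y)%:E)
    (fun y => ((x < y)%R%:R)%:E) (cst 1%E)) => //.
  - by move=> k; apply/measurable_EFinP; exact: measurable_ramp.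
  - by move=> y _; apply: cvg_EFin; [exact: nearW|exact: ramp_cvg].
  - exact: finite_measure_integrable_cst.
  - by move=> k y _; rewrite lee_fin ger0_norm ?ramp_le1 ?ramp_ge0.
have eq_half x : p1 `]x, +oo[%classic = p2 `]x, +oo[%classic.
  have h1 := half p1 x; have h2 := half p2 x.
  have e12 : (fun k => \int[p1]_y (ramp x k y)%:E)%E =
      (fun k => \int[p2]_y (ramp x k y)%:E)%E by apply/funext => k; exact: e.
  rewrite e12 in h1.
  exact: (cvg_unique (@ereal_hausdorff R) h1 h2).
refine (@measure_unique _ R R (@RGenOInfty.G R)
  (fun n => `](- n%:R), +oo[%classic) _ _ _ _ p1 p2 _ _) => //.
- exact: RGenOInfty.measurableE.
- move=> A1 A2 [x ->] [y ->]; exists (Num.max x y).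
  by apply/seteqP; split => z /=; rewrite !in_itv /= !andbT gt_max => /andP.
- by move=> n; exists (- n%:R).
- apply/seteqP; split => // y _.
  exists (Num.Def.archi_bound `|y|) => //=; rewrite in_itv /= andbT.
  have := archi_boundP (normr_ge0 y); have := ler_norm (- y); rewrite normrN; lra.
- by move=> A [x ->]; exact: eq_half.
- by move=> n; apply: le_lt_trans (probability_le1 _ _) _; rewrite // ltry.
Qed.

End ramps.

Section gauss.
Context {R : realType}.
Notation mu := (@lebesgue_measure R).

Definition affine (m c : R) (z : measurableTypeR R) : R := m + c * z.

Lemma measurable_affine m c : measurable_fun setT (affine m c).
Proof. by apply: measurable_funD => //; apply: measurable_funM. Qed.

HB.instance Definition _ m c :=
  isMeasurableFun.Build _ _ _ _ (affine m c) (measurable_affine m c).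

(** The law of [m + c Z] for a standard normal [Z]; unlike [normal_prob m c]
    it is the right law also for [c = 0]. *)
Definition gauss (m c : R) : probability R R :=
  distribution (normal_prob 0 1) (affine m c).

Lemma ge0_integral_normal (m s : R) (h : R -> R) : s != 0 ->
  measurable_fun setT h -> (forall x, 0 <= h x) ->
  (\int[normal_prob m s]_x (h x)%:E =
   \int[mu]_x (h x * normal_pdf m s x)%:E)%E.
Proof.
move=> s0 mh h0.
have dom := normal_prob_dominates m s.
have mhE : measurable_fun setT (fun x : measurableTypeR R => (h x)%:E).
  exact/measurable_EFinP.
rewrite -(Radon_Nikodym_SigmaFinite.change_of_variables dom) //.
have irn := Radon_Nikodym_SigmaFinite.f_integrable dom.
under [RHS]eq_integral do rewrite EFinM.
apply: ae_eq_integral => //.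
- by apply: emeasurable_funM => //; exact: measurable_int irn.
- by apply: emeasurable_funM => //; apply/measurable_EFinP; exact: measurable_normal_pdf.
apply: ae_eqe_mul2l; apply: integral_ae_eq => //.
- by apply/measurable_EFinP; exact: measurable_normal_pdf.
- by move=> E _ mE; rewrite -(Radon_Nikodym_SigmaFinite.f_integral dom).
Qed.

Lemma ge0_integral_affine (p : probability (measurableTypeR R) R) (m c : R)
    (h : R -> R) : measurable_fun setT h -> (forall x, 0 <= h x) ->
  (\int[distribution p (affine m c)]_y (h y)%:E = \int[p]_z (h (m + c * z))%:E)%E.
Proof.
move=> mh h0; apply: (@ge0_integral_distribution _ _ _ _ _ p (affine m c)
  (fun y => (h y)%:E)); first exact/measurable_EFinP.
by move=> y; rewrite lee_fin.
Qed.

Lemma normal_pdf_even (x : R) : normal_pdf 0 1 (- x) = normal_pdf 0 1 x.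
Proof. by rewrite !normal_pdfE ?oner_neq0 // /normal_fun !subr0 sqrrN. Qed.

Lemma integral_oppr (h : R -> \bar R) : measurable_fun setT h ->
  (forall x, (0 <= h x)%E) -> (\int[mu]_x h (- x)%R = \int[mu]_x h x)%E.
Proof.
move=> mh h0.
transitivity (\int[pushforward mu (-%R : _ -> measurableTypeR R)]_x h x)%E.
  by rewrite ge0_integral_pushforward.
by apply: eq_measure_integral => A mA _; exact: lebesgue_measureN.
Qed.

Lemma normal_pdf_scale (m c x : R) : 0 < c ->
  normal_pdf 0 1 ((x - m) / c) / c = normal_pdf m c x.
Proof.
move=> c0; have cn : c != 0 by rewrite gt_eqF.
rewrite !normal_pdfE ?oner_neq0 //.
rewrite /normal_peak /normal_fun subr0 !expr1n mul1r.
have -> : c ^+ 2 * pi *+ 2 = c ^+ 2 * (pi *+ 2) by rewrite -mulrnAr.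
rewrite sqrtrM ?sqr_ge0 // sqrtr_sqr (gtr0_norm c0) invfM mulrC mulrA.
congr (_ * expR _); rewrite expr_div_n -[c ^+ 2 *+ 2]mulr_natr.
by field.
Qed.

Lemma normal_gauss (m c : R) A : c != 0 -> measurable A ->
  normal_prob m `|c| A = gauss m c A.
Proof.
move=> cn mA.
have -> : normal_prob m `|c| A = distribution (normal_prob m `|c|) (affine 0 1) A.
  transitivity (normal_prob m `|c| (affine 0 1 @^-1` A)); last by [].
  suff -> : affine 0 1 = id by [].
  by apply/funext => x; rewrite /affine add0r mul1r.
apply: (@prob_eq_ramp R (distribution (normal_prob m `|c|) (affine 0 1)) (gauss m c)
  _ A mA) => x k.
 set h := ramp x k; have mh : measurable_fun setT h by exact: measurable_ramp.
have h0 y : 0 <= h y by exact: ramp_ge0.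
have ch : continuous h by exact: ramp_cont.
apply: (etrans (ge0_integral_affine _ _ _ mh h0)).
apply: (etrans _ (esym (ge0_integral_affine _ _ _ mh h0))).
have mha (u e : R) : measurable_fun setT (fun z : R => h (u + e * z)).
  by apply: measurableT_comp => //; exact: (measurable_affine u e).
have cn' : `|c| != 0 by rewrite normr_eq0.
apply: (etrans (ge0_integral_normal m cn' (mha 0 1) _)); first by move=> x0; exact: h0.
apply: (etrans _ (esym (ge0_integral_normal 0 (oner_neq0 R) (mha m c) _))); last first.
  by move=> x0; exact: h0.
pose G e (z : R) := h (m + e * z) * normal_pdf 0 1 z.
have G0 e z : 0 <= G e z by rewrite mulr_ge0 // normal_pdf_ge0.
have cp : continuous (normal_pdf (0 : R) 1).
  by apply: continuous_normal_pdf; exact: oner_neq0.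
have cG e : continuous (G e).
  move=> z; apply: cvgM; last exact: cp.
  have da := is_drvD (is_drvC m z) (is_drvZ e (is_drv_id z)).
  exact: (continuous_comp (is_drv_cont da) (ch _)).
have n0 : 0 < `|c| by rewrite normr_gt0.
have step : (\int[mu]_z (G `|c| z)%:E =
    \int[mu]_x (h (0 + 1 * x) * normal_pdf m `|c| x)%:E)%E.
  pose F z := (z - m) / `|c|.
  have dF (z : R) : is_derive z 1 F `|c|^-1.
    by apply: is_drv_eq (is_drvM (is_drvB (is_drv_id z) (is_drvC m z))
      (is_drvC `|c|^-1 z)) _; ring.
  have F'E : (F^`())%classic = cst `|c|^-1.
    by apply/funext => z; rewrite derive1E; have [_ ->] := dF z.
  rewrite (@increasing_ge0_integration_by_substitutionT R F (G `|c|)) ?F'E //.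
  - apply: eq_integral => z _; congr EFin.
    rewrite -[LHS]/(G `|c| (F z) * `|c|^-1) /G -mulrA /F normal_pdf_scale //.
    by rewrite mulrCA divff ?mulr1 ?gt_eqF // addrC subrK add0r mul1r.
  - by move=> u w uw; rewrite ltr_pM2r ?invr_gt0 // ltrD2r.
  - by move=> z; exact: cst_continuous.
  - exact: is_cvg_cst.
  - exact: is_cvg_cst.
  - by apply: gt0_cvgMlNy; [rewrite invr_gt0|exact: cvg_addrr_Ny].
  - by apply: gt0_cvgMly; [rewrite invr_gt0|exact: cvg_addrr].
have mG (e : R) : measurable_fun setT (fun z : R => (G e z)%:E).
  by apply/measurable_EFinP; exact: continuous_measurable_fun.
apply: (etrans (esym step)); have [c0|c0] := ltP 0 c; first by rewrite gtr0_norm.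
apply: (etrans _ (integral_oppr (mG c) _)); last by move=> z; rewrite lee_fin.
apply: eq_integral => z _; congr EFin.
by rewrite /G normal_pdf_even (ler0_norm c0) mulNr mulrN.
Qed.

Local Notation pdf := (normal_pdf (0 : R) 1).

Lemma std_pdfE (x : R) :
  pdf x = normal_peak (1 : R) * expR (- (2^-1 * x ^+ 2)).
Proof.
rewrite normal_pdfE ?oner_neq0 // /normal_fun subr0 expr1n.
by congr (_ * expR _); rewrite mulNr mulrC.
Qed.

Lemma std_pdf_drv (x : R) : is_derive x 1 pdf (- x * pdf x).
Proof.
have -> : pdf = (fun x => normal_peak (1 : R) * expR (- (2^-1 * x ^+ 2))).
  by apply/funext => y; exact: std_pdfE.
have d1 := is_drv_exp (is_drvN (is_drvZ 2^-1 (is_drv_sqr (is_drv_id x)))).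
apply: is_drv_eq (is_drvZ (normal_peak 1) d1) _.
by field.
Qed.

Lemma pow_pdf_integrable (j : nat) :
  mu.-integrable `[0, +oo[ (EFin \o (fun x => x ^+ j * pdf x)).
Proof.
have e2 : (0 : R) < 2^-1 by rewrite invr_gt0.
have [K K0 hK] := exprn_le_exp j e2.
have cf : {within `[0, +oo[, continuous (fun x : R => x ^+ j * pdf x)}.
  have c1 : {within `[0, +oo[, continuous (fun x : R => x ^+ j)}.
    by apply: cont_itv0y => t _; exact: exprn_cont.
  have c2 : {within `[0, +oo[, continuous pdf}.
    by apply: cont_itv0y => t _; exact: is_drv_cont (std_pdf_drv t).
  exact: (within_contM c1 c2).
have p0 : 0 <= normal_peak (1 : R) by exact: normal_peak_ge0.
apply: (@exp_le_integrable R _ (normal_peak 1 * K * expR 2^-1) _ e2 (within_measurable cf)).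
move=> t t0; rewrite ger0_norm; last by rewrite mulr_ge0 ?exprn_ge0 ?normal_pdf_ge0.
rewrite std_pdfE mulrCA -!mulrA; apply: ler_wpM2l => //.
apply: le_trans (ler_wpM2r (expR_ge0 _) (hK t t0)) _.
rewrite -mulrA; apply: ler_wpM2l; first exact: ltW.
rewrite -!expRD ler_expR.
by have := sqr_ge0 (t - 1); rewrite sqrrB; lra.
Qed.

Lemma even_moment (j : nat) : ~~ odd j ->
  (\int[normal_prob 0 1]_x (x ^+ j)%:E =
   2 * \int[mu]_(x in `[0%R, +oo[) (x ^+ j * pdf x)%:E)%E.
Proof.
move=> ej; have h0 (x : R) : 0 <= x ^+ j by exact: exprn_even_ge0.
have mh : measurable_fun setT (fun x : R => x ^+ j).
  by apply: continuous_measurable_fun => t; exact: exprn_cont.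
apply: (etrans (ge0_integral_normal 0 (oner_neq0 R) mh h0)).
have -> : `[(0 : R), +oo[%classic = [set x | 0 <= x].
  by apply/seteqP; split => x /=; rewrite in_itv /= andbT.
apply: (@ge0_symfun_integralT R (fun x => x ^+ j * pdf x)).
- by move=> x; rewrite mulr_ge0 // normal_pdf_ge0.
- move=> x; apply: cvgM; first exact: exprn_cont.
  exact: is_drv_cont (std_pdf_drv x).
- by move=> x /=; rewrite normal_pdf_even exprNn -signr_odd (negbTE ej) expr0 mul1r.
Qed.

Lemma std_moment2 : (\int[normal_prob 0 1]_x ((x : R) ^+ 2)%:E = 1)%E.
Proof.
have m0 := even_moment (j := 0) isT; have m2 := even_moment (j := 2) isT.
have i0 := pow_pdf_integrable 0; have i2 := pow_pdf_integrable 2.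
rewrite m2; rewrite /= in m0.
have one : (\int[normal_prob (0 : R) 1]_x ((x : R) ^+ 0)%:E = 1)%E.
  under eq_integral do rewrite expr0.
  by rewrite integral_cst // mul1e; exact: probability_setT.
rewrite -one m0; congr (2 * _)%E.
pose F x : R := - x * pdf x.
have dF (x : R) : is_derive x 1 F (x ^+ 2 * pdf x - x ^+ 0 * pdf x).
  apply: is_drv_eq (is_drvM (is_drvN (is_drv_id x)) (std_pdf_drv x)) _.
  by rewrite expr0; ring.
have m00 : measurable (`[0, +oo[%classic : set (measurableTypeR R)) by [].
have ck j : {within `[0, +oo[, continuous (fun x : R => x ^+ j * pdf x)}.
  apply: cont_itv0y => t _; apply: cvgM; first exact: exprn_cont.
  exact: is_drv_cont (std_pdf_drv t).
have lF : F x @[x --> +oo] --> (0 : R).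
  have e1 : (0 : R) < 2^-1 by rewrite invr_gt0.
  have [K K0 hK] := exprn_le_exp 1 e1.
  pose L := normal_peak (1 : R) * K * expR 2^-1.
  have p0 : 0 <= normal_peak (1 : R) by exact: normal_peak_ge0.
  have lb : L * expR (- (2^-1 * x)) @[x --> +oo] --> (0 : R).
    rewrite -[X in _ --> X](mulr0 L).
    by apply: cvgM; [exact: cvg_cst|exact: exp_cvg0].
  apply: norm_cvg0; apply: (squeeze_cvgr _ (cvg_cst 0) lb); near=> t.
  have t0 : 0 <= t by near: t; apply: nbhs_pinfty_ge; exact: num_real.
  rewrite normr_ge0 /= /F mulNr normrN ger0_norm; last by rewrite mulr_ge0 ?normal_pdf_ge0.
  rewrite std_pdfE mulrCA /L -!mulrA; apply: ler_wpM2l => //.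
  have := hK t t0; rewrite expr1 => ht.
  apply: le_trans (ler_wpM2r (expR_ge0 _) ht) _.
  rewrite -mulrA; apply: ler_wpM2l; first exact: ltW.
  rewrite -!expRD ler_expR.
  by have := sqr_ge0 (t - 1); rewrite sqrrB; lra.
have fi : mu.-integrable `[0, +oo[ (EFin \o (fun x : R => x ^+ 2 * pdf x - x ^+ 0 * pdf x)).
  exact: (integrableB m00 i2 i0).
have cf : {within `[0, +oo[, continuous (fun x : R => x ^+ 2 * pdf x - x ^+ 0 * pdf x)}.
  by move=> t; apply: cvgB; exact: ck.
have cF : {within `[0, +oo[, continuous F}.
  by apply: cont_itv0y => t _; exact: is_drv_cont (dF t).
have := FTC2y fi cf cF (fun t _ => dF t) lF.
rewrite /F oppr0 mul0r subr0 (RintegralB m00 i2 i0) => /subr0_eq.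
move=> e; apply/eqP; rewrite -(fineK (integrable_fin_num _ i2)) //.
by rewrite -(fineK (integrable_fin_num _ i0)) //; apply/eqP; congr EFin.
Unshelve. all: by end_near. Qed.

Lemma std_moment4 : (\int[normal_prob 0 1]_x ((x : R) ^+ 4)%:E < +oo)%E.
Proof.
rewrite (even_moment (j := 4)) //.
by rewrite -(fineK (integrable_fin_num _ (pow_pdf_integrable 4))) // -EFinM ltry.
Qed.

End gauss.

(** * Growth of Brownian paths *)

Section chaining.
Context {R : realType}.

Definition dyad (n k j : nat) : R := n%:R + j%:R / 2 ^+ k.

Lemma dyad0 n k : dyad n k 0 = n%:R. Proof. by rewrite /dyad mul0r addr0. Qed.

Lemma dyadS n k : dyad n k (2 ^ k) = n.+1%:R.
Proof. by rewrite /dyad natrX divff ?expf_neq0 // natr1. Qed.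

Lemma dyad_double n k j : dyad n k.+1 j.*2 = dyad n k j.
Proof.
have h : (2 : R) ^+ k != 0 by rewrite expf_neq0.
by rewrite /dyad -muln2 natrM exprS; congr (_ + _); field.
Qed.

Lemma dyad_ge0 n k j : 0 <= dyad n k j.
Proof. by rewrite addr_ge0 // divr_ge0 // exprn_ge0. Qed.

Lemma dyad_lt n k j : dyad n k j < dyad n k j.+1.
Proof. by rewrite ltrD2l ltr_pM2r ?invr_gt0 ?exprn_gt0 // ltr_nat. Qed.

Lemma dyadB n k j : dyad n k j.+1 - dyad n k j = (2 ^+ k)^-1.
Proof.
have h : (2 : R) ^+ k != 0 by rewrite expf_neq0.
by rewrite /dyad -natr1; field.
Qed.

Context (B : R -> R) (lam e : R) (lam0 : 0 <= lam) (e0 : 0 < e).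
Context (cB : {within `[0, +oo[, continuous B}) (B0 : B 0 = 0).

Let r : R := 19 / 20.
Let r0 : 0 < r. Proof. by rewrite divr_gt0. Qed.

Context (step : forall n k j, (j < 2 ^ k)%N ->
  `|B (dyad n k j.+1) - B (dyad n k j)| <= lam * expR (e * n%:R) * r ^+ k).

Let geo_le k : \sum_(0 <= i < k) r ^+ i <= 20.
Proof.
have r1 : `|r| < 1 by rewrite gtr0_norm // /r; lra.
have := @geometric_le_lim R k 1 r ler01 r0 r1.
rewrite /series /= /geometric /=; under eq_bigr do rewrite mul1r.
have -> : 1 / (1 - r) = 20 by rewrite /r; field.
by [].
Qed.

Let L n := lam * expR (e * n%:R).
Let L0 n : 0 <= L n. Proof. by rewrite mulr_ge0 ?expR_ge0. Qed.

(** Each dyadic point of level [k + 1] is within one increment of a point of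
    level [k]. *)
Lemma dyadic_bound n k j : (j <= 2 ^ k)%N ->
  `|B (dyad n k j) - B n%:R| <= L n * \sum_(0 <= i < k.+1) r ^+ i.
Proof.
elim: k j => [|k IH] j jk.
  rewrite big_nat1 expr0 mulr1; case: j jk => [|[|//]] _.
    by rewrite dyad0 subrr normr0.
  by have := @step n 0 0 isT; rewrite dyad0 expr0 mulr1.
have j2 : (j./2 <= 2 ^ k)%N.
  by rewrite -(doubleK (2 ^ k)%N) half_leq // -mul2n -expnS.
have h := IH _ j2; rewrite -dyad_double in h.
rewrite big_nat_recr //= mulrDr.
have [oj|ej] := boolP (odd j); last first.
  have -> : j = (j./2).*2 by rewrite -{1}(odd_double_half j) (negbTE ej).
  apply: le_trans h _; rewrite lerDl mulr_ge0 // exprn_ge0 // ltW //.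
have jE : j = (j./2).*2.+1 by rewrite -{1}(odd_double_half j) oj.
have jlt : ((j./2).*2 < 2 ^ k.+1)%N by rewrite -jE.
rewrite jE; have := step n jlt => hs.
rewrite -[X in `|X|](subrKA (B (dyad n k.+1 (j./2).*2))).
by apply: le_trans (ler_normD _ _) _; rewrite addrC lerD.
Qed.

Lemma unit_interval_bound n t : n%:R <= t <= n.+1%:R -> `|B t - B n%:R| <= 20 * L n.
Proof.
move=> /andP[nt tn].
pose Bc u := B (Num.max u 0).
have cBc : continuous Bc by exact: within_cont_max.
have BcE u : 0 <= u -> Bc u = B u by move=> u0; rewrite /Bc max_l.
have t0 : 0 <= t by exact: le_trans nt.
pose x k := (t - n%:R) * 2 ^+ k.
have p2 k : (0 : R) < 2 ^+ k by rewrite exprn_gt0.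
have x0 k : 0 <= x k by rewrite mulr_ge0 ?subr_ge0 // ltW.
pose j k := Num.Def.trunc (x k).
have jb k : (j k)%:R <= x k < (j k).+1%:R by exact: truncn_itv.
have jle k : (j k <= 2 ^ k)%N.
  have /andP[h _] := jb k; rewrite -(ler_nat R) natrX; apply: le_trans h _.
  by rewrite ler_piMl ?(ltW (p2 k)) // lerBlDr addrC natr1.
have dist k : `|t - dyad n k (j k)| <= (2 ^+ k)^-1.
  have /andP[h1 h2] := jb k.
  have -> : t - dyad n k (j k) = (x k - (j k)%:R) / 2 ^+ k.
    by rewrite /x /dyad; field; rewrite gt_eqF.
  rewrite normrM normfV (gtr0_norm (p2 k)) ler_piMl ?invr_ge0 ?(ltW (p2 k)) //.
  rewrite ger0_norm ?subr_ge0 //; move: h2; rewrite -natr1; lra.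
have lim : dyad n k (j k) @[k --> \oo] --> t.
  have r2 : `|(2^-1 : R)| < 1 by rewrite gtr0_norm ?invr_gt0 //; lra.
  have l0 := cvg_geometric 1 r2.
  apply/cvgrPdist_le => eta eta0; near=> k.
  apply: le_trans (dist k) _; rewrite -exprVn -[leLHS]mul1r.
  by near: k; apply: (cvgr_le _ l0).
have limB := cvg_comp _ _ lim (cBc t).
apply/ler_addgt0Pr => eta eta0.
have [k hk] : exists k, `|Bc t - Bc (dyad n k (j k))| <= eta.
  have [N _ hN] : \forall k \near \oo, `|Bc t - Bc (dyad n k (j k))| <= eta.
    exact: cvgr_dist_le limB _ eta0.
  by exists N; apply: hN => /=.
rewrite !BcE ?dyad_ge0 // in hk.
have h1 := dyadic_bound n (jle k).
have h2 : L n * (\sum_(0 <= i < k.+1) r ^+ i) <= 20 * L n.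
  by rewrite mulrC ler_wpM2r.
rewrite -[X in `|X|](subrKA (B (dyad n k (j k)))).
apply: le_trans (ler_normD _ _) _; rewrite addrC lerD //.
exact: le_trans h1 h2.
Unshelve. all: by end_near. Qed.

Lemma integer_bound n : `|B n%:R| <= n%:R * L n.
Proof.
elim: n => [|n IH]; first by rewrite B0 normr0 mul0r.
have h : `|B n.+1%:R - B n%:R| <= L n.
  by have := @step n 0 0 isT; rewrite dyad0 (dyadS n 0) expr0 mulr1.
have LS : L n <= L n.+1.
  by rewrite ler_wpM2l // ler_expR ler_wpM2l ?(ltW e0) // ler_nat.
rewrite -[X in `|X|](subrK (B n%:R)).
apply: le_trans (ler_normD _ _) _.
apply: (@le_trans _ _ (L n + n%:R * L n)); first exact: lerD.
rewrite -[in leRHS]natr1 mulrDl mul1r addrC.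
by apply: lerD => //; exact: ler_wpM2l.
Qed.

(** Kolmogorov's chaining: dyadic points are joined to the integer below by
    increments of geometrically decreasing size, the other points follow by
    continuity, and the integers are joined to [0] by unit steps. *)
Lemma chaining t : 0 <= t -> `|B t| <= lam * ((t + 20) * expR (e * t)).
Proof.
move=> t0; have /andP[h1 h2] := truncn_itv t0.
set n := Num.Def.trunc t in h1 h2.
have ha : `|B t - B n%:R| <= 20 * L n by apply: unit_interval_bound; rewrite h1 ltW.
have hb := integer_bound n.
rewrite -[X in `|X|](subrK (B n%:R)).
apply: le_trans (ler_normD _ _) _.
apply: (@le_trans _ _ ((t + 20) * L n)).
  by have := ler_wpM2r (L0 n) h1; lra.
rewrite [leRHS]mulrCA; apply: ler_wpM2l; first by rewrite addr_ge0.
by apply: ler_wpM2l => //; rewrite ler_expR ler_wpM2l // ltW.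
Qed.

End chaining.

Section growth.
Context d (T : measurableType d) (R : realType) (P : probability T R).
Context (B : R -> T -> R) (BM : brownian_motion P B).

Lemma bm_measurable t : 0 <= t -> measurable_fun setT (B t).
Proof. by have [h _ _ _ _] := BM; exact: h. Qed.

Lemma integral_law (X : T -> R) (p : probability R R) (h : R -> R) :
  measurable_fun setT X ->
  (forall A, measurable A -> P (X @^-1` A) = p A) ->
  measurable_fun setT h -> (forall x, 0 <= h x) ->
  (\int[P]_w (h (X w))%:E = \int[p]_y (h y)%:E)%E.
Proof.
move=> mX law mh h0.
have mhE : measurable_fun setT (fun y => (h y)%:E) by exact/measurable_EFinP.
have e := @ge0_integral_pushforward _ _ _ _ _ _ mX P setT (fun y => (h y)%:E)
  measurableT mhE.
rewrite preimage_setT in e; rewrite -e; last by move=> y _; rewrite lee_fin.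
by apply: eq_measure_integral => A mA _; exact: law.
Qed.

Lemma increment_law s t A : 0 <= s -> s < t -> measurable A ->
  P [set w | A (B t w - B s w)] = gauss 0 (Num.sqrt (t - s)) A.
Proof.
move=> s0 st mA; have [_ _ _ h _] := BM.
have c0 : 0 < Num.sqrt (t - s) by rewrite sqrtr_gt0 subr_gt0.
apply: (etrans (h s t s0 st A mA)).
rewrite -{1}(gtr0_norm c0); apply: normal_gauss => //.
by rewrite gt_eqF.
Qed.

Definition std_m4 : R := fine (\int[normal_prob 0 1]_x ((x : R) ^+ 4)%:E).

Lemma std_m4_ge0 : 0 <= std_m4.
Proof. by apply: fine_ge0; apply: integral_ge0 => x _; rewrite lee_fin exprn_even_ge0. Qed.

Lemma increment_moment4 s t : 0 <= s -> s < t ->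
  (\int[P]_w ((B t w - B s w) ^+ 4)%:E = ((t - s) ^+ 2 * std_m4)%:E)%E.
Proof.
move=> s0 st; have t0 : 0 <= t by apply: le_trans s0 _; exact: ltW.
set c := Num.sqrt (t - s).
have m4 : measurable_fun setT (fun x : R => x ^+ 4).
  by apply: continuous_measurable_fun => u; exact: exprn_cont.
have p4 (x : R) : 0 <= x ^+ 4 by exact: exprn_even_ge0.
have mX : measurable_fun setT (fun w => B t w - B s w).
  by apply: measurable_funB; exact: bm_measurable.
have law A : measurable A -> P ((fun w => B t w - B s w) @^-1` A) = gauss 0 c A.
  exact: increment_law.
apply: (etrans (integral_law mX law m4 p4)).
apply: (etrans (ge0_integral_affine _ 0 c m4 p4)).
have c4 : (c ^+ 4 = (t - s) ^+ 2)%R.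
  by rewrite -[4%N]/(2 * 2)%N exprM sqr_sqrtr // subr_ge0 ltW.
under eq_integral do rewrite add0r exprMn c4 EFinM.
rewrite ge0_integralZl //; last 3 first.
- by apply/measurable_EFinP.
- by move=> x _; rewrite lee_fin.
- by rewrite lee_fin sqr_ge0.
rewrite [RHS]EFinM /std_m4 fineK // ge0_fin_numE ?std_moment4 //.
by apply: integral_ge0 => x _; rewrite lee_fin.
Qed.

Lemma geometric_eseries_le (a x : R) : 0 <= a -> 0 < x -> x < 1 ->
  (\sum_(0 <= k <oo) (a * x ^+ k)%:E <= (a / (1 - x))%:E)%E.
Proof.
move=> a0 x0 x1; apply: lime_le.
  by apply: is_cvg_nneseries => n _ _; rewrite lee_fin mulr_ge0 // exprn_ge0 // ltW.
apply: nearW => n; rewrite sumEFin lee_fin.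
have xn : `|x| < 1 by rewrite gtr0_norm.
exact: (geometric_le_lim n a0 x0 xn).
Qed.

Context (e : R) (e0 : 0 < e).
(** [1 / rho <= (19 / 20) ^ 4] makes the increments summable over the levels,
    and [rho < 2] keeps the expectation of [Q] finite. *)
Let q := expR (- (4 * e)).
Let rho : R := 3 / 2.
Let q0 : 0 < q. Proof. exact: expR_gt0. Qed.
Let q1 : q < 1. Proof. by rewrite -[ltRHS]expR0 ltr_expR oppr_lt0 mulr_gt0. Qed.
Let rho0 : 0 < rho. Proof. by rewrite divr_gt0. Qed.

Let incr n k j w := B (dyad n k j.+1) w - B (dyad n k j) w.
Let term n k j w := q ^+ n * rho ^+ k * incr n k j w ^+ 4.

(** A weighted sum of the fourth powers of all dyadic increments; its
    expectation is finite, and each increment is bounded in terms of it. *)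
Let Q w : \bar R := (\sum_(0 <= n <oo) \sum_(0 <= k <oo)
  \sum_(0 <= j < 2 ^ k) (term n k j w)%:E)%E.

Let term_ge0 n k j w : (0 <= (term n k j w)%:E)%E.
Proof.
rewrite lee_fin; apply: mulr_ge0; last exact: exprn_even_ge0.
by rewrite mulr_ge0 // exprn_ge0 // ltW.
Qed.

Let incr_m n k j : measurable_fun setT (incr n k j).
Proof. by apply: measurable_funB; apply: bm_measurable; exact: dyad_ge0. Qed.

Let term_m n k j : measurable_fun setT (fun w => (term n k j w)%:E).
Proof.
apply/measurable_EFinP; apply: measurable_funM => //.
apply: measurable_funX; exact: incr_m.
Qed.

Let level_m n k : measurable_fun setT
  (fun w => \sum_(0 <= j < 2 ^ k) (term n k j w)%:E)%E.
Proof. by apply: emeasurable_sum => j; exact: term_m. Qed.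

Let level_ge0 n k w : (0 <= \sum_(0 <= j < 2 ^ k) (term n k j w)%:E)%E.
Proof. by apply: sume_ge0 => j _; exact: term_ge0. Qed.

Let unit_m n : measurable_fun setT
  (fun w => \sum_(0 <= k <oo) \sum_(0 <= j < 2 ^ k) (term n k j w)%:E)%E.
Proof. by apply: ge0_emeasurable_sum => // k _; exact: level_m. Qed.

Let unit_ge0 n w :
  (0 <= \sum_(0 <= k <oo) \sum_(0 <= j < 2 ^ k) (term n k j w)%:E)%E.
Proof. by apply: nneseries_ge0 => k _ _; exact: level_ge0. Qed.

Let Q_m : measurable_fun setT Q.
Proof. by apply: ge0_emeasurable_sum => // n _; exact: unit_m. Qed.

Let Q_ge0 w : (0 <= Q w)%E.
Proof. by apply: nneseries_ge0 => n _ _; exact: unit_ge0. Qed.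

Let term_int n k j : (\int[P]_w (term n k j w)%:E =
  (q ^+ n * rho ^+ k * ((2 ^+ k)^-1 ^+ 2 * std_m4))%:E)%E.
Proof.
have c0 : 0 <= q ^+ n * rho ^+ k by rewrite mulr_ge0 ?exprn_ge0 ?(ltW q0) ?(ltW rho0).
under eq_integral do rewrite EFinM.
rewrite ge0_integralZl //; last 2 first.
- by apply/measurable_EFinP; apply: measurable_funX; exact: incr_m.
- by move=> w _; rewrite lee_fin exprn_even_ge0.
by rewrite increment_moment4 ?dyad_ge0 ?dyad_lt // dyadB -EFinM.
Qed.

Let level_int n k : (\int[P]_w (\sum_(0 <= j < 2 ^ k) (term n k j w)%:E) =
  (q ^+ n * std_m4 * (3 / 4) ^+ k)%:E)%E.
Proof.
rewrite ge0_integral_sum //.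
under eq_bigr do rewrite term_int.
rewrite sumEFin big_const_nat iter_addr_0 subn0; congr EFin.
have e2 (x : R) : x *+ (2 ^ k) = x * 2 ^+ k by rewrite -[RHS]/(x * 2%:R ^+ k) -natrX mulr_natr.
rewrite e2.
have h : (2 : R) ^+ k != 0 by rewrite expf_neq0.
have -> : (3 / 4 : R) = rho / 2 by rewrite /rho; field.
by rewrite [(rho / 2) ^+ k]expr_div_n; field.
Qed.

Let Q_int : (\int[P]_w Q w < +oo)%E.
Proof.
rewrite integral_nneseries //.
apply: (@le_lt_trans _ _ (\sum_(0 <= n <oo) (4 * std_m4 * q ^+ n)%:E)%E).
  apply: lee_nneseries => [n _ _|n _]; first by apply: integral_ge0 => w _.
  rewrite integral_nneseries //.
  under eq_eseriesr do rewrite level_int.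
  have a0 : 0 <= q ^+ n * std_m4 by rewrite mulr_ge0 ?exprn_ge0 ?(ltW q0) ?std_m4_ge0.
  have h34 : (0 : R) < 3 / 4 by rewrite divr_gt0.
  apply: le_trans (geometric_eseries_le a0 h34 _) _; first lra.
  have -> : q ^+ n * std_m4 / (1 - 3 / 4) = 4 * std_m4 * q ^+ n by field.
  by [].
have a0 : 0 <= 4 * std_m4 by rewrite mulr_ge0 ?std_m4_ge0.
by apply: le_lt_trans (geometric_eseries_le a0 q0 q1) _; rewrite ltry.
Qed.

Let term_le n k j w : (j < 2 ^ k)%N -> (Q w < +oo)%E -> term n k j w <= 1 + fine (Q w).
Proof.
move=> jk Qw; have Qf : Q w \is a fin_num by rewrite ge0_fin_numE.
apply: (@le_trans _ _ (fine (Q w))); last by rewrite lerDr.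
rewrite -lee_fin fineK //.
apply: (@le_trans _ _ (\sum_(0 <= j < 2 ^ k) (term n k j w)%:E)%E).
  by rewrite big_mkord (bigD1 (Ordinal jk)) //= leeDl // sume_ge0.
apply: (@le_trans _ _ (\sum_(0 <= k <oo) \sum_(0 <= j < 2 ^ k) (term n k j w)%:E)%E).
  apply: le_trans (nneseries_lim_ge k.+1 _) => //.
  by rewrite big_nat_recr //= leeDr // sume_ge0.
apply: le_trans (nneseries_lim_ge n.+1 _) => //.
by rewrite big_nat_recr //= leeDr // sume_ge0.
Qed.

(** The fourth moments of the [2 ^ k] increments of level [k] add up to a
    multiple of [2 ^ (- k)], hence [Q] has finite expectation.  Chaining bounds
    the path by a multiple of the fourth root of [1 + Q], whose square is
    integrable. *)
Lemma brownian_growth : exists H : T -> R, [/\ measurable_fun setT H,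
  P.-integrable setT (EFin \o (fun w => H w ^+ 2)) &
  {ae P, forall w, {within `[0, +oo[, continuous (B ^~ w)} /\
     forall t, 0 <= t -> `|B t w| <= H w * expR (2 * e * t)}].
Proof.
have [K K0 hK] := exprn_le_exp 1 e0.
pose lam w := Num.sqrt (Num.sqrt (1 + fine (Q w))).
have S0 w : 0 <= 1 + fine (Q w) by rewrite addr_ge0 // fine_ge0.
have mS : measurable_fun setT (fun w => 1 + fine (Q w)).
  by apply: measurable_funD => //; exact: measurableT_comp.
have mlam : measurable_fun setT lam.
  have msqrt : measurable_fun setT (@Num.sqrt R).
    by apply: continuous_measurable_fun; exact: sqrt_continuous.
  by do 2 apply: (measurableT_comp msqrt).
exists (fun w => lam w * (K + 20)); split.
- by apply: measurable_funM.
- have iQ : P.-integrable setT (fun w => 1%:E + Q w)%E.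
    apply: integrableD => //; first exact: finite_measure_integrable_cst.
    by apply/integrableP; split => //; under eq_integral do rewrite gee0_abs //.
  apply: (@le_integrable _ _ _ P setT _ _
    (fun w => ((K + 20) ^+ 2)%:E * (1%:E + Q w))%E) => //.
  + by apply/measurable_EFinP; apply: measurable_funX; exact: measurable_funM.
  + move=> w _ /=; rewrite ger0_norm ?sqr_ge0 // gee0_abs; last first.
      by rewrite mule_ge0 ?lee_fin ?sqr_ge0 // adde_ge0.
    have [Qf|] := boolP (Q w \is a fin_num); last first.
      rewrite ge0_fin_numE // -leNgt leye_eq => /eqP ->.
      by rewrite addey // gt0_muley ?leey // lte_fin exprn_gt0 // addr_gt0.
    rewrite -(fineK Qf) -EFinD -EFinM lee_fin exprMn mulrC.
    apply: ler_wpM2l; first exact: sqr_ge0.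
    rewrite /lam sqr_sqrtr ?sqrtr_ge0 // -[leRHS]sqr_sqrtr ?S0 //.
    have h1 : 1 <= Num.sqrt (1 + fine (Q w)).
      by rewrite -[leLHS]sqrtr1; apply: ler_wsqrtr; rewrite lerDl fine_ge0.
    by rewrite expr2 ler_peMr // sqrtr_ge0.
  + exact: integrableZl.
have [_ h0 _ _ hc] := BM.
have hQ : {ae P, forall w, (Q w < +oo)%E}.
  have iQ : P.-integrable setT Q.
    by apply/integrableP; split => //; under eq_integral do rewrite gee0_abs //.
  have := integrable_ae measurableT iQ.
  by apply: filterS => w /(_ I); rewrite ge0_fin_numE.
near=> w.
have cw : {within `[0, +oo[, continuous (B ^~ w)} by near: w.
have w0 : B 0 w = 0 by near: w.
have Qw : (Q w < +oo)%E by near: w.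
split => // t t0.
have step n k j : (j < 2 ^ k)%N ->
    `|B (dyad n k j.+1) w - B (dyad n k j) w| <= lam w * expR (e * n%:R) * (19 / 20) ^+ k.
  move=> jk; have h := term_le n jk Qw.
  have l4 : lam w ^+ 4 = 1 + fine (Q w).
    by rewrite -[4%N]/(2 * 2)%N exprM !sqr_sqrtr ?sqrtr_ge0.
  have rhs0 : 0 <= lam w * expR (e * n%:R) * (19 / 20) ^+ k.
    by rewrite !mulr_ge0 ?sqrtr_ge0 ?expR_ge0 ?exprn_ge0 ?divr_ge0.
  rewrite -(ler_pXn2r (n := 4)) ?nnegrE //.
  have -> : `|B (dyad n k j.+1) w - B (dyad n k j) w| ^+ 4 = incr n k j w ^+ 4.
    by rewrite -normrX ger0_norm // exprn_even_ge0.
  rewrite exprMn [(lam w * _) ^+ 4]exprMn l4.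
  have -> : ((19 / 20 : R) ^+ k) ^+ 4 = ((19 / 20) ^+ 4) ^+ k by rewrite -!exprM mulnC.
  have E4 : expR (e * n%:R) ^+ 4 = (q ^+ n)^-1.
    rewrite -expRM_natl /q -expRM_natl -expRN; congr expR; ring.
  have c0 : 0 < q ^+ n * rho ^+ k by rewrite mulr_gt0 ?exprn_gt0.
  apply: (@le_trans _ _ ((1 + fine (Q w)) / (q ^+ n * rho ^+ k))).
    by rewrite ler_pdivlMr // mulrC.
  rewrite E4 -mulrA ler_wpM2l // invfM ler_wpM2l ?invr_ge0 ?exprn_ge0 ?(ltW q0) //.
  rewrite -exprVn; apply: lerXn2r; rewrite ?nnegrE.
  - by rewrite invr_ge0 ltW.
  - by rewrite exprn_ge0 // divr_ge0.
  - by rewrite /rho !exprS expr0; lra.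
have lam0 : 0 <= lam w by exact: sqrtr_ge0.
apply: le_trans (chaining lam0 e0 cw w0 step t0) _.
rewrite -[leRHS]mulrA; apply: ler_wpM2l => //.
have ht := hK t t0; rewrite expr1 in ht.
have E1 : 1 <= expR (e * t) by rewrite -[leLHS]expR0 ler_expR mulr_ge0 // ltW.
have -> : expR (2 * e * t) = expR (e * t) * expR (e * t).
  by rewrite -expRD; congr expR; ring.
rewrite mulrA; apply: ler_wpM2r; first exact: expR_ge0.
lra.
Unshelve. all: by end_near. Qed.

End growth.

(** * Sums of Brownian increments *)

Section sums.
Context d (T : measurableType d) (R : realType) (P : probability T R).

Lemma gauss0 (A : set R) : gauss 0 0 A = (`[< A 0 >]%:R : R)%:E.
Proof.
have -> : gauss 0 0 A = normal_prob 0 1 [set z : measurableTypeR R | A 0].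
  by congr (normal_prob 0 1 _); apply/seteqP; split=> z; rewrite /= /affine mul0r addr0.
have [a0|a0] := pselect (A 0).
- have -> : [set z : measurableTypeR R | A 0] = setT by apply/seteqP; split.
  by rewrite probability_setT asboolT.
- have -> : [set z : measurableTypeR R | A 0] = set0 by apply/seteqP; split.
  by rewrite measure0 asboolF.
Qed.

Lemma gauss_abs (c : R) A : measurable A -> gauss 0 c A = gauss 0 `|c| A.
Proof.
move=> mA; have [->|c0] := eqVneq c 0; first by rewrite normr0.
apply: (etrans (esym (normal_gauss 0 c0 mA))).
have c1 : `|c| != 0 by rewrite normr_eq0.
by apply: (etrans _ (normal_gauss 0 c1 mA)); rewrite normr_id.
Qed.

Lemma gauss_scale (c s : R) A : gauss 0 s [set x | A (c * x)] = gauss 0 (c * s) A.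
Proof.
congr (normal_prob 0 1 _); apply/seteqP; split=> z; rewrite /= /affine !add0r;
by rewrite mulrA.
Qed.

Lemma measurable_scale (c : R) (A : set R) : measurable A ->
  measurable [set x : R | A (c * x)].
Proof.
move=> mA; rewrite -[X in measurable X]setTI.
by apply: (measurable_funM (measurable_cst c) (@measurable_id _ _ setT)).
Qed.

Lemma measurable_add_set (A : set R) : measurable A ->
  measurable [set z : R * R | A (z.1 + z.2)].
Proof.
move=> mA; rewrite -[X in measurable X]setTI.
exact: (measurable_funD (@measurable_fst _ _ _ _) (@measurable_snd _ _ _ _)).
Qed.

(** A finite measure on the plane is determined by its values on rectangles.
    The event [G] stands for independent information about the future. *)
Lemma sum_law (X Y : T -> R) (G : set T) (p1 p2 : probability R R) (g : {nonneg R}) :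
  measurable_fun setT X -> measurable_fun setT Y -> measurable G ->
  (forall A1 A2 : set R, measurable A1 -> measurable A2 ->
     P (X @^-1` A1 `&` Y @^-1` A2 `&` G) = (g%:num%:E * p1 A1 * p2 A2)%E) ->
  forall A : set R, measurable A ->
  P ([set w | A (X w + Y w)] `&` G) =
  (g%:num%:E * (p1 \x p2) [set z : R * R | A (z.1 + z.2)%R])%E.
Proof.
move=> mX mY mG law A mA.
have mXY : measurable_fun setT (fun w => (X w, Y w)) by exact: measurable_fun_pair.
pose m' := pushforward (mrestr P mG) (fun w => (X w, Y w)).
have e : forall C, measurable C -> (mscale g p1 \x p2)%E C = m' C.
  apply: product_measure_unique => A1 A2 mA1 mA2.
  exact: law.
have e2 : forall C, measurable C -> (mscale g p1 \x p2)%E C = mscale g (p1 \x p2)%E C.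
  apply: product_measure_unique => A1 A2 mA1 mA2.
  have e3 := product_measure1E p1 p2 mA1 mA2.
  by rewrite -[LHS]/(g%:num%:E * (p1 \x p2) (A1 `*` A2))%E e3 muleA.
exact: (etrans (esym (e _ (measurable_add_set mA))) (e2 _ (measurable_add_set mA))).
Qed.


Lemma sum_law1 (X Y : T -> R) (p1 p2 : probability R R) :
  measurable_fun setT X -> measurable_fun setT Y ->
  (forall A1 A2 : set R, measurable A1 -> measurable A2 ->
     P (X @^-1` A1 `&` Y @^-1` A2) = (p1 A1 * p2 A2)%E) ->
  forall A : set R, measurable A ->
  P [set w | A (X w + Y w)] = (p1 \x p2)%E [set z : R * R | A (z.1 + z.2)].
Proof.
move=> mX mY law A mA.
have law' (A1 A2 : set R) : measurable A1 -> measurable A2 ->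
    P (X @^-1` A1 `&` Y @^-1` A2 `&` setT) = (1%:nng%:num%:E * p1 A1 * p2 A2)%E.
  by move=> mA1 mA2; rewrite setIT mul1e law.
by have := sum_law mX mY measurableT law' mA; rewrite setIT mul1e.
Qed.

Context (B : R -> T -> R) (BM : brownian_motion P B).

Lemma increment_law_le s t (A : set R) : 0 <= s -> s <= t -> measurable A ->
  P [set w | A (B t w - B s w)] = gauss 0 (Num.sqrt (t - s)) A.
Proof.
move=> s0; rewrite le_eqVlt => /predU1P[<-|st] mA; last exact: increment_law.
rewrite subrr sqrtr0 gauss0.
have [a0|a0] := pselect (A 0).
- have -> : [set w | A (B s w - B s w)] = setT.
    by apply/seteqP; split=> w //= _; rewrite subrr.
  by rewrite probability_setT asboolT.
- have -> : [set w | A (B s w - B s w)] = set0.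
    by apply/seteqP; split=> w //=; rewrite subrr.
  by rewrite measure0 asboolF.
Qed.

Lemma increments_indep (n : nat) (t : nat -> R) (A : nat -> set R) :
  0 <= t 0%N -> (forall i, t i <= t i.+1) -> (forall i, measurable (A i)) ->
  P (\bigcap_(i in `I_n) [set w | A i (B (t i.+1) w - B (t i) w)]) =
  (\prod_(i < n) P [set w | A i (B (t i.+1) w - B (t i) w)%R])%E.
Proof. by have [_ _ h _ _] := BM; exact: h. Qed.

Lemma increment_measurable s t : 0 <= s -> 0 <= t ->
  measurable_fun setT (fun w => B t w - B s w).
Proof. by move=> s0 t0; apply: measurable_funB; exact: (bm_measurable BM). Qed.

(** Read off from the independent increments of [B] over [0, p^2] and
    [p^2, p^2 + q^2], without any computation with densities. *)
Lemma gauss_convolution (p q : R) (A : set R) : measurable A ->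
  (gauss 0 `|p|%R \x gauss 0 `|q|%R)%E [set z : R * R | A (z.1 + z.2)] =
  gauss 0 (Num.sqrt (p ^+ 2 + q ^+ 2)) A.
Proof.
move=> mA.
pose t (i : nat) : R := if i is i'.+1 then if i' is 0%N then p ^+ 2 else p ^+ 2 + q ^+ 2 else 0.
have t0 : 0 <= t 0%N by [].
have ti i : t i <= t i.+1.
  case: i => [|[|i]] //=; first exact: sqr_ge0.
  by rewrite lerDl sqr_ge0.
have p0 := sqr_ge0 p; have pq0 : 0 <= p ^+ 2 + q ^+ 2 by rewrite addr_ge0 ?sqr_ge0.
have m1 := increment_measurable (lexx 0) p0.
have m2 := increment_measurable p0 pq0.
have l1 (A1 : set R) : measurable A1 ->
    P [set w | A1 (B (p ^+ 2) w - B 0 w)] = gauss 0 `|p| A1.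
  by move=> mA1; rewrite (increment_law_le (lexx 0) p0 mA1) subr0 sqrtr_sqr.
have l2 (A1 : set R) : measurable A1 ->
    P [set w | A1 (B (p ^+ 2 + q ^+ 2) w - B (p ^+ 2) w)] = gauss 0 `|q| A1.
  move=> mA1; rewrite (increment_law_le p0 _ mA1) ?lerDl ?sqr_ge0 //.
  by rewrite [X in X - _]addrC addrK sqrtr_sqr.
have e := sum_law1 m1 m2 _ mA.
rewrite -e.
- rewrite -[X in Num.sqrt X](subr0 (p ^+ 2 + q ^+ 2)).
  rewrite -(increment_law_le (lexx 0) pq0 mA); congr (P _).
  have E w : B (p ^+ 2) w - B 0 w + (B (p ^+ 2 + q ^+ 2) w - B (p ^+ 2) w) =
      B (p ^+ 2 + q ^+ 2) w - B 0 w by ring.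
  by apply/seteqP; split=> w /=; rewrite E.
- move=> A1 A2 mA1 mA2; rewrite -l1 // -l2 //.
  pose C (i : nat) := if i is 0%N then A1 else A2.
  have mC i : measurable (C i) by case: i.
  have := increments_indep 2 t0 ti mC.
  rewrite big_ord_recl big_ord_recl big_ord0 mule1 /= => <-.
  congr (P _); apply/seteqP; split=> w.
  + by move=> [h1 h2] [|[|i]].
  + by move=> h; split; [exact: (h 0%N)|exact: (h 1%N)].
Qed.

Context (t c : nat -> R) (t0 : 0 <= t 0%N) (tS : forall i, t i <= t i.+1).

Definition increment_sum k w := \sum_(i < k) c i * (B (t i.+1) w - B (t i) w).

Definition increment_var k := \sum_(i < k) c i ^+ 2 * (t i.+1 - t i).

Let t_ge0 i : 0 <= t i.
Proof. by elim: i => // i h; exact: le_trans h (tS i). Qed.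

Lemma increment_var_ge0 k : 0 <= increment_var k.
Proof. by apply: sumr_ge0 => i _; rewrite mulr_ge0 ?sqr_ge0 // subr_ge0. Qed.

Lemma increment_sum_measurable k : measurable_fun setT (increment_sum k).
Proof.
apply: measurable_sum => i; apply: measurable_funM => //.
exact: increment_measurable.
Qed.

Let event (A : set R) i := [set w | A (B (t i.+1) w - B (t i) w)].

Let event_measurable A i : measurable A -> measurable (event A i).
Proof.
by move=> mA; rewrite -[X in measurable X]setTI; apply: increment_measurable.
Qed.

Let future (A : nat -> set R) k n := \bigcap_(j in `I_n) event (A j) (k + j)%N.

Let future_measurable A k n : (forall j, measurable (A j)) -> measurable (future A k n).
Proof.
move=> mA; rewrite /future bigcap_mkcond; apply: bigcapT_measurable => j.
by case: ifP => // _; exact: event_measurable.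
Qed.

(** Induction on [k]: the increment of index [k] leaves the future and joins
    the sum, and the two laws convolve. *)
Lemma increment_sum_indep k n (A0 : set R) (A : nat -> set R) :
  measurable A0 -> (forall j, measurable (A j)) ->
  P (increment_sum k @^-1` A0 `&` future A k n) =
  (gauss 0 (Num.sqrt (increment_var k)) A0 *
   \prod_(j < n) P (event (A j) (k + j)%N))%E.
Proof.
elim: k n A0 A => [|k IH] n A0 A mA0 mA.
  have e0 : increment_sum 0 = cst 0 by apply/funext => w; rewrite /increment_sum big_ord0.
  have v0 : increment_var 0 = 0 by rewrite /increment_var big_ord0.
  have hF : P (future A 0 n) = (\prod_(j < n) P (event (A j) (0 + j)%N))%E.
    by have := increments_indep n t0 tS mA.
  rewrite e0 v0 sqrtr0 gauss0 -hF preimage_cst.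
  have [a0|a0] := pselect (A0 0).
  - by rewrite mem_set // asboolT // setTI mul1e.
  - by rewrite memNset // asboolF // set0I measure0 mul0e.
pose G := future A k.+1 n.
have mG : measurable G by exact: future_measurable.
pose g := fine (\prod_(j < n) P (event (A j) (k.+1 + j)%N))%E.
have PG : (\prod_(j < n) P (event (A j) (k.+1 + j)%N))%E = g%:E.
  rewrite fineK // prode_fin_num // => j _; apply: fin_num_measure.
  exact: event_measurable.
have g0 : 0 <= g by apply: fine_ge0; apply: prode_ge0 => j _; exact: measure_ge0.
pose s := Num.sqrt (t k.+1 - t k).
have law (A1 A2 : set R) : measurable A1 -> measurable A2 ->
  P (increment_sum k @^-1` A1 `&`
     (fun w => c k * (B (t k.+1) w - B (t k) w)) @^-1` A2 `&` G) =
  ((NngNum g0)%:num%:E * gauss 0 `|Num.sqrt (increment_var k)|%R A1 * gauss 0 `|c k * s|%R A2)%E.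
  move=> mA1 mA2.
  pose C j := if j is j'.+1 then A j' else [set x : R | A2 (c k * x)].
  have mC j : measurable (C j) by case: j => //=; exact: measurable_scale.
  have e := IH n.+1 A1 C mA1 mC.
  have -> : increment_sum k @^-1` A1 `&`
     (fun w => c k * (B (t k.+1) w - B (t k) w)) @^-1` A2 `&` G =
     increment_sum k @^-1` A1 `&` future C k n.+1.
    rewrite -setIA; congr (_ `&` _); apply/seteqP; split=> w.
    - move=> [h1 h2] [|j] /= jn; first by rewrite /event /= addn0.
      by rewrite -addSnnS; exact: h2.
    - move=> h; split; first by have := h 0%N isT; rewrite /event /= addn0.
      by move=> j jn; have := h j.+1 jn; rewrite /= -addSnnS.
  rewrite e big_ord_recl /= addn0.
  under eq_bigr do rewrite /bump /= add1n -addSnnS.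
  have l2 : P (event (C 0%N) k) = gauss 0 `|c k * s|%R A2.
    apply: (etrans (increment_law_le (t_ge0 k) (tS k) (mC 0%N))).
    by rewrite /C gauss_scale gauss_abs.
  rewrite l2 PG (ger0_norm (sqrtr_ge0 _)).
  by rewrite [LHS]muleA [LHS]muleC -[RHS]muleA.
have mZ : measurable_fun setT (fun w => c k * (B (t k.+1) w - B (t k) w)).
  by apply: measurable_funM => //; exact: increment_measurable.
have e := sum_law (increment_sum_measurable k) mZ mG law mA0.
have -> : increment_sum k.+1 @^-1` A0 =
    [set w | A0 (increment_sum k w + c k * (B (t k.+1) w - B (t k) w))].
  by apply/seteqP; split=> w; rewrite /= /increment_sum big_ord_recr.
apply: (etrans e); rewrite PG muleC; congr (_ * _)%E.
apply: (etrans (gauss_convolution _ _ mA0)); congr (gauss 0 (Num.sqrt _) A0).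
rewrite sqr_sqrtr ?increment_var_ge0 // exprMn sqr_sqrtr ?subr_ge0 //.
by rewrite /increment_var big_ord_recr.
Qed.

Lemma increment_sum_law k (A : set R) : measurable A ->
  P (increment_sum k @^-1` A) = gauss 0 (Num.sqrt (increment_var k)) A.
Proof.
move=> mA; have mT (j : nat) : measurable (setT : set R) by [].
have := increment_sum_indep k 0 mA mT.
by rewrite big_ord0 mule1 /future bigcap_mkord big_ord0 setIT.
Qed.

End sums.

(** * Step approximations of Wiener integrals *)

Section grid.
Context {R : realType}.
Local Notation mu := (@lebesgue_measure R).

Lemma step_fun_iota (t c : nat -> R) N s : (forall i, t i <= t i.+1) -> t 0%N < s ->
  (exists i, [/\ (i < N)%N, t i < s <= t i.+1 &
     step_fun [seq (t i, t i.+1, c i) | i <- iota 0 N] s = c i]) \/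
  (t N < s /\ step_fun [seq (t i, t i.+1, c i) | i <- iota 0 N] s = 0).
Proof.
move=> ti s0; elim: N => [|N IH]; first by right; rewrite /step_fun big_nil.
have e : step_fun [seq (t i, t i.+1, c i) | i <- iota 0 N.+1] s =
    step_fun [seq (t i, t i.+1, c i) | i <- iota 0 N] s +
    c N * \1_(`]t N, t N.+1]%classic) s.
  have -> : iota 0 N.+1 = iota 0 N ++ [:: N] by rewrite -addn1 iotaD.
  by rewrite /step_fun map_cat big_cat /= big_seq1.
have mono := homo_leq (@lexx _ R) (@le_trans _ R) ti.
rewrite e indicE; case: IH => [[i [iN hi ei]]|[h ei]]; rewrite ei.
- left; exists i; split => //; first exact: ltnW.
  rewrite memNset ?mulr0 ?addr0 //= in_itv /=; have /andP[_ h2] := hi.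
  by rewrite ltNge (le_trans h2 (mono _ _ iN)).
- have [h2|h2] := leP s (t N.+1).
  + left; exists N; rewrite h h2 mem_set ?mulr1 ?add0r //=.
    by rewrite in_itv /= h h2.
  + right; split => //; rewrite memNset ?mulr0 ?addr0 //= in_itv /=.
    by rewrite h /= leNgt h2.
Qed.

Definition grid n i : R := i%:R / n.+1%:R.

Lemma grid_le n i : grid n i <= grid n i.+1.
Proof. by rewrite ler_pM2r ?invr_gt0 // ler_nat. Qed.

Lemma grid_ge0 n i : 0 <= grid n i.
Proof. by rewrite divr_ge0. Qed.

Lemma grid0 n : grid n 0 = 0.
Proof. by rewrite /grid mul0r. Qed.

Lemma gridS n i : grid n i.+1 = grid n i + n.+1%:R^-1.
Proof. by rewrite /grid -addn1 natrD mulrDl mul1r. Qed.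

Lemma grid_end n : grid n (n.+1 ^ 2) = n.+1%:R.
Proof. by rewrite /grid natrX expr2 mulfK. Qed.

Definition grid_step n (c : nat -> R) : seq (R * R * R) :=
  [seq (grid n i, grid n i.+1, c i) | i <- iota 0 (n.+1 ^ 2)].

Lemma grid_step_mem n c q : q \in grid_step n c -> 0 <= q.1.1 <= q.1.2.
Proof. by case/mapP => i _ ->; rewrite grid_ge0 grid_le. Qed.

Lemma big_grid_step n (c : nat -> R) (F : R * R * R -> R) :
  \sum_(q <- grid_step n c) F q =
  \sum_(i < n.+1 ^ 2) F (grid n i, grid n i.+1, c i).
Proof. by rewrite big_map -[iota _ _]/(index_iota 0 (n.+1 ^ 2)) big_mkord. Qed.

Lemma measurable_step_fun (p : seq (R * R * R)) : measurable_fun setT (step_fun p).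
Proof.
by apply: measurable_sum => q; apply: measurable_funM.
Qed.

Lemma grid_step_locate n c s : 0 < s ->
  (exists2 i, grid n i < s <= grid n i.+1 & step_fun (grid_step n c) s = c i) \/
  (n.+1%:R < s /\ step_fun (grid_step n c) s = 0).
Proof.
move=> s0; have h0 : grid n 0 < s by rewrite grid0.
have [[i [_ h1 h2]]|[h1 h2]] := step_fun_iota c (n.+1 ^ 2) (grid_le n) h0.
- by left; exists i.
- by right; split => //; rewrite -grid_end.
Qed.

Lemma grid_near n i j s : (j <= 1)%N -> grid n i < s <= grid n i.+1 ->
  `|s - grid n (i + j)| <= n.+1%:R^-1.
Proof.
rewrite gridS => j1 /andP[h1 h2].
have : j = 0%N \/ j = 1%N by case: j j1 => [|[|]]; [left|right|].
case=> ->; rewrite ?addn0 ?addn1 ?gridS; move: (n.+1%:R^-1) h2 => y h2;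
by rewrite ler_norml; lra.
Qed.

(** The value of a cell is taken at its left ([j = 0]) or right ([j = 1]) end
    point. *)
Lemma step_fun_cvg (phi : R -> R) (j : nat) s : (j <= 1)%N ->
  {within `[0, +oo[, continuous phi} -> 0 < s ->
  step_fun (grid_step n (fun i => phi (grid n (i + j)%N))) s @[n --> \oo] --> phi s.
Proof.
move=> j1 /within_cont_max cphi s0; apply/cvgrPdist_lt => e e0.
have /cvgrPdist_lt /(_ e e0) /nbhs_ballP[r /= r0 hr] := cphi s.
have s0' : Num.max s 0 = s by apply/max_idPl; exact: ltW.
near=> n.
have nr : n.+1%:R^-1 < r by near: n; exact: near_infty_natSinv_lt (PosNum r0).
have ns : s <= n.+1%:R.
  apply: (@le_trans _ _ n%:R); last by rewrite ler_nat.
  by near: n; exact: nbhs_infty_ger.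
have [[i hi ->]|[h _]] := grid_step_locate n (fun i => phi (grid n (i + j))) s0;
  last by rewrite ltNge ns in h.
have t0' : Num.max (grid n (i + j)) 0 = grid n (i + j) by apply/max_idPl; exact: grid_ge0.
have := hr (grid n (i + j)); rewrite s0' t0'; apply.
by apply: le_lt_trans (grid_near j1 hi) _.
Unshelve. all: by end_near. Qed.

Lemma step_fun_le (phi : R -> R) (j : nat) (K e : R) n s : (j <= 1)%N ->
  (forall t, 0 <= t -> `|phi t| <= K * expR (e * t)) -> 0 < s ->
  `|step_fun (grid_step n (fun i => phi (grid n (i + j)%N))) s| <=
  K * expR `|e| * expR (e * s).
Proof.
move=> j1 le s0.
have K0 : 0 <= K.
  by have := le 0 (lexx _); rewrite mulr0 expR0 mulr1; exact: le_trans.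
have [[i hi ->]|[_ ->]] := grid_step_locate n (fun i => phi (grid n (i + j))) s0; last first.
  by rewrite normr0 !mulr_ge0 ?expR_ge0.
apply: le_trans (le _ (grid_ge0 _ _)) _.
rewrite -[leRHS]mulrA -expRD; apply: ler_wpM2l => //; rewrite ler_expR.
rewrite -lerBlDr -mulrBr; apply: le_trans (ler_norm _) _.
rewrite normrM distrC -[leRHS]mulr1; apply: ler_wpM2l => //.
apply: le_trans (grid_near j1 hi) _.
by rewrite invf_le1 // ler1n.
Qed.

(** Only local integrability of [g] is asked for, so that [g = 1] is allowed. *)
Lemma integral_step_fun (p : seq (R * R * R)) (g : R -> R) :
  (forall q, q \in p -> 0 <= q.1.1 <= q.1.2) ->
  (forall x y, 0 <= x -> mu.-integrable `[x, y] (EFin \o g)) ->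
  mu.-integrable `]0, +oo[ (EFin \o (fun s => g s * step_fun p s)) /\
  \int[mu]_(s in `]0, +oo[) (g s * step_fun p s) =
  \sum_(q <- p) q.2 * \int[mu]_(s in `[q.1.1, q.1.2]) g s.
Proof.
move=> + ig; elim: p => [|q p IH] hp.
  have e0 : (fun s => g s * step_fun [::] s) = cst 0.
    by apply/funext => s; rewrite /step_fun big_nil mulr0.
  rewrite e0 big_nil; split; first exact: integrable0.
  by rewrite /Rintegral integral0.
have /andP[q0 q1] := hp q (mem_head _ _).
have [i1 e1] := IH (fun r hr => hp r (mem_behead (s := q :: p) hr)).
have e s : g s * step_fun (q :: p) s =
    q.2 * (g s * \1_(`]q.1.1, q.1.2]%classic) s) + g s * step_fun p s.
  by rewrite /step_fun big_cons; ring.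
have mD : measurable (`]0%R, +oo[%classic : set (measurableTypeR R)) by [].
have mI : measurable (`]q.1.1, q.1.2]%classic : set (measurableTypeR R)) by [].
have io : mu.-integrable `]q.1.1, q.1.2] (EFin \o g).
  apply: integrableS (ig q.1.1 q.1.2 q0) => //.
  exact: subset_itv_oc_cc.
have ep : (EFin \o (fun s => g s * \1_(`]q.1.1, q.1.2]%classic) s)) \_ `]0%R, +oo[ =
    (EFin \o g) \_ `]q.1.1, q.1.2].
  apply/funext => s; rewrite /patch /= indicE.
  have [h|h] := boolP (s \in (`]q.1.1, q.1.2]%classic : set R)); last first.
    by rewrite mulr0; case: ifP.
  rewrite mulr1 ifT //; move: h; rewrite !inE /= !in_itv /= => /andP[h _].
  by rewrite andbT (le_lt_trans q0 h).
have i2 : mu.-integrable `]0, +oo[ (EFin \o (fun s => g s * \1_(`]q.1.1, q.1.2]%classic) s)).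
  by apply/(integrable_mkcond _ mD); rewrite ep; apply/(integrable_mkcond _ mI).
have e2 : \int[mu]_(s in `]0, +oo[) (g s * \1_(`]q.1.1, q.1.2]%classic) s) =
    \int[mu]_(s in `[q.1.1, q.1.2]) g s.
  rewrite -Rintegral_itv_obnd_cbnd //; congr fine.
  by rewrite integral_mkcond ep -integral_mkcond.
have i3 : mu.-integrable `]0, +oo[
    (EFin \o (fun s => q.2 * (g s * \1_(`]q.1.1, q.1.2]%classic) s))).
  exact: (integrableZl mD q.2 i2).
rewrite (_ : (fun s => g s * step_fun (q :: p) s) = (fun s =>
  q.2 * (g s * \1_(`]q.1.1, q.1.2]%classic) s) + g s * step_fun p s)); last exact/funext.
split; first exact: (integrableD mD i3 i1).
rewrite big_cons -e1 -e2; apply: (etrans (RintegralD mD i3 i1)).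
by congr (_ + _); exact: (RintegralZl q.2 mD i2).
Qed.

End grid.

Section weight.
Context {R : realType}.
Local Notation mu := (@lebesgue_measure R).
Context (a K : R) (f f' : R -> R) (a0 : 0 < a).
Context (cf : {within `[0, +oo[, continuous f}).
Context (cf' : {within `[0, +oo[, continuous f'}).
Context (df : forall x y, 0 <= x -> x <= y -> \int[mu]_(t in `[x, y]) f' t = f y - f x).
Context (bf : forall t, 0 <= t -> `|f t| <= K * expR (- (a / 2) * t)).
Context (bf' : forall t, 0 <= t -> `|f' t| <= K * expR (- (a / 2) * t)).

Let a2 : 0 < a / 2. Proof. by rewrite divr_gt0. Qed.
Let a4 : 0 < a / 4. Proof. by rewrite divr_gt0. Qed.

Let K0 : 0 <= K.
Proof. by have := bf (lexx 0); rewrite mulr0 expR0 mulr1; exact: le_trans. Qed.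

Let mD : measurable (`]0%R, +oo[%classic : set (measurableTypeR R)).
Proof. by []. Qed.

Let pos s : (`]0, +oo[%classic : set R) s -> 0 < s.
Proof. by rewrite /= in_itv /= andbT. Qed.

Let open_sub (g : R -> R) : measurable_fun (`[0, +oo[ : set R) g ->
  measurable_fun (`]0, +oo[ : set (measurableTypeR R)) g.
Proof.
move=> mg; apply: (@measurable_funS _ _ _ _ (`[0, +oo[ : set (measurableTypeR R))) => //.
by move=> s /pos s0; rewrite /= in_itv /= andbT ltW.
Qed.

Let step_m p (A : set (measurableTypeR R)) : measurable_fun A (step_fun p : R -> R).
Proof. exact: (measurable_funS measurableT (@subsetT _ _) (measurable_step_fun p)). Qed.

Let exp_int (M : R) : mu.-integrable `]0, +oo[ (EFin \o (fun t => M * expR (- (a / 4 * t)))).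
Proof.
have m0 : measurable (`[0%R, +oo[%classic : set (measurableTypeR R)) by [].
apply: (integrableS m0 mD _ (integrableZl m0 M (exp_integrable a4))) => s /pos s0.
by rewrite /= in_itv /= andbT ltW.
Qed.

Definition weight_step n := grid_step n (fun i => f (grid n i)).

(** The Wiener integral of [f] by parts, which makes sense along every path of
    moderate growth. *)
Definition weight_limit (B : R -> R) : R :=
  - (f 0 * B 0) - \int[mu]_(s in `[0, +oo[) (f' s * B s).

Lemma abel_sum (t B : R -> R) (x : nat -> R) N :
  \sum_(i < N) t (x i) * (B (x i.+1) - B (x i)) =
  t (x N) * B (x N) - t (x 0%N) * B (x 0%N) -
  \sum_(i < N) B (x i.+1) * (t (x i.+1) - t (x i)).
Proof.
elim: N => [|N IH]; first by rewrite !big_ord0; ring.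
by rewrite !big_ord_recr /= IH; ring.
Qed.

Let right_step (B : R -> R) n := grid_step n (fun i => B (grid n (i + 1)%N)).

(** Summation by parts turns the sums against [B] into integrals of [f'] against
    step versions of [B], which are accessible to dominated convergence. *)
Lemma weight_step_abel (B : R -> R) n :
  \sum_(q <- weight_step n) q.2 * (B q.1.2 - B q.1.1) =
  f n.+1%:R * B n.+1%:R - f 0 * B 0 -
  \int[mu]_(s in `]0, +oo[) (f' s * step_fun (right_step B n) s).
Proof.
have ig x y : 0 <= x -> mu.-integrable `[x, y] (EFin \o f').
  move=> x0; apply: cont_itv_integrable; apply: within_cont_sub cf' => s.
  by rewrite /= !in_itv /= andbT => /andP[h _]; exact: le_trans h.
have [_ ->] := integral_step_fun (@grid_step_mem _ n (fun i => B (grid n (i + 1)%N))) ig.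
rewrite !big_grid_step /= (abel_sum f B (grid n)) grid_end grid0; congr (_ - _).
by apply: eq_bigr => i _; rewrite addn1 df ?grid_ge0 ?grid_le.
Qed.

Let csqr : {within `[0, +oo[, continuous (fun t => f t ^+ 2)}.
Proof. exact: within_contM. Qed.

Let expRM2 (c : R) : expR c ^+ 2 = expR (2 * c).
Proof. by rewrite expr2 -expRD; congr expR; ring. Qed.

Let exp_le4 t : 0 <= t -> expR (- a * t) <= expR (- (a / 4 * t)).
Proof.
move=> t0; rewrite ler_expR; have : 0 <= a * t by rewrite mulr_ge0 // ltW.
have -> : - (a / 4 * t) = - (a * t) / 4 by field.
by rewrite mulNr; move: (a * t) => u h; lra.
Qed.

Let bsqr t : 0 <= t -> `|f t ^+ 2| <= K ^+ 2 * expR (- a * t).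
Proof.
move=> t0; rewrite normrX.
have -> : K ^+ 2 * expR (- a * t) = (K * expR (- (a / 2) * t)) ^+ 2.
  by rewrite exprMn expRM2; congr (_ * expR _); field.
by apply: lerXn2r; rewrite ?nnegrE ?mulr_ge0 ?expR_ge0 //; exact: bf.
Qed.

Lemma weight_var_cvg :
  \sum_(i < n.+1 ^ 2) f (grid n i) ^+ 2 * (grid n i.+1 - grid n i) @[n --> \oo] -->
  \int[mu]_(s in `[0, +oo[) f s ^+ 2.
Proof.
pose st n := grid_step n (fun i => f (grid n (i + 0)%N) ^+ 2).
have ig x y : 0 <= x -> mu.-integrable `[x, y] (EFin \o (fun _ : R => 1 : R)).
  by move=> _; apply: cont_itv_integrable; apply: cont_within => t _; exact: cst_continuous.
have e n : \sum_(i < n.+1 ^ 2) f (grid n i) ^+ 2 * (grid n i.+1 - grid n i) =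
    \int[mu]_(s in `]0, +oo[) (1 * step_fun (st n) s).
  have [_ ->] := integral_step_fun (@grid_step_mem _ n (fun i => f (grid n (i + 0)%N) ^+ 2)) ig.
  rewrite big_grid_step; apply: eq_bigr => i _ /=; rewrite addn0; congr (_ * _).
  have c1 : {within `[grid n i, grid n i.+1], continuous (fun _ : R => 1 : R)}.
    by apply: cont_within => t _; exact: cst_continuous.
  have c2 : {within `[grid n i, grid n i.+1], continuous (fun t : R => t)}.
    by apply: cont_within => t _; exact: cvg_id.
  have d1 (t : R) : grid n i < t < grid n i.+1 -> is_derive t 1 (fun t : R => t) 1.
    by move=> _; exact: is_drv_id.
  by rewrite (FTC2_itv (grid_le n i) c1 c2 d1).
under eq_fun do rewrite e.
have le n s : (`]0, +oo[%classic : set R) s ->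
    `|1 * step_fun (st n) s| <= K ^+ 2 * expR a * expR (- (a / 4 * s)).
  move=> /pos s0; rewrite mul1r.
  apply: le_trans (step_fun_le n (leq0n 1) bsqr s0) _; rewrite normrN (gtr0_norm a0).
  by apply: ler_wpM2l; [rewrite mulr_ge0 ?sqr_ge0 ?expR_ge0|exact: exp_le4 (ltW s0)].
have lim s : (`]0, +oo[%classic : set R) s -> 1 * step_fun (st n) s @[n --> \oo] --> f s ^+ 2.
  move=> /pos s0; rewrite -[X in _ --> X]mul1r; apply: cvgM; first exact: cvg_cst.
  exact: (step_fun_cvg (leq0n 1) csqr s0).
have mf_ n : measurable_fun (`]0, +oo[ : set (measurableTypeR R))
    (fun s => 1 * step_fun (st n) s).
  by apply: measurable_funM => //; exact: step_m.
have [il lim2] := Rdominated_cvg mD mf_ lim (exp_int _) le.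
by rewrite -Rintegral_itv_obnd_cbnd.
Qed.

Lemma weight_step_L2 :
  (\int[mu]_(s in `[0%R, +oo[) ((step_fun (weight_step n) s - f s) ^+ 2)%R%:E)%E
     @[n --> \oo] --> 0%E.
Proof.
have mf0 : measurable_fun (`[0, +oo[ : set (measurableTypeR R)) f.
  exact: (within_measurable cf).
have mf : measurable_fun (`]0, +oo[ : set (measurableTypeR R)) f by exact: open_sub.
have mh n : measurable_fun (`]0, +oo[ : set (measurableTypeR R))
    (fun s => ((step_fun (weight_step n) s - f s) ^+ 2)%R%:E).
  have m1 : measurable_fun (`]0, +oo[ : set (measurableTypeR R))
      (fun s => step_fun (weight_step n) s - f s).
    by apply: measurable_funB mf; exact: step_m.
  by apply/measurable_EFinP; exact: measurable_funX.
have e n : (\int[mu]_(s in `[0%R, +oo[) ((step_fun (weight_step n) s - f s) ^+ 2)%R%:E =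
    \int[mu]_(s in `]0%R, +oo[) ((step_fun (weight_step n) s - f s) ^+ 2)%R%:E)%E.
  exact: (esym (integral_itv_obnd_cbnd (mh n))).
under eq_fun do rewrite e.
have w n : weight_step n = grid_step n (fun i => f (grid n (i + 0)%N)).
  by apply: eq_map => i; rewrite addn0.
have lim s : (`]0, +oo[%classic : set R) s ->
    ((step_fun (weight_step n) s - f s) ^+ 2)%:E @[n --> \oo] --> 0%E.
  move=> /pos s0; apply: cvg_EFin; first exact: nearW.
  have h := step_fun_cvg (leq0n 1) cf s0.
  have h2 : step_fun (weight_step n) s - f s @[n --> \oo] --> f s - f s.
    by apply: cvgB; [under eq_fun do rewrite w|exact: cvg_cst].
  have h3 := cvgM h2 h2; rewrite subrr mulr0 in h3; exact: h3.
pose M := K * expR (a / 2) + K.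
have le n s : (`]0, +oo[%classic : set R) s ->
    (`|((step_fun (weight_step n) s - f s) ^+ 2)%:E| <= (M ^+ 2 * expR (- (a / 4 * s)))%:E)%E.
  move=> /pos s0; rewrite abse_EFin lee_fin normrX w.
  have h := step_fun_le n (leq0n 1) bf s0; rewrite normrN (gtr0_norm a2) in h.
  have h1 := le_trans (ler_normB _ _) (lerD h (bf (ltW s0))).
  have M0 : 0 <= M by rewrite addr_ge0 // mulr_ge0 ?expR_ge0.
  apply: (@le_trans _ _ ((M * expR (- (a / 2) * s)) ^+ 2)).
    apply: lerXn2r; rewrite ?nnegrE ?mulr_ge0 ?expR_ge0 //.
    by apply: le_trans h1 _; rewrite /M mulrDl.
  rewrite exprMn; apply: ler_wpM2l; first exact: sqr_ge0.
  rewrite expRM2; have -> : 2 * (- (a / 2) * s) = - a * s by field.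
  exact: exp_le4 (ltW s0).
have m0 : measurable_fun (`]0, +oo[ : set (measurableTypeR R)) (cst (0 : \bar R)%E) by [].
have le' : {ae mu, forall s n, (`]0, +oo[%classic : set R) s ->
    (`|((step_fun (weight_step n) s - f s) ^+ 2)%:E| <= (M ^+ 2 * expR (- (a / 4 * s)))%:E)%E}.
  by apply: aeW => s n; exact: le.
have lim' : {ae mu, forall s, (`]0, +oo[%classic : set R) s ->
    ((step_fun (weight_step n) s - f s) ^+ 2)%:E @[n --> \oo] --> cst 0%E s}.
  by apply: aeW => s; exact: lim.
have [_ _] := dominated_convergence mD mh m0 lim' (exp_int (M ^+ 2)) le'.
by rewrite integral0.
Qed.

Context (H : R) (B : R -> R) (gB : exp_growth a H B).

Let H0 : 0 <= H. Proof. exact: exp_growth_ge0 gB. Qed.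

Let bound n s : 0 < s ->
  `|f' s * step_fun (right_step B n) s| <= K * H * expR (a / 4) * expR (- (a / 4 * s)).
Proof.
move=> s0; have [_ hB] := gB.
rewrite normrM; apply: le_trans (ler_pM _ _ (bf' (ltW s0)) (step_fun_le _ (leqnn 1) hB s0)) _ => //.
rewrite (gtr0_norm a4).
have -> : - (a / 4 * s) = - (a / 2) * s + a / 4 * s by field.
by rewrite expRD le_eqVlt; apply/orP; left; apply/eqP; ring.
Qed.

Let end_bound n : `|f n.+1%:R * B n.+1%:R| <= K * H * expR (- (a / 4 * n.+1%:R)).
Proof.
have [_ hB] := gB; have n0 : 0 <= n.+1%:R :> R by [].
rewrite normrM; apply: le_trans (ler_pM _ _ (bf n0) (hB _ n0)) _ => //.
have -> : - (a / 4 * n.+1%:R) = - (a / 2) * n.+1%:R + a / 4 * n.+1%:R by field.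
by rewrite expRD le_eqVlt; apply/orP; left; apply/eqP; ring.
Qed.

Lemma weight_step_cvg :
  \sum_(q <- weight_step n) q.2 * (B q.1.2 - B q.1.1) @[n --> \oo] --> weight_limit B.
Proof.
have [cB _] := gB.
have mf_ n : measurable_fun (`]0, +oo[ : set (measurableTypeR R))
    (fun s => f' s * step_fun (right_step B n) s).
  by apply: measurable_funM; [exact: open_sub (within_measurable cf')|exact: step_m].
have lim s : (`]0, +oo[%classic : set R) s ->
    f' s * step_fun (right_step B n) s @[n --> \oo] --> f' s * B s.
  move=> /pos s0; apply: cvgM; first exact: cvg_cst.
  exact: (step_fun_cvg (leqnn 1) cB s0).
have le n s : (`]0, +oo[%classic : set R) s ->
    `|f' s * step_fun (right_step B n) s| <= K * H * expR (a / 4) * expR (- (a / 4 * s)).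
  by move=> /pos s0; exact: bound.
have [il lim2] := Rdominated_cvg mD mf_ lim (exp_int _) le.
have lim3 : f n.+1%:R * B n.+1%:R @[n --> \oo] --> (0 : R).
  have e1 : expR (- (a / 4 * n%:R)) @[n --> \oo] --> (0 : R).
    exact: (cvg_comp _ _ (@cvgr_idn R) (exp_cvg0 a4)).
  have e2 : expR (- (a / 4 * n.+1%:R)) @[n --> \oo] --> (0 : R).
    by rewrite -cvg_shiftS in e1.
  apply: norm_cvg0; apply: (@squeeze_cvgr _ _ _ _ (cst 0) (fun n => K * H * expR (- (a / 4 * n.+1%:R)))).
  - by apply: nearW => n; rewrite normr_ge0 end_bound.
  - exact: cvg_cst.
  - by rewrite -[X in _ --> X](mulr0 (K * H)); apply: cvgM => //; exact: cvg_cst.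
rewrite /weight_limit -Rintegral_itv_obnd_cbnd // -[X in X - _]add0r.
under eq_fun do rewrite weight_step_abel.
apply: cvgB => //; apply: cvgD => //; exact: cvg_cst.
Qed.

Lemma weight_step_le n :
  `|\sum_(q <- weight_step n) q.2 * (B q.1.2 - B q.1.1)| <=
  K * (2 + expR (a / 4) * \int[mu]_(s in `]0, +oo[) expR (- (a / 4 * s))) * H.
Proof.
have [_ hB] := gB.
rewrite weight_step_abel.
have h1 : `|f n.+1%:R * B n.+1%:R| <= K * H.
  apply: le_trans (end_bound n) _; rewrite -[leRHS]mulr1; apply: ler_wpM2l.
    by rewrite mulr_ge0.
  by rewrite -[leRHS]expR0 ler_expR oppr_le0 mulr_ge0 // ltW.
have h2 : `|f 0 * B 0| <= K * H.
  have := bf (lexx 0); have := hB 0 (lexx _); rewrite !mulr0 expR0 !mulr1 => u1 u2.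
  by rewrite normrM; apply: ler_pM.
have mI : measurable_fun (`]0, +oo[ : set (measurableTypeR R))
    (fun s => f' s * step_fun (right_step B n) s).
  by apply: measurable_funM; [exact: open_sub (within_measurable cf')|exact: step_m].
have iI : mu.-integrable `]0, +oo[ (EFin \o (fun s => f' s * step_fun (right_step B n) s)).
  apply: (le_integrable mD _ _ (exp_int (K * H * expR (a / 4)))).
    exact/measurable_EFinP.
  move=> s /pos s0; rewrite /= lee_fin [leRHS]ger0_norm; first exact: bound.
  by rewrite !mulr_ge0 ?expR_ge0.
have h3 : `|\int[mu]_(s in `]0, +oo[) (f' s * step_fun (right_step B n) s)| <=
    K * H * expR (a / 4) * \int[mu]_(s in `]0, +oo[) expR (- (a / 4 * s)).
  have i1 : mu.-integrable `]0, +oo[ (EFin \o (fun s => expR (- (a / 4 * s)))).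
    rewrite (_ : (fun s : R => expR _) = (fun s => 1 * expR (- (a / 4 * s)))).
      exact: exp_int.
    by apply/funext => s; rewrite mul1r.
  rewrite -(RintegralZl _ mD i1).
  apply: le_trans (le_normr_Rintegral mD iI) _.
  apply: (le_Rintegral mD _ (exp_int (K * H * expR (a / 4)))).
    exact: (integrable_norm iI).
  by move=> s /pos s0; exact: bound.
move: (\int[mu]_(s in `]0, +oo[) expR _) h3 => G h3.
apply: le_trans (ler_normB _ _) _; apply: le_trans (lerD (ler_normB _ _) h3) _.
have -> : K * (2 + expR (a / 4) * G) * H = K * H + K * H + K * H * expR (a / 4) * G by ring.
by rewrite lerD2r; exact: lerD.
Qed.

End weight.

(** * Limits of moments and of normal laws *)

Section dominated.
Context d (T : measurableType d) (R : realType) (P : probability T R).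

Lemma mean_integral (X : T -> R) : 'E_P[X]%E = (\int[P]_w (X w)%:E)%E.
Proof. by rewrite unlock. Qed.

Lemma variance_integral (X : T -> R) :
  'V_P[X]%E = (\int[P]_w ((X w - fine 'E_P[X]) ^+ 2)%:E)%E.
Proof. by rewrite /variance unlock mean_integral; apply: eq_integral. Qed.

Context (Y : nat -> T -> R) (C G : T -> R).
Context (mY : forall n, measurable_fun setT (Y n)) (mC : measurable_fun setT C).
Context (limY : {ae P, forall w, Y n w @[n --> \oo] --> C w}).
Context (iG : P.-integrable setT (EFin \o G)).
Context (leY : {ae P, forall w n, Y n w ^+ 2 <= G w}).

Let mT : measurable (setT : set T). Proof. exact: measurableT. Qed.

Let leC : {ae P, forall w, C w ^+ 2 <= G w}.
Proof.
near=> w.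
have lim : Y n w @[n --> \oo] --> C w by near: w.
have le : forall n, Y n w ^+ 2 <= G w by near: w.
apply: (ler_cvg_to (cvgM lim lim) (cvg_cst (G w))).
by apply: nearW => n; exact: le.
Unshelve. all: by end_near. Qed.

Let i1G (k M : R) : P.-integrable setT (EFin \o (fun w => k * G w + M)).
Proof.
have iM : P.-integrable setT (EFin \o (fun _ : T => M)).
  exact: finite_measure_integrable_cst.
exact: (integrableD mT (integrableZl mT k iG) iM).
Qed.

Let seq_cvg (Z : nat -> T -> R) (Z' : T -> R) (k M : R) :
  (forall n, measurable_fun setT (Z n)) -> measurable_fun setT Z' ->
  {ae P, forall w, Z n w @[n --> \oo] --> Z' w} ->
  {ae P, forall w n, `|Z n w| <= k * G w + M} ->
  P.-integrable setT (EFin \o Z') /\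
  (\int[P]_w (Z n w)%:E @[n --> \oo] --> \int[P]_w (Z' w)%:E)%E.
Proof.
move=> mZ mZ' lim le.
have mE n : measurable_fun setT (fun w => (Z n w)%:E) by exact/measurable_EFinP.
have mE' : measurable_fun setT (fun w => (Z' w)%:E) by exact/measurable_EFinP.
have limE : {ae P, forall w, setT w -> (Z n w)%:E @[n --> \oo] --> (Z' w)%:E}.
  by apply: filterS lim => w h _; apply: cvg_EFin => //; exact: nearW.
have leE : {ae P, forall w n, setT w -> (`|(Z n w)%:E| <= (k * G w + M)%:E)%E}.
  by apply: filterS le => w h n _; rewrite abse_EFin lee_fin.
by have [h1 _ h2] := dominated_convergence mT mE mE' limE (i1G k M) leE.
Qed.

Let abs_le_sqr (x y : R) : x ^+ 2 <= y -> `|x| <= 1 * y + 1.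
Proof.
move=> xy; apply: (@le_trans _ _ (x ^+ 2 + 1)); last by rewrite mul1r lerD2r.
rewrite -(real_normK (num_real x)); have := sqr_ge0 (`|x| - 1).
by rewrite sqrrB1 -mulr_natl; have := normr_ge0 x; move: `|x| => u u0; lra.
Qed.

Let sqrB_le (x y z M : R) : x ^+ 2 <= z -> y ^+ 2 <= M -> (x - y) ^+ 2 <= 2 * z + 2 * M.
Proof. by move=> h1 h2; have := sqr_ge0 (x + y); rewrite sqrrD sqrrB; lra. Qed.

Lemma dominated_mean :
  [/\ P.-integrable setT (EFin \o C), forall n, P.-integrable setT (EFin \o Y n) &
   ('E_P[Y n] @[n --> \oo] --> 'E_P[C])%E].
Proof.
have leY1 : {ae P, forall w n, `|Y n w| <= 1 * G w + 1}.
  by apply: filterS leY => w h n; exact: abs_le_sqr.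
have [h1 h2] := seq_cvg mY mC limY leY1.
split => //; last by under eq_fun do rewrite mean_integral; rewrite mean_integral.
move=> n; have leYn : {ae P, forall w (k : nat), `|Y n w| <= 1 * G w + 1}.
  by apply: filterS leY1 => w h _; exact: h.
have limn : {ae P, forall w, Y n w @[_ --> \oo] --> Y n w}.
  by apply: aeW => w; exact: cvg_cst.
by have [] := seq_cvg (fun _ : nat => mY n) (mY n) limn leYn.
Qed.

Lemma dominated_L2 : (\int[P]_w ((Y n w - C w) ^+ 2)%:E @[n --> \oo] --> 0)%E.
Proof.
have mZ n : measurable_fun setT (fun w => (Y n w - C w) ^+ 2).
  by apply: measurable_funX; exact: measurable_funB.
have lim : {ae P, forall w, (Y n w - C w) ^+ 2 @[n --> \oo] --> (0 : R)}.
  apply: filterS limY => w h.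
  have h2 : Y n w - C w @[n --> \oo] --> C w - C w by apply: cvgB => //; exact: cvg_cst.
  by have h3 := cvgM h2 h2; rewrite subrr mulr0 in h3; exact: h3.
have le : {ae P, forall w n, `|(Y n w - C w) ^+ 2| <= 4 * G w + 0}.
  near=> w => n.
  have h1 : forall n, Y n w ^+ 2 <= G w by near: w.
  have h2 : C w ^+ 2 <= G w by near: w.
  rewrite ger0_norm ?sqr_ge0 //; apply: le_trans (sqrB_le (h1 n) h2) _; lra.
have [_] := seq_cvg mZ (measurable_cst (0 : R)) lim le.
by rewrite integral0.
Unshelve. all: by end_near. Qed.

Lemma dominated_variance : ('V_P[Y n] @[n --> \oo] --> 'V_P[C])%E.
Proof.
have [iC iY limE] := dominated_mean.
pose m n := fine 'E_P[Y n]%E; pose m' := fine 'E_P[C]%E.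
have finC : ('E_P[C] \is a fin_num)%E by rewrite mean_integral; exact: integrable_fin_num.
have limm : m n @[n --> \oo] --> m' by apply: fine_cvg; rewrite fineK.
have [M [M0 hM]] := cvg_seq_bounded (cvgP _ limm).
pose M1 := `|M| + 1.
have hm n : m n ^+ 2 <= M1 ^+ 2.
  rewrite -(real_normK (num_real (m n))); apply: lerXn2r; rewrite ?nnegrE ?addr_ge0 //.
  by apply: hM => //; rewrite /M1 ltr_pwDr // ler_norm.
have mZ n : measurable_fun setT (fun w => (Y n w - m n) ^+ 2).
  by apply: measurable_funX; exact: measurable_funB.
have mZ' : measurable_fun setT (fun w => (C w - m') ^+ 2).
  by apply: measurable_funX; exact: measurable_funB.
have lim : {ae P, forall w, (Y n w - m n) ^+ 2 @[n --> \oo] --> (C w - m') ^+ 2}.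
  apply: filterS limY => w h.
  have h2 : Y n w - m n @[n --> \oo] --> C w - m' by exact: cvgB.
  exact: (cvgM h2 h2).
have le : {ae P, forall w n, `|(Y n w - m n) ^+ 2| <= 2 * G w + 2 * M1 ^+ 2}.
  apply: filterS leY => w h n; rewrite ger0_norm ?sqr_ge0 //.
  exact: sqrB_le.
have [_] := seq_cvg mZ mZ' lim le.
by under eq_fun do rewrite -variance_integral; rewrite -variance_integral.
Qed.

End dominated.

Section dominated_pinfty.
Context d (T : measurableType d) (R : realType) (P : probability T R).
Context (Y : R -> T -> R) (C G : T -> R) (t1 : R).
Context (mY : forall t, t1 <= t -> measurable_fun setT (Y t)).
Context (mC : measurable_fun setT C).
Context (limY : {ae P, forall w, Y t w @[t --> +oo] --> C w}).
Context (iG : P.-integrable setT (EFin \o G)).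
Context (leY : {ae P, forall w t, t1 <= t -> Y t w ^+ 2 <= G w}).

Let Y1 t := Y (Num.max t t1).

Let t1_le t : t1 <= Num.max t t1. Proof. by rewrite le_max lexx orbT. Qed.

Let near_Y1 : \forall t \near +oo, Y1 t = Y t.
Proof.
near=> t; rewrite /Y1 max_l //; near: t; exact: nbhs_pinfty_ge.
Unshelve. all: by end_near. Qed.

Let leY1 (u : nat -> R) : {ae P, forall w n, Y1 (u n) w ^+ 2 <= G w}.
Proof. by apply: filterS leY => w h n; exact: h. Qed.

Let limY1 (u : nat -> R) : u n @[n --> \oo] --> +oo ->
  {ae P, forall w, Y1 (u n) w @[n --> \oo] --> C w}.
Proof.
move=> hu; apply: filterS limY => w h.
have h1 : Y1 t w @[t --> +oo] --> C w.
  apply: cvg_trans h; apply: near_eq_cvg.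
  by apply: filterS near_Y1 => t ->.
exact: (cvg_comp _ _ hu h1).
Qed.

Lemma dominated_mean_pinfty : 'E_P[Y t]%E @[t --> +oo] --> 'E_P[C]%E /\
  forall t, t1 <= t -> P.-integrable setT (EFin \o Y t).
Proof.
split.
- have h : 'E_P[Y1 t]%E @[t --> +oo] --> 'E_P[C]%E.
    apply/cvge_pinftyP => u hu.
    by have [] := dominated_mean (fun n => mY (t1_le (u n))) mC (limY1 hu) iG (leY1 u).
  apply: cvg_trans h; apply: near_eq_cvg.
  by apply: filterS near_Y1 => t ->.
- move=> t tt1.
  have limt : {ae P, forall w, Y t w @[_ --> \oo] --> Y t w}.
    by apply: aeW => w; exact: cvg_cst.
  have let_ : {ae P, forall w (n : nat), Y t w ^+ 2 <= G w}.
    by apply: filterS leY => w h _; exact: h.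
  by have [] := dominated_mean (fun _ : nat => mY tt1) (mY tt1) limt iG let_.
Qed.

Lemma dominated_variance_pinfty : 'V_P[Y t]%E @[t --> +oo] --> 'V_P[C]%E.
Proof.
have h : 'V_P[Y1 t]%E @[t --> +oo] --> 'V_P[C]%E.
  apply/cvge_pinftyP => u hu.
  exact: dominated_variance (fun n => mY (t1_le (u n))) mC (limY1 hu) iG (leY1 u).
apply: cvg_trans h; apply: near_eq_cvg.
by apply: filterS near_Y1 => t ->.
Qed.

End dominated_pinfty.

Section normal_limit.
Context d (T : measurableType d) (R : realType) (P : probability T R).

Let distr (Z : T -> R) (mZ : measurable_fun setT Z) : probability R R :=
  distribution P (mfun_Sub (mem_set mZ)).

(** The integral of a ramp, continuous and bounded, passes to the limit both in
    [Z_ n] and in [s_ n Z] for a standard normal [Z]. *)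
Lemma gauss_limit (Z_ : nat -> T -> R) (Z : T -> R) (s_ : nat -> R) (s : R) :
  (forall n, measurable_fun setT (Z_ n)) -> measurable_fun setT Z ->
  {ae P, forall w, Z_ n w @[n --> \oo] --> Z w} ->
  (forall n (A : set R), measurable A -> P (Z_ n @^-1` A) = gauss 0 (s_ n) A) ->
  s_ n @[n --> \oo] --> s ->
  forall A : set R, measurable A -> P (Z @^-1` A) = gauss 0 s A.
Proof.
move=> mZ_ mZ limZ law lims A mA.
have one d' (T' : measurableType d') (Q : probability T' R) :
    Q.-integrable setT (EFin \o (fun _ : T' => 1 : R)).
  exact: finite_measure_integrable_cst.
suff h : forall x k, (\int[distr mZ]_y (ramp x k y)%:E = \int[gauss 0 s]_y (ramp x k y)%:E)%E.
  exact: (prob_eq_ramp h mA).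
move=> x k; set h := ramp x k.
have mh : measurable_fun setT h by exact: measurable_ramp.
have h0 y : 0 <= h y by exact: ramp_ge0.
have h1 y : `|h y| <= 1 by rewrite ger0_norm // ramp_le1.
have ch : continuous h by exact: ramp_cont.
have lim d' (T' : measurableType d') (Q : probability T' R) (W_ : nat -> T' -> R) (W : T' -> R) :
    (forall n, measurable_fun setT (W_ n)) -> measurable_fun setT W ->
    {ae Q, forall w, W_ n w @[n --> \oo] --> W w} ->
    (\int[Q]_w (h (W_ n w))%:E @[n --> \oo] --> \int[Q]_w (h (W w))%:E)%E.
  move=> mW_ mW limW.
  have mE n : measurable_fun setT (fun w => (h (W_ n w))%:E).
    by apply/measurable_EFinP; exact: measurableT_comp.
  have mE' : measurable_fun setT (fun w => (h (W w))%:E).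
    by apply/measurable_EFinP; exact: measurableT_comp.
  have limE : {ae Q, forall w, setT w -> (h (W_ n w))%:E @[n --> \oo] --> (h (W w))%:E}.
    apply: filterS limW => w hw _; apply: cvg_EFin; first exact: nearW.
    exact: (cvg_comp _ _ hw (ch (W w))).
  have leE : {ae Q, forall w n, setT w -> (`|(h (W_ n w))%:E| <= (EFin \o (fun _ : T' => 1%R)) w)%E}.
    by apply: aeW => w n _; rewrite abse_EFin lee_fin.
  by have [] := dominated_convergence measurableT mE mE' limE (one _ _ Q) leE.
have l1 := lim _ _ P _ _ mZ_ mZ limZ.
have mA_ c : measurable_fun setT (affine (0 : R) c) by exact: measurable_affine.
have limN : {ae normal_prob 0 1, forall z, affine 0 (s_ n) z @[n --> \oo] --> affine 0 s z}.
  apply: aeW => z; apply: cvgD; first exact: cvg_cst.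
  by apply: cvgM => //; exact: cvg_cst.
have l2 := lim _ _ (normal_prob 0 1) _ _ (fun n => mA_ (s_ n)) (mA_ s) limN.
have e n : (\int[P]_w (h (Z_ n w))%:E = \int[normal_prob 0 1]_z (h (affine 0 (s_ n) z))%:E)%E.
  apply: (etrans (integral_law (mZ_ n) (law n) mh h0)).
  exact: ge0_integral_affine.
have e2 : (\int[P]_w (h (Z w))%:E = \int[normal_prob 0 1]_z (h (affine 0 s z))%:E)%E.
  have eF : (fun n => \int[P]_w (h (Z_ n w))%:E)%E =
      (fun n => \int[normal_prob 0 1]_z (h (affine 0 (s_ n) z))%:E)%E by exact/funext.
  by rewrite eF in l1; exact: (cvg_unique _ l1 l2).
have e3 : (\int[P]_w (h (Z w))%:E = \int[distr mZ]_y (h y)%:E)%E.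
  exact: integral_law.
apply: (etrans (esym e3)); apply: (etrans e2); apply: esym.
exact: ge0_integral_affine.
Qed.

Context (Z : T -> R) (s : R) (mZ : measurable_fun setT Z).
Context (law : forall A : set R, measurable A -> P (Z @^-1` A) = gauss 0 s A).

Lemma gauss_law_affine (m c : R) (A : set R) : measurable A ->
  P ((fun w => m + c * Z w) @^-1` A) = gauss m (c * s) A.
Proof.
move=> mA; have mA' : measurable [set x : R | A (m + c * x)].
  have mf : measurable_fun setT (fun x : R => m + c * x).
    by apply: measurable_funD => //; apply: measurable_funM.
  by rewrite -[X in measurable X]setTI; exact: mf.
apply: (etrans (law mA')); congr (normal_prob 0 1 _).
by apply/seteqP; split=> z; rewrite /= /affine add0r mulrA.
Qed.

Lemma gauss_law_normal (m c : R) : c * s != 0 ->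
  normal_rv P (fun w => m + c * Z w).
Proof.
move=> cs; exists m, `|c * s|; split; first by rewrite normr_gt0.
move=> A mA; apply: (etrans (gauss_law_affine m c mA)).
exact: (esym (normal_gauss m cs mA)).
Qed.

Lemma gauss_second_moment : (\int[P]_w (Z w ^+ 2)%:E = (s ^+ 2)%:E)%E.
Proof.
have m2 : measurable_fun setT (fun x : R => x ^+ 2) by exact: measurable_funX.
have p2 (x : R) : 0 <= x ^+ 2 by exact: sqr_ge0.
apply: (etrans (integral_law mZ law m2 p2)).
apply: (etrans (ge0_integral_affine _ 0 s m2 p2)).
under eq_integral do rewrite add0r exprMn EFinM.
rewrite ge0_integralZl //; last 3 first.
- by apply/measurable_EFinP.
- by move=> x _; rewrite lee_fin.
- by rewrite lee_fin.
by rewrite std_moment2 mule1.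
Qed.

Lemma gauss_integrable : P.-integrable setT (EFin \o Z).
Proof.
have i2 : P.-integrable setT (EFin \o (fun w => Z w ^+ 2)).
  apply/integrableP; split; first by apply/measurable_EFinP; exact: measurable_funX.
  under eq_integral do rewrite /= ger0_norm ?sqr_ge0 //.
  by rewrite gauss_second_moment ltry.
have lim : {ae P, forall w, Z w @[_ --> \oo] --> Z w}.
  by apply: aeW => w; exact: cvg_cst.
have le : {ae P, forall w (n : nat), Z w ^+ 2 <= Z w ^+ 2} by exact: aeW.
by have [] := dominated_mean (fun _ : nat => mZ) mZ lim i2 le.
Qed.

(** [Z] and [- Z] have the same law, hence [E (Z + 1)^2 = E (Z - 1)^2]. *)
Lemma gauss_mean0 : (\int[P]_w (Z w)%:E = 0)%E.
Proof.
have lawN (A : set R) : measurable A -> P ((fun w => - Z w) @^-1` A) = gauss 0 s A.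
  move=> mA; have e := gauss_law_affine 0 (-1) mA.
  rewrite mulN1r in e; apply: etrans (etrans e _).
    by congr (P _); apply/seteqP; split=> w; rewrite /= add0r mulN1r.
  by rewrite gauss_abs // normrN -gauss_abs.
have m2 : measurable_fun setT (fun x : R => (x + 1) ^+ 2).
  by apply: measurable_funX; exact: measurable_funD.
have p2 (x : R) : 0 <= (x + 1) ^+ 2 by exact: sqr_ge0.
have mN : measurable_fun setT (fun w => - Z w) by exact: measurableT_comp.
have e := etrans (integral_law mZ law m2 p2) (esym (integral_law mN lawN m2 p2)).
have iZ := gauss_integrable.
have i2 : P.-integrable setT (EFin \o (fun w => Z w ^+ 2)).
  apply/integrableP; split; first by apply/measurable_EFinP; exact: measurable_funX.
  under eq_integral do rewrite /= ger0_norm ?sqr_ge0 //.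
  by rewrite gauss_second_moment ltry.
have i1 : P.-integrable setT (EFin \o (fun _ : T => 1 : R)).
  exact: finite_measure_integrable_cst.
have expand (c : R) : \int[P]_w ((c * Z w + 1) ^+ 2) =
    c ^+ 2 * \int[P]_w (Z w ^+ 2) + 2 * c * \int[P]_w (Z w) + \int[P]_w (1 : R).
  have j1 := integrableZl measurableT (c ^+ 2) i2.
  have j2 := integrableZl measurableT (2 * c) iZ.
  have j3 := integrableD measurableT j1 j2.
  rewrite -(RintegralZl (c ^+ 2) measurableT i2) -(RintegralZl (2 * c) measurableT iZ).
  apply: (etrans _ (etrans (RintegralD measurableT j3 i1) _)).
    by apply: eq_Rintegral => w _ /=; ring.
  by congr (_ + _); exact: (RintegralD measurableT j1 j2).
have e1 := expand 1; have e2 := expand (-1).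
have e3 : \int[P]_w ((1 * Z w + 1) ^+ 2) = \int[P]_w ((-1 * Z w + 1) ^+ 2).
  rewrite /Rintegral; congr fine.
  under eq_integral do rewrite mul1r; under [RHS]eq_integral do rewrite mulN1r.
  exact: e.
have f := fineK (integrable_fin_num measurableT iZ).
rewrite -f; congr EFin; rewrite -/(Rintegral P setT Z).
move: e3; rewrite e1 e2; move: (\int[P]_w (Z w)) (\int[P]_w (Z w ^+ 2)) => u u2; lra.
Qed.

Lemma gauss_affine_mean (m c : R) : 'E_P[fun w => (m + c * Z w)%R]%E = m%:E.
Proof.
have im : P.-integrable setT (EFin \o (fun _ : T => m)).
  exact: finite_measure_integrable_cst.
have ic := integrableZl measurableT c gauss_integrable.
rewrite mean_integral.
apply: (etrans (integralD measurableT im ic)).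
rewrite [X in (_ + X)%E](integralZl measurableT gauss_integrable c) gauss_mean0 mule0 adde0.
exact: (etrans (esym (mean_integral P (cst m))) (expectation_cst P m)).
Qed.

Lemma gauss_affine_variance (m c : R) :
  'V_P[fun w => (m + c * Z w)%R]%E = ((c * s) ^+ 2)%:E.
Proof.
rewrite variance_integral gauss_affine_mean /=.
have e w : (m + c * Z w - m) ^+ 2 = c ^+ 2 * Z w ^+ 2 by ring.
under eq_integral do rewrite e EFinM.
rewrite ge0_integralZl //; last 3 first.
- by apply/measurable_EFinP; exact: measurable_funX.
- by move=> x _; rewrite lee_fin sqr_ge0.
- by rewrite lee_fin sqr_ge0.
by rewrite gauss_second_moment -EFinM exprMn.
Qed.

End normal_limit.

(** * The limit variable *)

Section seq_limit.
Context d (T : measurableType d) (R : realType).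

(** The pointwise limit, where there is one; elsewhere some value that keeps
    measurability. *)
Definition seq_limit (S : nat -> T -> R) (w : T) : R :=
  fine (limn_esup (fun n => (S n w)%:E)).

Lemma seq_limit_cvg (S : nat -> T -> R) w (x : R) :
  S n w @[n --> \oo] --> x -> seq_limit S w = x.
Proof.
move=> h; have hE : (S n w)%:E @[n --> \oo] --> x%:E.
  by apply: cvg_EFin => //; exact: nearW.
by rewrite /seq_limit is_cvg_limn_esupE; [rewrite (cvg_lim _ hE)|exact: cvgP hE].
Qed.

Lemma measurable_seq_limit (S : nat -> T -> R) :
  (forall n, measurable_fun setT (S n)) -> measurable_fun setT (seq_limit S).
Proof.
move=> mS.
have mL : measurable_fun setT (fun w => limn_esup (fun n => (S n w)%:E)).
  by apply: measurable_fun_limn_esup => n; exact/measurable_EFinP.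
exact: measurableT_comp mL.
Qed.

End seq_limit.

Section integral_of_weight.
Context d (T : measurableType d) (R : realType) (P : probability T R).
Context (B : R -> T -> R) (BM : brownian_motion P B) (f : R -> R).

Lemma weight_step_sum n w : step_integral B (weight_step f n) w =
  increment_sum B (grid n) (fun i => f (grid n i)) (n.+1 ^ 2) w.
Proof. by rewrite /step_integral big_grid_step. Qed.

Lemma weight_step_measurable n :
  measurable_fun setT (step_integral B (weight_step f n)).
Proof.
have -> := funext (weight_step_sum n).
by apply: (increment_sum_measurable BM); [rewrite grid0|exact: grid_le].
Qed.

(** The approximating sums are measurable for the sigma-algebra generated by
    [B], and [seq_limit] keeps this. *)
Lemma weight_integral_wrt c m : measurable_wrt (brownian_sigma_algebra P B)
  (fun w => m + c * seq_limit (fun n => step_integral B (weight_step f n)) w).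
Proof.
pose G := [set E | (exists s, exists A : set R,
  [/\ 0 <= s, measurable A & E = B s @^-1` A]) \/ P.-negligible E].
pose T' := g_sigma_algebraType G.
have mB t : 0 <= t -> measurable_fun (setT : set T') (B t : T' -> R).
  move=> t0 _ A mA; rewrite setTI; apply: sub_sigma_algebra.
  by left; exists t, A.
have mS n : measurable_fun (setT : set T') (step_integral B (weight_step f n) : T' -> R).
  have -> := funext (weight_step_sum n).
  apply: measurable_sum => i; apply: measurable_funM => //.
  by apply: measurable_funB; apply: mB; exact: grid_ge0.
have mL := measurable_seq_limit mS.
have mC : measurable_fun (setT : set T')
    (fun w : T' => m + c * seq_limit (fun n => step_integral B (weight_step f n) : T' -> R) w).
  by apply: measurable_funD => //; exact: measurable_funM.
by move=> A mA; have := mC measurableT A mA; rewrite setTI.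
Qed.

Lemma weight_step_law n (A : set R) : measurable A ->
  P (step_integral B (weight_step f n) @^-1` A) =
  gauss 0 (Num.sqrt (\sum_(i < n.+1 ^ 2) f (grid n i) ^+ 2 *
                       (grid n i.+1 - grid n i))) A.
Proof.
move=> mA; have -> := funext (weight_step_sum n).
by apply: (increment_sum_law BM _ _ _ _ mA); [rewrite grid0|exact: grid_le].
Qed.

End integral_of_weight.

Section weight_data.
Context {R : realType} (a b : R) (v v' : R -> R) (a0 : 0 < a).
Local Notation mu := (@lebesgue_measure R).
Context (dv : forall t : R, 0 < t ->
  is_derive t 1 v (v' t) /\ is_derive t 1 v' (a * v' t + b / t * v t)).
Context (lv : t `^ (b / a) * v t @[t --> +oo] --> a `^ (- (b / a))).
Context (lv' : t `^ (b / a) * v' t @[t --> +oo] --> (0 : R)).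
Context (f : R -> R) (fE : forall t, 0 <= t -> f t = a^-1 * wt a v t).

Let f' t := a^-1 * wt' a v v' t.

Let cwt (t : R) : 0 <= t -> {for t, continuous (fun s => a^-1 * wt a v s)}.
Proof.
move=> t0; have t1 : -1 < t by lra.
exact: is_drv_cont (is_drvZ a^-1 (wt_drv dv t1)).
Qed.

Let cwt' (t : R) : 0 <= t -> {for t, continuous f'}.
Proof.
move=> t0; have t1 : -1 < t by lra.
by apply: cvgM; [exact: cvg_cst|exact: (wt'_cont dv t1)].
Qed.

Lemma weight_data : exists K, [/\ {within `[0, +oo[, continuous f},
  {within `[0, +oo[, continuous f'},
  forall x y, 0 <= x -> x <= y -> \int[mu]_(t in `[x, y]) f' t = f y - f x,
  (forall t, 0 <= t -> `|f t| <= K * expR (- (a / 2) * t)) /\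
  (forall t, 0 <= t -> `|f' t| <= K * expR (- (a / 2) * t)) &
  0 < \int[mu]_(s in `[0, +oo[) f s ^+ 2].
Proof.
have [K K0 hK] := wt_bound a0 dv lv lv'.
have ai : 0 < a^-1 by rewrite invr_gt0.
have cf : {within `[0, +oo[, continuous f}.
  apply: (@subspace_eq_continuous _ _ _ (fun s => a^-1 * wt a v s)).
    by move=> t; rewrite inE /= in_itv /= andbT => /fE.
  exact: cont_itv0y.
have bf t : 0 <= t -> `|f t| <= (a^-1 * K) * expR (- (a / 2) * t).
  move=> t0; rewrite fE // normrM (gtr0_norm ai) -mulrA mulNr ler_pM2l //.
  by have [] := hK t t0.
exists (a^-1 * K); split => //.
- exact: cont_itv0y.
- move=> x y x0 xy; rewrite !fE ?(le_trans x0) //.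
  have sub t : (`[x, y]%classic : set R) t -> 0 <= t.
    by rewrite /= in_itv /= => /andP[h _]; exact: le_trans h.
  have c1 : {within `[x, y], continuous f'} by apply: cont_within => t /sub; exact: cwt'.
  have c2 : {within `[x, y], continuous (fun s => a^-1 * wt a v s)}.
    by apply: cont_within => t /sub; exact: cwt.
  have d1 (t : R) : x < t < y -> is_derive t 1 (fun s => a^-1 * wt a v s) (f' t).
    move=> /andP[xt _]; have t1 : -1 < t by lra.
    exact: (is_drvZ a^-1 (wt_drv dv t1)).
  exact: (FTC2_itv xy c1 c2 d1).
- split => // t t0; rewrite normrM (gtr0_norm ai) -mulrA mulNr ler_pM2l //.
  by have [] := hK t t0.
have [t0 t01 ht] := weights_asymp a0 lv lv'.
have t00 : 0 <= t0 by lra.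
have tS : t0 <= t0 + 1 by lra.
have cf0 : {within `[t0, t0 + 1], continuous f}.
  apply: within_cont_sub cf => t; rewrite /= !in_itv /= andbT => /andP[h _].
  exact: le_trans h.
have [c hc hmin] := EVT_min tS cf0.
have fpos t : t0 <= t -> 0 < f t.
  move=> h; rewrite fE ?(le_trans t00) // mulr_gt0 //.
  by have [] := ht t h.
have fc : 0 < f c by apply: fpos; move: hc; rewrite in_itv /= => /andP[].
apply: (@Rintegral_gt0 _ _ _ t0 (t0 + 1) (f c ^+ 2)).
- apply: (@exp_le_integrable _ _ ((a^-1 * K) ^+ 2) a a0).
    exact: (within_measurable (within_contM cf cf)).
  move=> t h; rewrite normrX.
  have -> : (a^-1 * K) ^+ 2 * expR (- (a * t)) = (a^-1 * K * expR (- (a / 2) * t)) ^+ 2.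
    by rewrite [RHS]exprMn [X in _ = _ * X]expr2 -expRD; congr (_ * expR _); field.
  apply: lerXn2r; rewrite ?nnegrE //; last exact: bf.
  by rewrite !mulr_ge0 ?expR_ge0 // ltW.
- by move=> t _; exact: sqr_ge0.
- by lra.
- move=> t; rewrite /= !in_itv /= andbT => /andP[h _]; exact: le_trans h.
- by rewrite exprn_gt0.
- move=> t ht'; apply: lerXn2r; rewrite ?nnegrE ?(ltW fc) //.
    by apply: ltW; apply: fpos; have /andP[] := ht'.
  by apply: hmin; rewrite in_itv /= ht'.
Qed.

Lemma wiener_path_weight (H : R) (B : R -> R) : exp_growth a H B ->
  wiener_path a v v' B = a * weight_limit f f' B.
Proof.
move=> gB; have an : a != 0 by rewrite gt_eqF.
rewrite /wiener_path /weight_limit fE //.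
have i := wt'B_integrable a0 dv lv lv' gB.
have m0 : measurable (`[0%R, +oo[%classic : set (measurableTypeR R)) by [].
have -> : \int[mu]_(s in `[0, +oo[) (f' s * B s) =
    a^-1 * \int[mu]_(s in `[0, +oo[) (wt' a v v' s * B s).
  rewrite -(RintegralZl a^-1 m0 i); apply: eq_Rintegral => s _.
  by rewrite /f' mulrA.
move: (\int[mu]_(s in _) _) => G; move: (wt a v 0) (B 0) => x y.
by field.
Qed.

End weight_data.

Theorem theorem4p2 (d : measure_display) (T : measurableType d) (R : realType)
    (P : probability T R) (F : R -> set (set T)) (B : R -> T -> R)
    (a b sigma : R) (psi : R -> R) (X : R -> T -> R)
    (P_complete : measure_is_complete P)
    (F_usual : usual_filtration P F)
    (B_brownian : brownian_motion P B)
    (B_adapted : adapted F B)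
    (sigma_gt0 : 0 < sigma)
    (a_gt0 : 0 < a)
    (psi_continuous : {within `[-1, 0], continuous psi})
    (X_solution : average_sde_solution P F B a b sigma psi X) :
  exists C : {RV P >-> R},
    (* (a) *)
    [/\ measurable_wrt (brownian_sigma_algebra P B) C,
        normal_rv P C &
        {ae P, forall w,
           X t w / (expR (a * t) * t `^ (b / a)) @[t --> +oo] --> C w}] /\
    (* (b) *)
    (exists J : T -> R,
       is_wiener_integral P B
         (fun s => expR (- (a * s)) * (1 + s) *
                   tricomiU (1 + b / a) 2 (a * (1 + s))) J /\
       {ae P, forall w,
          C w = limit_mean a b psi + sigma * a `^ (1 + b / a) * J w}) /\
    (* (c) *)
    [/\ 'E_P[C]%E = (limit_mean a b psi)%:E,
        'V_P[C]%E =
          ((sigma ^+ 2 * a `^ (2 + 2 * b / a))%R%:E *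
           \int[lebesgue_measure]_(s in `[0%R, +oo[)
             (expR (- (2 * a * s)) * (1 + s) ^+ 2 *
              tricomiU (1 + b / a) 2 (a * (1 + s)) ^+ 2)%R%:E)%E &
        (0 < 'V_P[C])%E] /\
    (* (d) *)
    [/\ ('E_P[X t] * ((expR (a * t) * t `^ (b / a))^-1)%R%:E)%E
          @[t --> +oo] --> 'E_P[C]%E &
        ('V_P[X t] * ((expR (2 * a * t) * t `^ (2 * b / a))^-1)%R%:E)%E
          @[t --> +oo] --> 'V_P[C]%E].
Proof.
have [v [v' [dv lv lv' vE v1']]] := decaying_solution b a_gt0.
have an : a != 0 by rewrite gt_eqF.
set f := fun s : R => expR (- (a * s)) * (1 + s) * tricomiU (1 + b / a) 2 (a * (1 + s)).
have fE (t : R) : 0 <= t -> f t = a^-1 * wt a v t.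
  move=> t0; rewrite /f /wt vE; last by lra.
  by move: (tricomiU _ _ _) (expR _) => u e; field.
have [K [cf cf' df [bf bf'] intf0]] := weight_data a_gt0 dv lv lv' fE.
pose f' t := a^-1 * wt' a v v' t; rewrite -/f' in cf' df bf'.
(* [brownian_growth] doubles the rate, and [exp_growth] asks for [a / 4]. *)
have a8 : 0 < a / 8 by rewrite divr_gt0.
have [H [mH iH2 growthH]] := brownian_growth B_brownian a8.
have growth : {ae P, forall w, exp_growth a (H w) (B ^~ w)}.
  apply: filterS growthH => w [h1 h2]; split => // t t0.
  by have := h2 t t0; have -> : 2 * (a / 8) * t = a / 4 * t by field.
pose S n := step_integral B (weight_step f n).
have mS n : measurable_fun setT (S n) by exact: (weight_step_measurable B_brownian f n).
pose J := seq_limit S.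
have mJ : measurable_fun setT J by exact: measurable_seq_limit.
have limS : {ae P, forall w, S n w @[n --> \oo] --> weight_limit f f' (B ^~ w)}.
  by apply: filterS growth => w; exact: (weight_step_cvg a_gt0 cf' df bf bf').
have JE : {ae P, forall w, J w = weight_limit f f' (B ^~ w)}.
  by apply: filterS limS => w; exact: seq_limit_cvg.
have limJ : {ae P, forall w, S n w @[n --> \oo] --> J w}.
  by apply: filterS2 limS JE => w h ->.
pose var := \int[lebesgue_measure]_(s in `[0, +oo[) f s ^+ 2.
have lawJ (A : set R) : measurable A -> P (J @^-1` A) = gauss 0 (Num.sqrt var) A.
  apply: (gauss_limit mS mJ limJ (weight_step_law B_brownian f)).
  exact: (cvg_comp _ _ (weight_var_cvg a_gt0 cf bf) (@sqrt_continuous R var)).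
pose c := sigma * a `^ (1 + b / a).
have c0 : 0 < c by rewrite mulr_gt0 // powR_gt0.
pose m := limit_mean a b psi.
pose Cf w := m + c * J w.
have mC : measurable_fun setT Cf.
  by apply: measurable_funD => //; exact: measurable_funM.
have sd0 : c * Num.sqrt var != 0 by rewrite mulf_neq0 ?gt_eqF // sqrtr_gt0.
pose x0 := psi 0.
pose i0 := \int[lebesgue_measure]_(s in `[-1, 0]) psi s.
have [t1 [KX [t11 KX0 hX]]] := path_limit a_gt0 sigma_gt0 dv lv lv' x0 i0.
have [XF Xae] := X_solution.
have CE w : exp_growth a (H w) (B ^~ w) -> J w = weight_limit f f' (B ^~ w) ->
    a `^ (b / a) * (v 1 * x0 - v' 1 * i0 + sigma * wiener_path a v v' (B ^~ w)) = Cf w.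
  move=> gw Jw; rewrite (wiener_path_weight a_gt0 dv lv lv' fE gw) -/f' -Jw.
  rewrite vE // v1' mulr1 /Cf /m /c /limit_mean powRD; last by rewrite an implybT.
  rewrite powRr1 ?ltW // -/x0 -/i0.
  by move: (tricomiU _ _ _) (tricomiU _ _ _) (a `^ _) (J w) => *; ring.
have pathX : {ae P, forall w,
    (X t w / (expR (a * t) * t `^ (b / a)) @[t --> +oo] --> Cf w) /\
    forall t, t1 <= t -> (X t w / (expR (a * t) * t `^ (b / a))) ^+ 2 <= KX * (1 + H w ^+ 2)}.
  near=> w.
  have gw : exp_growth a (H w) (B ^~ w) by near: w.
  have Jw : J w = weight_limit f f' (B ^~ w) by near: w.
  have [cX X0 Xeq] : [/\ {within `[-1, +oo[, continuous (fun t => X t w)},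
        forall t, -1 <= t <= 0 -> X t w = psi t &
        forall t, 0 <= t ->
          X t w = X 0 w
            + \int[lebesgue_measure]_(s in `[0, t])
                (a * X s w + b / (1 + s) *
                   \int[lebesgue_measure]_(u in `[-1, s]) X u w)
            + sigma * (B t w - B 0 w)] by near: w.
  rewrite -(CE w gw Jw); apply: (hX (H w) (X ^~ w) (B ^~ w) gw cX Xeq).
    by rewrite X0 // lerN10 lexx.
  by apply: eq_Rintegral => s; rewrite inE /= in_itv /= => hs; exact: X0.
have iG : P.-integrable setT (EFin \o (fun w => KX * (1 + H w ^+ 2))).
  have i1 : P.-integrable setT (EFin \o (fun _ : T => 1 : R)).
    exact: finite_measure_integrable_cst.
  exact: (integrableZl measurableT KX (integrableD measurableT i1 iH2)).
pose Y t w := X t w / (expR (a * t) * t `^ (b / a)).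
have mX t : 0 <= t -> measurable_fun setT (X t).
  move=> t0 _ A mA; rewrite setTI; have [hF _ _ _] := F_usual.
  by have [_ sub] := hF t t0; apply: sub; exact: XF.
have mY t : t1 <= t -> measurable_fun setT (Y t).
  move=> tt1; apply: measurable_funM => //; apply: mX.
  by apply: le_trans tt1; apply: le_trans t11.
have limY : {ae P, forall w, Y t w @[t --> +oo] --> Cf w}.
  by apply: filterS pathX => w [].
have leY : {ae P, forall w t, t1 <= t -> Y t w ^+ 2 <= KX * (1 + H w ^+ 2)}.
  by apply: filterS pathX => w [].
have [limEY iY] := dominated_mean_pinfty mY mC limY iG leY.
have limVY := dominated_variance_pinfty mY mC limY iG leY.
have EC : 'E_P[Cf]%E = m%:E by exact: (gauss_affine_mean mJ lawJ m c).
have VC : 'V_P[Cf]%E = ((c * Num.sqrt var) ^+ 2)%:E.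
  exact: (gauss_affine_variance mJ lawJ m c).
have [C CC] : exists C : {RV P >-> R}, (C : T -> R) = Cf.
  by exists (mfun_Sub (mem_set mC)).
exists C; rewrite CC; split; [|split; [|split]].
- split.
  + exact: weight_integral_wrt.
  + exact: (gauss_law_normal lawJ m sd0).
  + exact: limY.
- exists J; split; last by apply: aeW => w.
  split; [exact: (within_measurable cf)|exact: mJ|].
  exists (weight_step f); split.
  + by move=> n q; exact: grid_step_mem.
  + exact: (weight_step_L2 a_gt0 cf bf).
  + pose M := K * (2 + expR (a / 4) *
      \int[lebesgue_measure]_(s in `]0, +oo[) expR (- (a / 4 * s))).
    have iM : P.-integrable setT (EFin \o (fun w => M ^+ 2 * H w ^+ 2)).
      exact: (integrableZl measurableT (M ^+ 2) iH2).
    have leS : {ae P, forall w n, S n w ^+ 2 <= M ^+ 2 * H w ^+ 2}.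
      apply: filterS growth => w gw n.
      have h := weight_step_le a_gt0 cf' df bf bf' gw n.
      rewrite -exprMn -(real_normK (num_real (S n w))).
      have h0 := le_trans (normr_ge0 _) h.
      by apply: lerXn2r; rewrite ?nnegrE.
    exact: (dominated_L2 mS mJ limJ iM leS).
- split; first exact: EC.
  + have varE : (\int[lebesgue_measure]_(s in `[0%R, +oo[) (f s ^+ 2)%:E = var%:E)%E.
      move: intf0; rewrite /var /Rintegral; case: (integral _ _ _) => [r||] //=;
      by rewrite ltxx.
    have fE2 (s : R) : expR (- (2 * a * s)) * (1 + s) ^+ 2 *
        tricomiU (1 + b / a) 2 (a * (1 + s)) ^+ 2 = f s ^+ 2.
      rewrite /f !exprMn; congr (_ * _ * _).
      by rewrite [RHS]expr2 -expRD; congr expR; ring.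
    under eq_integral do rewrite fE2.
    rewrite varE VC -EFinM exprMn sqr_sqrtr ?(ltW intf0) // /c exprMn.
    have -> // : a `^ (2 + 2 * b / a) = (a `^ (1 + b / a)) ^+ 2.
    have -> : 2 + 2 * b / a = (1 + b / a) + (1 + b / a) by field.
    by rewrite [LHS]powRD ?expr2 // an implybT.
  + by rewrite VC lte_fin exprn_even_gt0.
have gpos t : t1 <= t -> 0 < expR (a * t) * t `^ (b / a).
  by move=> tt1; rewrite mulr_gt0 ?expR_gt0 // powR_gt0 //; lra.
have XY t w : t1 <= t -> X t w = Y t w * (expR (a * t) * t `^ (b / a)).
  by move=> tt1; rewrite /Y divfK // gt_eqF // gpos.
have EX t : t1 <= t -> 'E_P[X t]%E = ('E_P[Y t] * (expR (a * t) * t `^ (b / a))%:E)%E.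
  move=> tt1; rewrite !mean_integral -(integralZr measurableT (iY t tt1)).
  by apply: eq_integral => w _; rewrite (XY t w tt1) EFinM.
have finE t : t1 <= t -> ('E_P[Y t] \is a fin_num)%E.
  by move=> tt1; rewrite mean_integral; exact: (integrable_fin_num measurableT (iY t tt1)).
split.
- apply: cvg_trans limEY; apply: near_eq_cvg; near=> t.
  have tt1 : t1 <= t by near: t; apply: nbhs_pinfty_ge; exact: num_real.
  have g0 := gpos t tt1; rewrite EX // -muleA -EFinM divff ?mule1 //.
  by rewrite gt_eqF.
- apply: cvg_trans limVY; apply: near_eq_cvg; near=> t.
  have tt1 : t1 <= t by near: t; apply: nbhs_pinfty_ge; exact: num_real.
  have g0 := gpos t tt1; have t0 : 0 < t by lra.
  have -> : expR (2 * a * t) * t `^ (2 * b / a) = (expR (a * t) * t `^ (b / a)) ^+ 2.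
    rewrite exprMn !expr2 -expRD -powRD; last by rewrite (gt_eqF t0) implybT.
    by congr (expR _ * t `^ _); [ring|field].
  rewrite !variance_integral EX // fineM ?finE //=.
  move: (fine _) => u.
  have -> : (\int[P]_w ((X t w - u * (expR (a * t) * t `^ (b / a))) ^+ 2)%:E =
      ((expR (a * t) * t `^ (b / a)) ^+ 2)%:E * \int[P]_w ((Y t w - u) ^+ 2)%:E)%E.
    rewrite -ge0_integralZl //; last 3 first.
    - apply/measurable_EFinP; apply: measurable_funX; apply: measurable_funB => //.
      exact: mY.
    - by move=> w _; rewrite lee_fin sqr_ge0.
    - by rewrite lee_fin sqr_ge0.
    apply: eq_integral => w _; rewrite (XY t w tt1) -EFinM; congr EFin.
    by move: (expR _ * _) => g; ring.
  rewrite muleAC -EFinM divff ?mul1e //.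
  by rewrite expf_neq0 // gt_eqF.
Unshelve. all: by end_near. Qed.
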